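(* Let $\mathcal{R}=\mathbb{C}[[z^4,\,z^{2u}+z^v]]\subset\mathcal{O}=\mathbb{C}[[z]]$, where $u,v$ are positive integers with $\gcd(uv,2)=1$ and $v>2u$. Let $\mathcal{D}=\{D_0\subset D_1\subset\cdots\subset D_m\}$, $D_i=D_0\cup\{g_1,\dots,g_i\}$ with $g_1<g_2<\cdots<g_m$, be an admissible $D$-flag. Then the variety $J^m_{\mathcal{R}}[\mathcal{D}]$ is isomorphic to an affine space $\mathbb{A}^N$ with $$N=\dim J_{\mathcal{R}}[D_0]+\sum_{i=0}^{m-1}\mu_{D_i,g_{i+1}},$$ where $\mu_{D,g}=\dim J^1_{\mathcal{R}}[D,g]-\dim J_{\mathcal{R}}[D]$. Moreover, for $D=D_i$, $g=g_{i+1}$, or more generally for any admissible $D$-set $D$ and $g\notin\Gamma\cup D$ such that $D\cup\{g\}$ is an admissible $D$-set, one has, with $\Delta=\Gamma\cup D$ and $\Delta'=\Delta\cup\{g\}$: $$\mu_{D,g}=\gamma_{\Delta'}(g)-\gamma_{\Delta'}(g+4)\quad\text{if } g\equiv 1\text{ or }3 \pmod 4,$$ $$\mu_{D,g}=\gamma_{\Delta'}(g)-\gamma_{\Delta'}(g+4)-\bigl(\gamma_{\Delta'}(g+n)-\gamma_{\Delta'}(g+4+n)\bigr)\quad\text{if } g\equiv 2 \pmod 4,$$ where $n=n(D)$ is the smallest odd number in $(\Delta\cup\{v\})\cap[2u,\infty)$.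
   Context: Let $\nu$ be the $z$-adic valuation (order of vanishing) on $\mathcal{O}=\mathbb{C}[[z]]$. $\Gamma=\{\nu(x): 0\neq x\in\mathcal{R}\}$ is the valuation semigroup of $\mathcal{R}$, $G=\mathbb{Z}_{+}\setminus\Gamma$ ($\mathbb{Z}_+=\{0,1,2,\dots\}$) is its finite set of gaps, and $\delta=|G|$; one has $z^{2\delta}\mathcal{O}\subset\mathcal{R}$. A standard $\mathcal{R}$-module is an $\mathcal{R}$-submodule $\mathcal{M}\subset\mathcal{O}$ containing an element of valuation $0$. Put $\Delta_{\mathcal{M}}=\{\nu(x):0\ne x\in\mathcal{M}\}$ and $D_{\mathcal{M}}=\Delta_{\mathcal{M}}\setminus\Gamma$. A standard $\Gamma$-module is a subset $\Delta\subset\mathbb{Z}_+$ with $0\in\Delta$ and $\Gamma+\Delta\subset\Delta$; a $D$-set is a set of the form $D=\Delta\setminus\Gamma$ for a standard $\Gamma$-module $\Delta$ (so $\Delta=\Gamma\cup D$). A $D$-set $D$ is admissible if $D=D_{\mathcal{M}}$ for some standard module $\mathcal{M}$. A $D$-flag of length $m\geq 0$ is a sequence $\mathcal{D}=\{D_0, D_1=D_0\cup\{g_1\},\dots,D_m=D_0\cup\{g_1,\dots,g_m\}\}$ of $D$-sets with $g_i\in G\setminus D_0$ and $g_1<g_2<\cdots<g_m$. Set $$J^m_{\mathcal{R}}[\mathcal{D}]=\bigl\{\mathcal{M}_0\subset\mathcal{M}_1\subset\cdots\subset\mathcal{M}_m \;:\; \mathcal{M}_i \text{ standard } \mathcal{R}\text{-modules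 with } D_{\mathcal{M}_i}=D_i \text{ for } 0\le i\le m\bigr\}.$$ The $D$-flag $\mathcal{D}$ is admissible if $J^m_{\mathcal{R}}[\mathcal{D}]\neq\varnothing$. For $m=0$ write $J_{\mathcal{R}}[D]$, and for $m=1$, $D_0=D$, $D_1=D\cup\{g\}$, write $J^1_{\mathcal{R}}[D,g]$. Every standard module $\mathcal{M}$ contains $z^{2\delta}\mathcal{O}$ and $\dim_{\mathbb{C}}\mathcal{M}/z^{2\delta}\mathcal{O}=\delta+|D_{\mathcal{M}}|$, so $J^m_{\mathcal{R}}[\mathcal{D}]$ is regarded as a (locally closed) subvariety of the product of Grassmannians $\prod_{i=0}^m Gr(\mathcal{O}/z^{2\delta}\mathcal{O},\,\delta+|D_i|)$. For $\Delta\subset\mathbb{Z}_+$ with finite complement, the gap counting function is $\gamma_\Delta(\ell)=|[\ell,\infty)\setminus\Delta|$, the number of integers $k\ge\ell$ with $k\notin\Delta$. *)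

(* Defs.v *)
From HB Require Import structures.
From mathcomp Require Import all_boot all_order all_algebra.
From mathcomp Require Import finmap boolp classical_sets cardinality reals.
From mathcomp Require Import complex mpoly.

Set Implicit Arguments.
Unset Strict Implicit.
Unset Printing Implicit Defensive.

Import Order.TTheory GRing.Theory Num.Theory.
Local Open Scope classical_set_scope.
Local Open Scope ring_scope.

(* [f k] is the coefficient of z^k. *)
Definition pseries (K : Type) : Type := nat -> K.

Section PowerSeriesRing.
Context {K : comNzRingType}.
Implicit Types f g h : pseries K.

HB.instance Definition _ := gen_eqMixin (pseries K).
HB.instance Definition _ := gen_choiceMixin (pseries K).

Definition ps_zero : pseries K := fun=> 0.
Definition ps_one : pseries K := fun k => (k == 0)%:R.
Definition ps_opp f : pseries K := fun k => - f k.
Definition ps_add f g : pseries K := fun k => f k + g k.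
Definition ps_mul f g : pseries K :=
  fun k => \sum_(i < k.+1) f i * g (k - i)%N.

Fact ps_addA : associative ps_add.
Proof. by move=> f g h; apply: funext => k; rewrite /ps_add addrA. Qed.
Fact ps_addC : commutative ps_add.
Proof. by move=> f g; apply: funext => k; rewrite /ps_add addrC. Qed.
Fact ps_add0 : left_id ps_zero ps_add.
Proof. by move=> f; apply: funext => k; rewrite /ps_add add0r. Qed.
Fact ps_addN : left_inverse ps_zero ps_opp ps_add.
Proof. by move=> f; apply: funext => k; rewrite /ps_add /ps_opp addNr. Qed.

HB.instance Definition _ :=
  GRing.isZmodule.Build (pseries K) ps_addA ps_addC ps_add0 ps_addN.

Definition ps_poly (n : nat) f : {poly K} := \poly_(i < n) f i.

Lemma coef_ps_poly n f k : (k < n)%N -> (ps_poly n f)`_k = f k.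
Proof. by move=> kn; rewrite coef_poly kn. Qed.

Lemma ps_mulE n f g k :
  (k < n)%N -> ps_mul f g k = (ps_poly n f * ps_poly n g)`_k.
Proof.
move=> kn; rewrite coefM; apply: eq_bigr => i _.
rewrite !coef_ps_poly //; first by apply: leq_ltn_trans kn; exact: leq_subr.
by apply: leq_trans kn; exact: ltn_ord.
Qed.

Fact ps_mulC : commutative ps_mul.
Proof.
by move=> f g; apply: funext => k; rewrite !(@ps_mulE k.+1) // mulrC.
Qed.

Fact ps_mulA : associative ps_mul.
Proof.
move=> f g h; apply: funext => k.
transitivity ((ps_poly k.+1 f * (ps_poly k.+1 g * ps_poly k.+1 h))`_k).
  rewrite coefM; apply: eq_bigr => i _.
  by rewrite coef_ps_poly // -ps_mulE // ltnS leq_subr.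
rewrite mulrA coefM; apply: eq_bigr => i _.
by rewrite [X in _ * X]coef_ps_poly -?ps_mulE // ltnS leq_subr.
Qed.

Fact ps_mul1 : left_id ps_one ps_mul.
Proof.
move=> f; apply: funext => k; rewrite /ps_mul big_ord_recl /ps_one /= mul1r.
by rewrite subn0 big1 ?addr0 // => i _; rewrite mul0r.
Qed.

Fact ps_mulDl : left_distributive ps_mul ps_add.
Proof.
move=> f g h; apply: funext => k; rewrite /ps_add /ps_mul -big_split /=.
by apply: eq_bigr => i _; rewrite mulrDl.
Qed.

Fact ps_one_neq0 : ps_one != 0 :> pseries K.
Proof.
apply/eqP => /(congr1 (fun f : pseries K => f 0%N)) /eqP.
by rewrite [X in X == _](_ : _ = 1) // oner_eq0.
Qed.

HB.instance Definition _ := GRing.Zmodule_isComNzRing.Build (pseries K)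
  ps_mulA ps_mulC ps_mul1 ps_mulDl ps_one_neq0.

Definition ps_var : pseries K := fun k => (k == 1)%:R.

(* The substitution c(x, y) = \sum_(i, j) c i j x^i y^j, for x and y with
   zero constant term: x^i y^j then has order at least i + j, so the terms
   with i > k or j > k do not contribute to the coefficient of z^k. *)
Definition ps_subst2 (c : nat -> nat -> K) (x y : pseries K) : pseries K :=
  fun k => \sum_(i < k.+1) \sum_(j < k.+1)
             c i j * (x ^+ i * y ^+ j : pseries K) k.

(* K[[x, y]] as a subset of K[[z]]: the image of the substitution map. *)
Definition ps_gen2 (x y : pseries K) : set (pseries K) :=
  range (fun c => ps_subst2 c x y).

Definition has_val f (k : nat) : Prop :=
  f k != 0 /\ forall j, (j < k)%N -> f j = 0.

Definition valset (M : set (pseries K)) : set nat :=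
  [set k | exists2 f, M f & has_val f k].

Definition ps_trunc (n : nat) f : 'rV[K]_n := \row_j f j.

End PowerSeriesRing.

(* A set of points covered by coordinate charts.  Each chart is identified,
   via its coordinates, with a subset of the affine space K^index. *)
Record atlas (K : fieldType) := Atlas {
  point :> Type;
  chart : Type;
  index : finType;
  chart_dom : chart -> set point;
  chart_coord : chart -> point -> index -> K }.

Section Zariski.
Context {K : fieldType}.

Definition chart_poly (P : atlas K) : Type := {mpoly K[#|index P|]}.

Definition chart_eval (P : atlas K) (c : chart P) (p : chart_poly P)
    (x : P) : K := p.@[fun a => chart_coord c x (enum_val a)].

Definition basic_open (P : atlas K) (c : chart P) (q : chart_poly P) : set P :=
  [set x | chart_dom c x /\ chart_eval c q x != 0].

(* Subsets X of an atlas carry the induced Zariski topology, and regular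
   functions are the functions that are locally quotients of polynomials in
   the coordinates of a chart. *)
Definition zopen (P : atlas K) (X U : set P) : Prop :=
  U `<=` X /\ forall x, U x -> exists c q,
    basic_open c q x /\ X `&` basic_open c q `<=` U.

Definition zclosed (P : atlas K) (X Z : set P) : Prop :=
  Z `<=` X /\ zopen X (X `\` Z).

Definition regular_on (P : atlas K) (U : set P) (f : P -> K) : Prop :=
  forall x, U x -> exists c p q, basic_open c q x /\
    forall y, U y -> basic_open c q y ->
      f y = chart_eval c p y / chart_eval c q y.

Definition morphism (P Q : atlas K) (X : set P) (Y : set Q) (phi : P -> Q)
    : Prop :=
  [/\ forall x, X x -> Y (phi x),
      forall V, zopen Y V -> zopen X (X `&` phi @^-1` V)
    & forall V f, zopen Y V -> regular_on V f ->
        regular_on (X `&` phi @^-1` V) (f \o phi)].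

Definition isomorphic (P Q : atlas K) (X : set P) (Y : set Q) : Prop :=
  exists phi psi, [/\ morphism X Y phi, morphism Y X psi,
    forall x, X x -> psi (phi x) = x & forall y, Y y -> phi (psi y) = y].

Definition irreducible_closed (P : atlas K) (X Z : set P) : Prop :=
  [/\ zclosed X Z, Z !=set0 &
    forall Z1 Z2, zclosed X Z1 -> zclosed X Z2 ->
      Z `<=` Z1 `|` Z2 -> Z `<=` Z1 \/ Z `<=` Z2].

Definition irreducible_chain (P : atlas K) (X : set P) (d : nat)
    (Z : nat -> set P) : Prop :=
  (forall i, (i <= d)%N -> irreducible_closed X (Z i)) /\
  (forall i, (i < d)%N -> Z i `<` Z i.+1).

(* [has_dim X d]: the Krull dimension of X is d (in particular X is not
   empty). *)
Definition has_dim (P : atlas K) (X : set P) (d : nat) : Prop :=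
  (exists Z, irreducible_chain X d Z) /\
  (forall e Z, irreducible_chain X e Z -> (e <= d)%N).

Definition affine_space (N : nat) : atlas K :=
  {| point := 'rV[K]_N; chart := unit; index := 'I_N;
     chart_dom := fun _ => setT; chart_coord := fun _ x a => x 0 a |}.

Definition grass (n k : nat) : Type := {V : {vspace 'rV[K]_n} | \dim V == k}.

Definition grass_mx n k (V : grass n k) : 'M[K]_(k, n) :=
  \matrix_(a, b) (vbasis (val V))`_a 0 b.

(* The product of the Grassmannians Gr(K^n, k i).  A chart of Gr(K^n, k) is
   given by a choice s of k columns: on the set where the minor of these
   columns does not vanish, the coordinates of V are the entries of the unique
   matrix with row space V and identity submatrix on these columns. *)
Definition grass_prod (I : finType) (n : nat) (k : I -> nat) : atlas K :=
  {| point := forall i, grass n (k i);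
     chart := forall i, 'I_(k i) -> 'I_n;
     index := {i : I & 'I_(k i) * 'I_n}%type;
     chart_dom := fun s V => forall i, colsub (s i) (grass_mx (V i)) \in unitmx;
     chart_coord := fun s V a => let: existT i (r, b) := a in
       (invmx (colsub (s i) (grass_mx (V i))) *m grass_mx (V i)) r b |}.

End Zariski.

Arguments affine_space : clear implicits.

(* The cardinality of S if S is finite, and 0 otherwise. *)
Definition fcard (S : set nat) : nat := #|` fset_set S|%fset.

Definition gap_count (Delta : set nat) (l : nat) : nat :=
  fcard [set k | (l <= k)%N /\ ~ Delta k].

Section Flags.
Context {K : fieldType}.
Variable A : set (pseries K).

Definition gaps : set nat := ~` valset A.

Definition delta : nat := fcard gaps.

Definition standard_module (M : set (pseries K)) : Prop :=
  [/\ M 0, forall f g, M f -> M g -> M (f + g),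
      forall a f, A a -> M f -> M (a * f) & exists2 f, M f & has_val f 0].

Definition Dset_of (M : set (pseries K)) : set nat := valset M `\` valset A.

Definition standard_gmodule (Delta : set nat) : Prop :=
  Delta 0 /\ forall a b, valset A a -> Delta b -> Delta (a + b)%N.

Definition is_Dset (D : set nat) : Prop :=
  exists2 Delta, standard_gmodule Delta & D = Delta `\` valset A.

Definition admissible (D : set nat) : Prop :=
  exists2 M, standard_module M & Dset_of M = D.

(* A D-flag of length m is encoded by D_0 and the tuple (g_1, ..., g_m). *)
Definition flag_set (m : nat) (D0 : set nat) (g : m.-tuple nat) (i : nat)
    : set nat := D0 `|` [set x | x \in take i g].

Definition is_flag (m : nat) (D0 : set nat) (g : m.-tuple nat) : Prop :=
  [/\ sorted ltn g, forall x, x \in (g : seq nat) -> gaps x /\ ~ D0 x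
    & forall i : 'I_m.+1, is_Dset (flag_set D0 g i)].

Definition module_flags (m : nat) (D0 : set nat) (g : m.-tuple nat)
    : set ('I_m.+1 -> set (pseries K)) :=
  [set M | (forall i j : 'I_m.+1, (i <= j)%N -> M i `<=` M j) /\
           (forall i, standard_module (M i) /\
                      Dset_of (M i) = flag_set D0 g i)].

Definition admissible_flag (m : nat) (D0 : set nat) (g : m.-tuple nat) : Prop :=
  is_flag D0 g /\ module_flags D0 g !=set0.

(* The product of the Grassmannians Gr(O / z^(2 delta) O, delta + |D_i|), the
   class of a series modulo z^(2 delta) being its row of coefficients. *)
Definition flag_space (m : nat) (D0 : set nat) (g : m.-tuple nat) : atlas K :=
  grass_prod (delta + delta)
    (fun i : 'I_m.+1 => (delta + fcard (flag_set D0 g i))%N).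

Definition J (m : nat) (D0 : set nat) (g : m.-tuple nat)
    : set (flag_space D0 g) :=
  [set V : flag_space D0 g | exists2 M, module_flags D0 g M &
    forall i x, x \in val (V i) <->
                exists2 f, M i f & x = ps_trunc (delta + delta) f].

Arguments J {m} D0 g _.

Definition J0 (D : set nat) := J D [tuple].

Arguments J0 D _ : clear implicits.

Definition J1 (D : set nat) (h : nat) := J D [tuple h].

Arguments J1 D h _ : clear implicits.

(* mu_(D, h) = k; as a relation because dimensions are only defined for
   nonempty varieties. *)
Definition has_mu (D : set nat) (h : nat) (k : int) : Prop :=
  exists d1 d0, [/\ has_dim (J1 D h) d1, has_dim (J0 D) d0
                  & k = d1%:Z - d0%:Z].

End Flags.

Arguments J {K} A {m} D0 g _.
Arguments J0 {K} A D _.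
Arguments J1 {K} A D h _.

Definition ring4uv (K : fieldType) (u v : nat) : set (pseries K) :=
  ps_gen2 (ps_var ^+ 4) (ps_var ^+ (2 * u) + ps_var ^+ v).
Arguments ring4uv : clear implicits.

(* n = n(D), where Delta is the Gamma-module of D. *)
Definition smallest_odd (u v : nat) (Delta : set nat) (n : nat) : Prop :=
  let S := [set k | [/\ odd k, Delta k \/ k = v & (2 * u <= k)%N]] in
  S n /\ forall k, S k -> (n <= k)%N.

(* Main.v *)
(* Put x = z^4 and f = z^(2u) + z^v.  A module M is generated over C[[x]] by four
   elements m_0 = w, m_1, m_2, m_3 whose orders are the least elements a_0 = 0,
   a_1, a_2, a_3 of its set of orders Delta in the residue classes mod 4; reduced
   at Delta, they are unique.  After division by w, stability under f only has to
   be tested on 1 and m_2, because f raises the order of odd elements beyond every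
   gap.  The resulting equations are triangular: each one determines one
   coefficient of the m_c by coefficients of smaller relative order, so the
   remaining coefficients are free and the modules form an affine space.  In a
   flag, the module M* obtained by adjoining the new element of order congruent to
   2 mod 4, if there is one, varies in an affine space in the same way; M_0 is cut
   out of M* by a linear functional and the elements of odd order are adjoined by
   choosing an element of x^-1 M_0, and all of these choices are free.  Since the
   coordinates are polynomials in both directions in a single chart of the product
   of Grassmannians, this gives the isomorphism, and the dimension of affine space
   follows from the linear dependence of the monomials in more than N polynomials
   in N variables.  Counting the free coordinates, the contribution of g depends
   only on the generators of Delta beyond g, and for g congruent to 2 mod 4 the
   admissibility of Delta with g adjoined (it contains v or v + g) turns the number
   of equations gained into the difference of gap counts at g + n. *)

Require Import Defs.
From HB Require Import structures.
From mathcomp Require Import all_boot all_order all_algebra.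
From mathcomp Require Import finmap boolp classical_sets cardinality reals.
From mathcomp Require Import complex mpoly.
From mathcomp Require Import zify ring.

Set Implicit Arguments.
Unset Strict Implicit.
Unset Printing Implicit Defensive.

Import Order.TTheory GRing.Theory Num.Theory.
Local Open Scope classical_set_scope.
Local Open Scope ring_scope.

(** * Maps given by polynomials in a single chart *)

Section PolynomialFunctions.
Context {K : fieldType}.

(** Each g_i + b with b > 0 in Gamma lies in Delta_0, because it exceeds every element adjoined so
    far. Hence g_i is a_c - 4 for its class c, each of the classes 1, 2, 3 contains at most one g_i,
    and the elements of M_i of order beyond g_i already lie in M_0. The choices made for different
    g_i therefore do not interact. The obstacle is the g congruent to 2. Adjoining to M_0 an element
    W of order g requires f W in M_0, a condition on W of the same kind as the equations for M_0
    itself. Going down from M* removes it: f M* has orders at least 2u, beyond g, and elements of M*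
    of order beyond g lie in M_0 automatically, so the functional cutting out M_0 only has to keep
    the order g out. The equations are solvable exactly when v or v + a_2 lies in Delta. If both are
    gaps, the coordinate of f m_2 at v + a_2 is the constant 2, with no unknown to cancel it. *)

Definition polyfun (P : atlas K) (X : set P) (c : chart P) (F : P -> K) :=
  exists p : chart_poly P, forall x, X x -> chart_eval c p x = F x.

Section Closure.
Variables (P : atlas K) (X : set P) (c : chart P).
Implicit Types F G : P -> K.
Local Notation pf := (polyfun X c).

Lemma polyfun_ext F G : (forall x, X x -> F x = G x) -> pf F -> pf G.
Proof. by move=> FG [p pF]; exists p => x Xx; rewrite pF ?FG. Qed.

Lemma polyfun_cst a : pf (fun=> a).
Proof. by exists a%:MP => x _; rewrite /chart_eval mevalC. Qed.

Lemma polyfun_coord i : pf (fun x => chart_coord c x i).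
Proof.
by exists 'X_(enum_rank i) => x _; rewrite /chart_eval mevalXU enum_rankK.
Qed.

Lemma polyfun_add F G : pf F -> pf G -> pf (fun x => F x + G x).
Proof.
move=> [p pF] [q qG]; exists (p + q) => x Xx.
by rewrite /chart_eval mevalD -pF // -qG.
Qed.

Lemma polyfun_mul F G : pf F -> pf G -> pf (fun x => F x * G x).
Proof.
move=> [p pF] [q qG]; exists (p * q) => x Xx.
by rewrite /chart_eval mevalM -pF // -qG.
Qed.

Lemma polyfun_opp F : pf F -> pf (fun x => - F x).
Proof.
move=> pF; have := polyfun_mul (polyfun_cst (-1)) pF.
by apply: polyfun_ext => x _; rewrite mulN1r.
Qed.

Lemma polyfun_sub F G : pf F -> pf G -> pf (fun x => F x - G x).
Proof. by move=> pF pG; apply: polyfun_add => //; apply: polyfun_opp. Qed.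

Lemma polyfun_sum (I : Type) (r : seq I) (Q : pred I) (F : I -> P -> K) :
  (forall i, Q i -> pf (F i)) -> pf (fun x => \sum_(i <- r | Q i) F i x).
Proof.
move=> pF; elim: r => [|i r IHr].
  by apply: polyfun_ext (polyfun_cst 0) => x _; rewrite big_nil.
case Qi: (Q i); last by apply: polyfun_ext IHr => x _; rewrite big_cons Qi.
apply: polyfun_ext (polyfun_add (pF i Qi) IHr) => x _.
by rewrite big_cons Qi.
Qed.

Lemma polyfun_prod (I : Type) (r : seq I) (Q : pred I) (F : I -> P -> K) :
  (forall i, Q i -> pf (F i)) -> pf (fun x => \prod_(i <- r | Q i) F i x).
Proof.
move=> pF; elim: r => [|i r IHr].
  by apply: polyfun_ext (polyfun_cst 1) => x _; rewrite big_nil.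
case Qi: (Q i); last by apply: polyfun_ext IHr => x _; rewrite big_cons Qi.
apply: polyfun_ext (polyfun_mul (pF i Qi) IHr) => x _.
by rewrite big_cons Qi.
Qed.

Lemma polyfun_exp F n : pf F -> pf (fun x => F x ^+ n).
Proof.
move=> pF; elim: n => [|n IHn]; first exact: polyfun_cst.
by apply: polyfun_ext (polyfun_mul pF IHn) => x _; rewrite exprS.
Qed.

Lemma polyfun_det k (F : P -> 'M[K]_k) :
  (forall i j, pf (fun x => F x i j)) -> pf (fun x => \det (F x)).
Proof.
move=> pF; apply: polyfun_sum => s _; apply: polyfun_mul.
  exact: polyfun_cst.
by apply: polyfun_prod => i _; apply: pF.
Qed.

Lemma polyfun_if (b : bool) F G : pf F -> pf G ->
  pf (fun x => if b then F x else G x).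
Proof. by case: b. Qed.

End Closure.

Lemma polyfun_comp (P Q : atlas K) (X : set P) (Y : set Q) (c : chart P)
    (d : chart Q)
    (phi : P -> Q) F :
    (forall x, X x -> Y (phi x)) ->
    (forall a, polyfun X c (fun x => chart_coord d (phi x) a)) ->
  polyfun Y d F -> polyfun X c (F \o phi).
Proof.
move=> XY pphi [p peF].
have [l pl] : exists l : #|Defs.index Q|.-tuple (chart_poly P),
    forall x i, X x ->
      chart_eval c (tnth l i) x = chart_coord d (phi x) (enum_val i).
  have /choice[l pl] (i : 'I_#|Defs.index Q|) : exists p : chart_poly P,
      forall x, X x -> chart_eval c p x = chart_coord d (phi x) (enum_val i).
    exact: pphi.
  by exists [tuple l i | i < _] => x i Xx; rewrite tnth_mktuple pl.
exists (p \mPo l) => x Xx /=; rewrite /chart_eval comp_mpoly_meval.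
rewrite -peF; last exact: XY.
by apply: meval_eq => i; rewrite -pl.
Qed.

(* All of Y lies in the chart d, and every other chart is obtained from d by a
   change of coordinates with a single polynomial denominator. *)
Definition single_chart (Q : atlas K) (Y : set Q) (d : chart Q) : Prop :=
  (forall y, Y y -> chart_dom d y) /\
  forall c, exists D : Q -> K, [/\ polyfun Y d D,
    forall y, Y y -> chart_dom c y <-> D y != 0
    & forall a, exists2 N, polyfun Y d N &
        forall y, Y y -> D y != 0 -> chart_coord c y a = N y / D y].

Lemma single_chart_eval (Q : atlas K) (Y : set Q) (d c : chart Q) D
    (p : chart_poly Q) :
    polyfun Y d D ->
    (forall a, exists2 N, polyfun Y d N &
       forall y, Y y -> D y != 0 -> chart_coord c y a = N y / D y) ->
  exists N r, polyfun Y d N /\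
    forall y, Y y -> D y != 0 -> chart_eval c p y = N y / D y ^+ r.
Proof.
move=> pD crd.
pose good (p : chart_poly Q) := exists N r, polyfun Y d N /\
    forall y, Y y -> D y != 0 -> chart_eval c p y = N y / D y ^+ r.
have goodC a : good a%:MP.
  exists (fun=> a), 0%N; split; first exact: polyfun_cst.
  by move=> y _ _; rewrite /chart_eval mevalC expr0 divr1.
have goodM p1 p2 : good p1 -> good p2 -> good (p1 * p2).
  move=> [N1 [r1 [pN1 N1E]]] [N2 [r2 [pN2 N2E]]].
  exists (fun y => N1 y * N2 y), (r1 + r2)%N; split; first exact: polyfun_mul.
  move=> y Yy Dy; rewrite /chart_eval mevalM -!/(chart_eval c _ y) N1E // N2E //.
  by rewrite exprD invfM mulrACA.
have goodD p1 p2 : good p1 -> good p2 -> good (p1 + p2).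
  move=> [N1 [r1 [pN1 N1E]]] [N2 [r2 [pN2 N2E]]].
  exists (fun y => N1 y * D y ^+ r2 + N2 y * D y ^+ r1), (r1 + r2)%N; split.
    by apply: polyfun_add; apply: polyfun_mul => //; apply: polyfun_exp.
  move=> y Yy Dy; rewrite /chart_eval mevalD -!/(chart_eval c _ y) N1E // N2E //.
  by rewrite exprD; field; rewrite !expf_neq0.
have goodX i : good 'X_i.
  have [N pN NE] := crd (enum_val i); exists N, 1%N; split => // y Yy Dy.
  by rewrite /chart_eval mevalXU NE.
suff: good p by [].
elim/mpolyind: p => [|a m p _ _ IHp]; first exact: goodC.
apply/goodD => //; rewrite -mul_mpolyC; apply/goodM => //.
rewrite mpolyXE_id; apply: (big_ind good) => // [|i _]; first exact: goodC.
elim: (m i) => [|k IHk]; first by rewrite expr0; apply/goodC.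
by rewrite exprS; apply/goodM.
Qed.

Lemma polynomial_morphism (P Q : atlas K) (X : set P) (Y : set Q) (c : chart P)
    (d : chart Q)
    (phi : P -> Q) :
    (forall x, X x -> chart_dom c x) -> single_chart Y d ->
    (forall x, X x -> Y (phi x)) ->
    (forall a, polyfun X c (fun x => chart_coord d (phi x) a)) ->
  morphism X Y phi.
Proof.
move=> Xc [_ chY] XY pphi.
(* Expressed in the chart d, the basic open set of q in any chart e becomes D N != 0 with D and N
   polynomial, so its preimage in X is a basic open set of the chart c. *)
have pull e : exists D : P -> K, polyfun X c D /\
    forall q : chart_poly Q, exists N r, [/\ polyfun X c N,
      forall x, X x -> basic_open e q (phi x) <-> D x != 0 /\ N x != 0 &
      forall x, X x -> D x != 0 -> chart_eval e q (phi x) = N x / D x ^+ r].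
  have [D [pD domD crd]] := chY e.
  exists (D \o phi); split; first exact: polyfun_comp pphi pD.
  move=> q; have [N [r [pN NE]]] := single_chart_eval q pD crd.
  have evE x : X x -> D (phi x) != 0 ->
      chart_eval e q (phi x) = N (phi x) / D (phi x) ^+ r.
    by move=> Xx Dx; apply: NE => //; apply: XY.
  exists (N \o phi), r; split => //; first exact: polyfun_comp pphi pN.
  move=> x Xx /=; split.
    move=> [] /(domD _ (XY _ Xx)) Dn0; rewrite evE // mulf_eq0.
    by case/norP.
  move=> [Dn0 Nn0]; split; first exact/(domD _ (XY _ Xx)).
  by rewrite evE // mulf_neq0 // invr_neq0 // expf_neq0.
split=> // [V [_ Vop]|V f [_ Vop] regf].
- split=> [x []//|x [Xx Vx]].
  have [e [q [bx bV]]] := Vop _ Vx.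
  have [D [pD /(_ q)[N [r [pN bE _]]]]] := pull e.
  have [p pE] := polyfun_mul pD pN.
  have bP y : X y -> chart_eval c p y != 0 <-> basic_open e q (phi y).
    move=> Xy; rewrite pE // mulf_eq0 negb_or.
    by split => [/andP/(bE _ Xy)|/(bE _ Xy)/andP].
  exists c, p; split; first by split; [exact: Xc | exact/bP].
  move=> y [Xy [_ /bP-/(_ Xy) byy]]; split => //=.
  by apply: bV; split; [exact: XY | exact: byy].
- move=> x [Xx Vx].
  have [e [p [q [bx fE]]]] := regf _ Vx.
  have [D [pD pl]] := pull e.
  have [N1 [r1 [pN1 _ e1]]] := pl p; have [N2 [r2 [pN2 b2 e2]]] := pl q.
  (* One more factor D than needed in numerator and denominator: the new denominator then vanishes
     wherever D does, and its basic open set is exactly the preimage. *)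
  have [P2 PE] := polyfun_mul pN1 (polyfun_exp r2.+1 pD).
  have [Q2 QE] := polyfun_mul pN2 (polyfun_exp r1.+1 pD).
  have bP y : X y -> chart_eval c Q2 y != 0 <-> basic_open e q (phi y).
    move=> Xy; rewrite QE // mulf_eq0 expf_eq0 /= negb_or.
    split => [/andP[? ?]|/b2-/(_ Xy)[-> ->]//]; exact/b2.
  exists c, P2, Q2; split; first by split; [exact: Xc | exact/bP].
  move=> y [Xy Vy] [_ /bP-/(_ Xy) byy].
  have /b2-/(_ Xy)[Dn0 Nn0] := byy.
  rewrite /= fE // PE // QE // e1 // e2 // !exprS.
  by field; rewrite Dn0 Nn0 !expf_neq0.
Qed.

Lemma isomorphic_of_polynomial (P Q : atlas K) (X : set P) (Y : set Q)
    (c : chart P) (d : chart Q)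
    (phi : P -> Q) (psi : Q -> P) :
    single_chart X c -> single_chart Y d ->
    (forall x, X x -> Y (phi x)) -> (forall y, Y y -> X (psi y)) ->
    (forall a, polyfun X c (fun x => chart_coord d (phi x) a)) ->
    (forall a, polyfun Y d (fun y => chart_coord c (psi y) a)) ->
    (forall x, X x -> psi (phi x) = x) -> (forall y, Y y -> phi (psi y) = y) ->
  isomorphic X Y.
Proof.
move=> sX sY XY YX pphi ppsi psiK phiK; exists phi, psi; split => //.
  by apply: polynomial_morphism pphi => //; case: sX.
by apply: polynomial_morphism ppsi => //; case: sY.
Qed.

Lemma affine_space_single_chart N (Y : set (affine_space K N)) :
  single_chart Y (tt : chart (affine_space K N)).
Proof.
split=> // -[]; exists (fun=> 1); split => [|y _|a].
- exact: polyfun_cst.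
- by rewrite oner_neq0.
- exists (chart_coord (tt : chart (affine_space K N)) ^~ a).
    exact: polyfun_coord.
  by move=> y _ _; rewrite divr1.
Qed.

(** With E the matrix normalised in the chart d, the chart c is the locus where the minors of E on
    the columns of c do not vanish, and Cramer's rule gives its coordinates. The product of these
    minors over all factors serves as the common denominator. *)
Lemma grass_prod_single_chart (I : finType) (n : nat) (k : I -> nat)
    (Y : set (@grass_prod K I n k)) (d : chart (@grass_prod K I n k)) :
  (forall y, Y y -> chart_dom d y) -> single_chart Y d.
Proof.
move=> Yd; split=> // c.
pose E (y : @grass_prod K I n k) i : 'M[K]_(k i, n) :=
  invmx (colsub (d i) (grass_mx (y i))) *m grass_mx (y i).
have pE i r b : polyfun Y d (fun y => E y i r b).
  exact: (polyfun_coord Y d (existT _ i (r, b))).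
pose Dt i (y : @grass_prod K I n k) := \det (colsub (c i) (E y i)).
have pDt i : polyfun Y d (Dt i).
  apply: polyfun_det => r b.
  by apply: polyfun_ext (pE i r (c i b)) => y _; rewrite !mxE.
have colE y i : colsub (c i) (E y i) =
    invmx (colsub (d i) (grass_mx (y i))) *m colsub (c i) (grass_mx (y i)).
  by rewrite /E mulmx_colsub.
exists (fun y => \prod_i Dt i y); split.
- by apply: polyfun_prod.
- move=> y Yy; split.
    move=> cy; apply/prodf_neq0 => i _.
    rewrite /Dt -unitfE -[_ \is a _]/(_ \in unitmx) colE unitmx_mul unitmx_inv.
    by rewrite (Yd _ Yy) cy.
  move=> /prodf_neq0 Dn0 i; have := Dn0 i isT.
  rewrite /Dt -unitfE -[_ \is a _]/(_ \in unitmx) colE unitmx_mul.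
  by case/andP.
- case=> i [r b].
  exists (fun y => (\adj (colsub (c i) (E y i)) *m E y i) r b *
                   \prod_(j | j != i) Dt j y).
    apply: polyfun_mul; last by apply: polyfun_prod.
    suff : polyfun Y d (fun y => \sum_j \adj (colsub (c i) (E y i)) r j * E y i j b).
      by apply: polyfun_ext => y _; rewrite mxE.
    apply: polyfun_sum => j _; apply: polyfun_mul => //.
    apply: (@polyfun_ext _ _ _ (fun y => cofactor (colsub (c i) (E y i)) j r)).
      by move=> y _; rewrite mxE.
    apply: polyfun_mul; first exact: polyfun_cst.
    apply: polyfun_det => r' b'.
    by apply: polyfun_ext (pE i (lift j r') (c i (lift r b'))) => y _; rewrite !mxE.
  move=> y Yy Dn0.
  have uE : colsub (c i) (E y i) \in unitmx.
    by rewrite unitmxE unitfE; move/prodf_neq0: Dn0 => /(_ i isT).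
  have -> : chart_coord c y (existT _ i (r, b)) =
      (invmx (colsub (c i) (E y i)) *m E y i) r b.
    rewrite colE /= /E.
    have := Yd _ Yy i; rewrite /= => ud.
    have uc : colsub (c i) (grass_mx (y i)) \in unitmx.
      by move: uE; rewrite colE unitmx_mul => /andP[].
    have -> : invmx (invmx (colsub (d i) (grass_mx (y i))) *m
                     colsub (c i) (grass_mx (y i))) =
              invmx (colsub (c i) (grass_mx (y i))) *m
                     colsub (d i) (grass_mx (y i)).
      apply: (can_inj (mulKmx uE)); rewrite colE mulmxV -?colE // colE.
      by rewrite -mulmxA mulKVmx // mulVmx.
    by rewrite -mulmxA mulKVmx.
  rewrite /invmx uE -scalemxAl mxE -/(Dt i y) [\prod_j Dt j y](bigD1 i) //=.
  have /prodf_neq0 Dn := Dn0; have Di := Dn i isT.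
  have P0 : \prod_(j | j != i) Dt j y != 0 by apply/prodf_neq0 => j _; apply: Dn.
  by field; rewrite Di P0.
Qed.

End PolynomialFunctions.

(** * The dimension of affine space *)

Section Dimension.
Context {K : fieldType}.

Lemma zclosed_preimage (P Q : atlas K) (X : set P) (Y : set Q) phi Z :
  morphism X Y phi -> zclosed Y Z -> zclosed X (X `&` phi @^-1` Z).
Proof.
move=> [XY cont _] [ZY opZ]; split; first by move=> x [].
suff -> : X `\` (X `&` phi @^-1` Z) = X `&` phi @^-1` (Y `\` Z) by exact: cont.
apply/seteqP; split=> x [Xx].
  by move=> nZ; split => //; split; [exact: XY | move=> Zx; apply: nZ].
by move=> [_ nZ]; split => // -[_ /nZ].
Qed.

Lemma irreducible_closed_transfer (P Q : atlas K) (X : set P) (Y : set Q)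
    phi psi Z :
    morphism X Y phi -> morphism Y X psi ->
    (forall x, X x -> psi (phi x) = x) -> (forall y, Y y -> phi (psi y) = y) ->
  irreducible_closed X Z -> irreducible_closed Y (Y `&` psi @^-1` Z).
Proof.
move=> mphi mpsi psiK phiK [clZ [z Zz] irrZ].
have ZX : Z `<=` X by case: clZ.
have XY : forall x, X x -> Y (phi x) by case: mphi.
split; first exact: zclosed_preimage mpsi clZ.
  exists (phi z); split; first exact/XY/ZX.
  by rewrite /= psiK //; apply: ZX.
move=> Z1 Z2 cl1 cl2 sub.
case: (irrZ _ _ (zclosed_preimage mphi cl1) (zclosed_preimage mphi cl2)).
- move=> x Zx; have Xx := ZX _ Zx.
  have [|h|h] := sub (phi x); [|by left|by right].
  by split; [exact: XY | rewrite /= psiK].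
- move=> s; left=> y [Yy Zy]; rewrite -(phiK y Yy).
  by case: (s _ Zy).
- move=> s; right=> y [Yy Zy]; rewrite -(phiK y Yy).
  by case: (s _ Zy).
Qed.

Lemma irreducible_chain_transfer (P Q : atlas K) (X : set P) (Y : set Q)
    phi psi e Z :
    morphism X Y phi -> morphism Y X psi ->
    (forall x, X x -> psi (phi x) = x) -> (forall y, Y y -> phi (psi y) = y) ->
  irreducible_chain X e Z -> irreducible_chain Y e (fun i => Y `&` psi @^-1` Z i).
Proof.
move=> mphi mpsi psiK phiK [irr lt]; split=> i ie.
  by apply: irreducible_closed_transfer mphi mpsi _ _ _ => //; apply: irr.
have [sub nsub] := lt i ie; split.
  by move=> y [Yy Zy]; split => //; apply: sub.
move=> sub'; apply: nsub => x Zx.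
have ZX : Z i.+1 `<=` X by have [[]] := irr i.+1 ie.
have XY : forall x, X x -> Y (phi x) by case: mphi.
have [] := sub' (phi x); first by split; [apply/XY/ZX|rewrite /= psiK //; apply: ZX].
by rewrite /= psiK //; apply: ZX.
Qed.

Lemma isomorphic_has_dim (P Q : atlas K) (X : set P) (Y : set Q) d :
  isomorphic X Y -> has_dim Y d -> has_dim X d.
Proof.
move=> [phi [psi [mphi mpsi psiK phiK]]] [[Z chZ] max]; split.
  by eexists; apply: irreducible_chain_transfer mpsi mphi phiK psiK chZ.
move=> e W chW; apply: max.
exact: irreducible_chain_transfer mphi mpsi psiK phiK chW.
Qed.

Lemma dependent_of_card (T : Type) (A B : finType) (F : A -> T -> K)
    (G : B -> T -> K) :
    (#|B| < #|A|)%N ->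
    (forall a, exists c : B -> K, forall x, F a x = \sum_b c b * G b x) ->
  exists2 w : A -> K, exists a, w a != 0 &
    forall x, \sum_a w a * F a x = 0.
Proof.
move=> ltBA /choice[c FE].
pose C : 'M[K]_(#|A|, #|B|) := \matrix_(i, j) c (enum_val i) (enum_val j).
have : kermx C != 0.
  rewrite kermx_eq0 /row_free neq_ltn; apply/orP; left.
  by apply: leq_ltn_trans ltBA; apply: rank_leq_col.
case/rowV0Pn=> r /sub_kermxP rC rn0.
have [j rj] : exists j, r 0 j != 0.
  apply/existsP; apply: contraNT rn0; rewrite negb_exists => /forallP r0.
  by apply/eqP/rowP => j; rewrite mxE; apply/eqP; have := r0 j; rewrite negbK.
exists (fun a => r 0 (enum_rank a)).
  by exists (enum_val j); rewrite enum_valK.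
move=> x; under eq_bigr do rewrite FE mulr_sumr.
rewrite exchange_big big1 //= => b _.
transitivity ((\sum_a r 0 (enum_rank a) * c a b) * G b x).
  by rewrite mulr_suml; apply: eq_bigr => a _; rewrite mulrA.
suff -> : \sum_a r 0 (enum_rank a) * c a b = (r *m C) 0 (enum_rank b).
  by rewrite rC mxE mul0r.
rewrite mxE (reindex _ (onW_bij _ (enum_rank_bij A))) /=.
by apply: eq_bigr => a _; rewrite !mxE !enum_rankK.
Qed.

Lemma card_bmultinom n b : (#|{: 'X_{1..n < b}}| <= b ^ n)%N.
Proof.
have ltb (m : 'X_{1..n < b}) (i : 'I_n) : ((m : 'X_{1..n}) i < b)%N.
  apply: leq_ltn_trans (bmdeg m); rewrite mdegE (bigD1 i) //=.
  exact: leq_addr.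
pose f (m : 'X_{1..n < b}) : {ffun 'I_n -> 'I_b} := [ffun i => Ordinal (ltb m i)].
suff /leq_card : injective f by rewrite card_ffun !card_ord.
move=> m m' /ffunP ff; apply/val_inj/mnmP => i.
by have := congr1 val (ff i); rewrite !ffunE.
Qed.

Lemma msizeM_leq n (p q : {mpoly K[n]}) a b :
  (msize p <= a.+1 -> msize q <= b.+1 -> msize (p * q) <= (a + b).+1)%N.
Proof.
have [->|p0] := eqVneq p 0; first by rewrite mul0r msize0.
have [->|q0] := eqVneq q 0; first by rewrite mulr0 msize0.
rewrite msizeM //; move: (msize p) (msize q) => k l; lia.
Qed.

Lemma monomials_dependent n e (f : 'I_e -> {mpoly K[n]}) : (n < e)%N ->
  exists D (w : {ffun 'I_e -> 'I_D} -> K), (exists a, w a != 0) /\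
    forall x, \sum_a w a * (\prod_i f i ^+ a i).@[x] = 0.
Proof.
move=> ne.
pose d := (\max_i msize (f i))%N.
(* There are D^e products with exponents below D, and they involve at most ((e d + 1) D)^n
   monomials; this D makes D^(n+1) exceed that number. *)
pose D := ((e * d).+1 ^ n).+1.
have sz (a : {ffun 'I_e -> 'I_D}) :
    (msize (\prod_i f i ^+ a i) <= (e * (D * d)).+1)%N.
  have szX i k : (msize (f i ^+ k) <= (k * d).+1)%N.
    elim: k => [|k IHk]; first by rewrite expr0 msize1.
    rewrite exprS mulSn; apply: msizeM_leq => //; apply: leqW.
    exact: leq_bigmax.
  have : (msize (\prod_i f i ^+ a i) <= (\sum_(i < e) a i * d).+1)%N.
    elim/big_ind2 : _ => [|p k q l hp hq|i _]; first by rewrite msize1.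
      exact: msizeM_leq.
    exact: szX.
  move=> /leq_trans; apply; rewrite ltnS.
  apply: (@leq_trans (\sum_(i < e) D * d)).
    by apply: leq_sum => i _; rewrite leq_mul2r ltnW ?orbT.
  by rewrite sum_nat_const card_ord.
pose b := (e * (D * d)).+1.
have lt : (#|{: 'X_{1..n < b}}| < #|{ffun 'I_e -> 'I_D}|)%N.
  apply: leq_ltn_trans (card_bmultinom n b) _.
  rewrite card_ffun !card_ord.
  apply: (@leq_trans (D ^ n.+1)); last by rewrite leq_pexp2l.
  rewrite expnS; apply: (@leq_ltn_trans (((e * d).+1 * D) ^ n)).
    have leb : (b <= (e * d).+1 * D)%N by rewrite /b; nia.
    by elim: (n) => // k IHk; rewrite !expnS leq_mul.
  by rewrite expnMn ltn_mul2r expn_gt0 /= ltnSn.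
have [|w wn0 wE] := @dependent_of_card ('I_n -> K) _ _
  (fun (a : {ffun 'I_e -> 'I_D}) x => (\prod_i f i ^+ a i).@[x])
  (fun (m : 'X_{1..n < b}) x => \prod_i x i ^+ (m : 'X_{1..n}) i) lt.
  move=> a; exists (fun m : 'X_{1..n < b} => (\prod_i f i ^+ a i)@_m) => x.
  rewrite {1}(mpolywE (sz a)) raddf_sum /=.
  by apply: eq_bigr => m _; rewrite mevalZ mevalX.
by exists D, w.
Qed.

Local Notation aff N := (affine_space K N).

Definition aeval N (p : {mpoly K[#|'I_N|]}) (x : (aff N)) : K :=
  chart_eval (tt : chart (aff N)) p x.

Definition vanishes N (Z : set (aff N)) p := forall x, Z x -> aeval p x = 0.

Lemma zclosed_separation N (Z : set (aff N)) x :
  zclosed setT Z -> ~ Z x -> exists2 q, vanishes Z q & aeval q x != 0.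
Proof.
move=> [_ [_ op]] nZx; have [//|[] [q [[_ qx] sub]]] := op x.
exists q => // y Zy; apply/eqP/negPn/negP => qy.
by have [_] := sub y (conj I (conj I qy)).
Qed.

Lemma zclosed_zeros N (q : {mpoly K[#|'I_N|]}) :
  zclosed setT [set x : (aff N) | aeval q x = 0].
Proof.
split=> //; split=> // x [_ /eqP qx]; exists tt, q; split; first by split.
by move=> y [_ [_ qy]]; split => // /eqP; apply/negP.
Qed.

Lemma vanishes_prime N (Z : set (aff N)) p q :
  irreducible_closed setT Z -> vanishes Z (p * q) ->
  vanishes Z p \/ vanishes Z q.
Proof.
move=> [_ _ irr] pq.
apply: (irr _ _ (zclosed_zeros p) (zclosed_zeros q)) => x /pq.
rewrite /aeval /chart_eval mevalM => /eqP; rewrite mulf_eq0.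
by case/orP => /eqP; [left|right].
Qed.

Section Independence.
Variables (N e : nat) (Z : nat -> set (aff N)) (f : 'I_e -> {mpoly K[#|'I_N|]}).
Hypothesis chZ : irreducible_chain setT e Z.
Hypothesis fZ : forall i : 'I_e, vanishes (Z i) (f i).
Hypothesis fZS : forall i : 'I_e, ~ vanishes (Z i.+1) (f i).
Variables (D : nat) (w : {ffun 'I_e -> 'I_D} -> K).
Implicit Types (S : {set {ffun 'I_e -> 'I_D}}) (a b : {ffun 'I_e -> 'I_D}).

Let mono i a : {mpoly K[#|'I_N|]} := \prod_(j < e | (j < i)%N) f j ^+ a j.

Lemma vanishes_exp i (j : 'I_e) k p : (j < i)%N -> (i <= e)%N ->
  j.+1 = i -> vanishes (Z i) (f j ^+ k * p) -> vanishes (Z i) p.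
Proof.
move=> ji ie <- ; elim: k => [|k IHk]; first by rewrite mul1r.
rewrite exprS -mulrA => /vanishes_prime[]; last exact: IHk.
  by case: chZ => + _; apply; lia.
by move/fZS.
Qed.

(* Induction on i: after division by the lowest power of the last variable,
   restriction to the next smaller set of the chain kills the higher powers. *)
Lemma chain_independent i S : (i <= e)%N -> S != finset.set0 ->
    (forall a, a \in S -> w a != 0) ->
    (forall a b, a \in S -> b \in S ->
       forall j : 'I_e, (i <= j)%N -> a j = b j) ->
  ~ vanishes (Z i) (\sum_(a in S) w a *: mono i a).
Proof.
elim: i S => [|i IHi] S ie S0 wn0 agr van.
  have /finset.set0Pn[a aS] := S0.
  have S1 : S = [set a]%SET.
    apply/finset.setP => b; rewrite inE; apply/idP/eqP => [bS|-> //].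
    by apply/ffunP => j; apply: agr.
  have [_ [x Zx] _] : irreducible_closed setT (Z 0%N) by case: chZ => + _; apply.
  have := van x Zx; rewrite S1 big_set1 /mono big_pred0 // /aeval /chart_eval.
  by rewrite mevalZ meval1 mulr1; apply/eqP/wn0.
have [a0 a0S] := finset.set0Pn _ S0.
pose oi := Ordinal ie.
case: (@arg_minnP _ a0 (fun a => a \in S) (fun a => val (a oi)) a0S) => a aS amin.
pose k := val (a oi).
pose S' := [set b in S | val (b oi) == k]%SET.
have splitm b : b \in S -> mono i.+1 b = f oi ^+ k * (f oi ^+ (b oi - k) * mono i b).
  move=> bS; rewrite mulrA -exprD subnKC; last exact: amin.
  rewrite /mono (bigD1 oi) //=; congr (_ * _).
  apply: eq_bigl => j; rewrite -val_eqE /= ltnS leq_eqVlt andbC.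
  by case: ltngtP.
have van' : vanishes (Z i.+1)
    (\sum_(b in S) w b *: (f oi ^+ (b oi - k) * mono i b)).
  apply: (@vanishes_exp _ oi k) => //.
  rewrite mulr_sumr; move: van; congr vanishes.
  by apply: eq_bigr => b bS; rewrite splitm // scalerAr.
apply: (IHi S').
- exact: ltnW.
- by apply/finset.set0Pn; exists a; rewrite inE aS /=.
- by move=> b; rewrite inE => /andP[bS _]; apply: wn0.
- move=> b c; rewrite !inE => /andP[bS /eqP bk] /andP[cS /eqP ck] j.
  rewrite leq_eqVlt => /orP[/eqP ij|]; last exact: agr.
  have -> : j = oi by apply/val_inj.
  by apply/val_inj; rewrite /= bk ck.
- move=> x Zx; have Zx1 : Z i.+1 x by case: chZ => _ /(_ i ie)[sub _]; apply: sub.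
  have := van' x Zx1; rewrite (bigID (fun b => val (b oi) == k)) /=.
  rewrite {1}/aeval /chart_eval mevalD.
  rewrite [X in _ + X](_ : _ = 0) ?addr0.
    move=> <-; rewrite /aeval /chart_eval; congr meval.
    apply: eq_big => [b|b]; first by rewrite inE.
    by rewrite inE => /andP[_ /eqP->]; rewrite subnn mul1r.
  rewrite raddf_sum /= big1 // => b /andP[bS bk].
  rewrite mevalZ mevalM.
  have kb : (k < b oi)%N by rewrite ltn_neqAle eq_sym bk amin.
  rewrite -(subnSK kb) exprS mevalM.
  have := fZ (i := oi) Zx; rewrite /aeval /chart_eval => ->.
  by rewrite !mul0r mulr0.
Qed.

End Independence.

(** Choose f_i vanishing on Z_i but not on Z_(i+1). The monomials in the f_i are linearly
    independent by [chain_independent], which [monomials_dependent] forbids for more than N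
    polynomials. *)
Lemma affine_chain_le N e (Z : nat -> set (aff N)) :
  irreducible_chain setT e Z -> (e <= N)%N.
Proof.
move=> chZ; rewrite leqNgt; apply/negP => Ne.
have /choice[f fP] : forall i : 'I_e, exists q,
    vanishes (Z i) q /\ ~ vanishes (Z i.+1) q.
  move=> i; have [irr lt] := chZ.
  have [sub /existsNP[x /not_implyP[Zx nZx]]] := lt i (ltn_ord i).
  have [cl _ _] := irr i (ltnW (ltn_ord i)).
  have [q qZ qx] := zclosed_separation cl nZx.
  by exists q; split => // /(_ x Zx); apply/eqP.
have [|D [w [[a wa] wE]]] := @monomials_dependent #|'I_N| e f; first by rewrite card_ord.
have := @chain_independent N e Z f chZ (fun i => (fP i).1) (fun i => (fP i).2)
  D w e [set b | w b != 0]%SET (leqnn _).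
case.
- by apply/finset.set0Pn; exists a; rewrite inE.
- by move=> b; rewrite inE.
- by move=> b c _ _ j; rewrite leqNgt ltn_ord.
move=> x _; rewrite /aeval /chart_eval raddf_sum /= big_mkcond /=.
rewrite -[RHS](wE (fun a => x 0 (enum_val a))); apply: eq_bigr => b _.
rewrite inE; case: eqP => [->|_]; first by rewrite mul0r.
rewrite mevalZ; congr (_ * _.@[_]).
by apply: eq_bigl => i; rewrite ltn_ord.
Qed.

Hypothesis Kinf : forall p : {poly K}, p != 0 -> exists t, p.[t] != 0.

(** If Z1 misses x and Z2 misses y, polynomials separating them restrict to nonzero polynomials on
    the line through x and y. Their product has a non-root, giving a point of Z outside both Z1 and
    Z2. *)
Lemma convex_irreducible N (Z : set (aff N)) :
    zclosed setT Z -> Z !=set0 ->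
    (forall (x y : 'rV[K]_N) t, Z x -> Z y -> Z (x + t *: (y - x) : 'rV_N)) ->
  irreducible_closed setT Z.
Proof.
move=> clZ Z0 cvx; split=> // Z1 Z2 cl1 cl2 sub.
apply: contrapT => /not_orP[/existsNP[x /not_implyP[Zx nx]]].
move=> /existsNP[y /not_implyP[Zy ny]].
have [q1 q1Z q1x] := zclosed_separation cl1 nx.
have [q2 q2Z q2y] := zclosed_separation cl2 ny.
pose line : 'I_#|'I_N| -> {poly K} := fun a =>
  (x 0 (enum_val a))%:P + 'X * (y 0 (enum_val a) - x 0 (enum_val a))%:P.
pose res (q : {mpoly K[#|'I_N|]}) : {poly K} := mmap (@polyC K) line q.
have resE q t : (res q).[t] = aeval q (x + t *: (y - x) : 'rV_N).
  rewrite /res /aeval /chart_eval /meval /mmap horner_sum; apply: eq_bigr => m _.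
  rewrite hornerM hornerC; congr (_ * _).
  rewrite /mmap1 horner_prod; apply: eq_bigr => i _.
  by rewrite horner_exp /line !hornerE /= !mxE.
have r1 : res q1 != 0.
  apply: contraNneq q1x => r0; have := resE q1 0.
  by rewrite r0 horner0 scale0r addr0 => <-.
have r2 : res q2 != 0.
  apply: contraNneq q2y => r0; have := resE q2 1.
  by rewrite r0 horner0 scale1r addrC subrK => <-.
have [t] := Kinf (mulf_neq0 r1 r2).
rewrite hornerM !resE mulf_eq0 negb_or => /andP[t1 t2].
have [/q1Z|/q2Z] := sub _ (cvx _ _ t Zx Zy); exact/eqP.
Qed.

Lemma affine_space_has_dim N : has_dim [set: (aff N)] N.
Proof.
split; last by move=> e Z; apply: affine_chain_le.
exists (fun i => [set x : 'rV[K]_N | forall j : 'I_N, (i <= j)%N -> x 0 j = 0]).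
split=> i iN.
  apply: convex_irreducible.
  - split=> //; split=> // x [_ /existsNP[j /not_implyP[ij /eqP xj]]].
    exists tt, 'X_(enum_rank j).
    have cE y : chart_eval (tt : chart (aff N)) 'X_(enum_rank j) y = y 0 j.
      by rewrite /chart_eval mevalXU enum_rankK.
    split; first by split=> //; rewrite cE.
    by move=> y [_ [_]]; rewrite cE => yj; split => // /(_ j ij) /eqP; apply/negP.
  - by exists 0 => j _; rewrite mxE.
  - by move=> x y t Zx Zy j ij; rewrite !mxE Zx // Zy // subr0 mulr0 addr0.
split; first by move=> x Zx j ij; apply: Zx; apply: ltnW.
move=> /(_ (delta_mx 0 (Ordinal iN))) /=.
have /[swap]/[apply] : forall j : 'I_N, (i < j)%N ->
    (delta_mx 0 (Ordinal iN) : 'rV[K]_N) 0 j = 0.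
  by move=> j ij; rewrite mxE eqxx -val_eqE /= gtn_eqF.
by move=> /(_ (Ordinal iN) (leqnn i)) /eqP; rewrite mxE !eqxx oner_eq0.
Qed.

End Dimension.

Lemma horner_neq0_exists (K : numFieldType) (p : {poly K}) :
  p != 0 -> exists t, p.[t] != 0.
Proof.
move=> p0; apply: contrapT => /forallNP p_root.
have := max_poly_roots p0 (rs := [seq i%:R | i <- iota 0 (size p)]).
rewrite size_map size_iota ltnn => mp; suff: false by []; apply: mp.
  by apply/allP => x _; apply/negPn/negP; apply: p_root.
by rewrite map_inj_uniq ?iota_uniq // => i j /eqP; rewrite eqr_nat => /eqP.
Qed.

(** * Power series and echelon bases *)

Section SeriesToolkit.
Context {K : fieldType}.
Local Notation ps := (pseries K).
Implicit Types (f g y : ps) (M : set ps).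

Lemma psD f g k : (f + g) k = f k + g k. Proof. by []. Qed.
Lemma psN f k : (- f) k = - f k. Proof. by []. Qed.
Lemma psB f g k : (f - g) k = f k - g k. Proof. by []. Qed.
Lemma ps0 k : (0 : ps) k = 0. Proof. by []. Qed.
Lemma ps1 k : (1 : ps) k = (k == 0)%:R. Proof. by []. Qed.
Lemma psM f g k : (f * g) k = \sum_(i < k.+1) f i * g (k - i)%N.
Proof. by []. Qed.

Lemma ps_sum (I : Type) (r : seq I) (P : pred I) (F : I -> ps) k :
  (\sum_(i <- r | P i) F i) k = \sum_(i <- r | P i) F i k.
Proof. by elim/big_ind2 : _ => // y a z b <- <-. Qed.

Definition ordge n y := forall k, (k < n)%N -> y k = 0.

Lemma ordge0 y : ordge 0 y. Proof. by []. Qed.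

Lemma ordgeW m n y : (m <= n)%N -> ordge n y -> ordge m y.
Proof. by move=> mn yn k km; apply: yn; apply: leq_trans mn. Qed.

Lemma ordgeD n f g : ordge n f -> ordge n g -> ordge n (f + g).
Proof. by move=> fn gn k kn; rewrite psD fn // gn // addr0. Qed.

Lemma ordgeN n f : ordge n f -> ordge n (- f).
Proof. by move=> fn k kn; rewrite psN fn // oppr0. Qed.

Lemma ordgeB n f g : ordge n f -> ordge n g -> ordge n (f - g).
Proof. by move=> fn gn; apply: ordgeD => //; apply: ordgeN. Qed.

Lemma ordge_sum n (I : Type) (r : seq I) (P : pred I) (F : I -> ps) :
  (forall i, P i -> ordge n (F i)) -> ordge n (\sum_(i <- r | P i) F i).
Proof. by move=> Fn k kn; rewrite ps_sum big1 // => i Pi; apply: Fn. Qed.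

Lemma ordgeM m n f g : ordge m f -> ordge n g -> ordge (m + n) (f * g).
Proof.
move=> fm gn k kmn; rewrite psM big1 // => i _.
case: (ltnP i m) => im; first by rewrite fm ?mul0r.
by rewrite gn ?mulr0 //; have := ltn_ord i; lia.
Qed.

Lemma ordge_mulr n f g : ordge n g -> ordge n (f * g).
Proof. by move=> gn; apply: (ordgeM (ordge0 f) gn). Qed.

Lemma ordge_lead m n f g : ordge m f -> ordge n g ->
  (f * g) (m + n)%N = f m * g n.
Proof.
move=> fm gn; rewrite psM (bigD1 (inord m)) //= inordK; last by lia.
rewrite addKn big1 ?addr0 // => i; rewrite -val_eqE /= inordK; last by lia.
move=> im; case: (ltnP i m) => [lim|mi]; first by rewrite fm ?mul0r.
by rewrite gn ?mulr0 //; have := ltn_ord i; lia.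
Qed.

Lemma ordge_step n y : ordge n y -> y n = 0 -> ordge n.+1 y.
Proof. by move=> yn y0 k; rewrite ltnS leq_eqVlt => /orP[/eqP->|/yn]. Qed.

Lemma ordge_exp m f k : ordge m f -> ordge (k * m) (f ^+ k).
Proof.
by move=> fm; elim: k => [|k IHk] //; rewrite exprS mulSn; apply: ordgeM.
Qed.

Definition zX d : ps := ps_var ^+ d.

Lemma zXE d k : zX d k = (k == d)%:R.
Proof.
elim: d k => [|d IHd] k; first by rewrite /zX expr0.
rewrite /zX exprS psM; case: k => [|k]; first by rewrite big_ord1 /ps_var mul0r.
rewrite (bigD1 (inord 1)) //= inordK // big1 ?addr0; last first.
  by move=> i; rewrite -val_eqE /= inordK // /ps_var => /negbTE->; rewrite mul0r.
by rewrite /ps_var mul1r subn1 /= -/(zX d) IHd eqSS.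
Qed.

Lemma zXD a b : zX (a + b) = zX a * zX b. Proof. exact: exprD. Qed.
Lemma zX0 : zX 0 = 1. Proof. exact: expr0. Qed.

Lemma ordge_zX d : ordge d (zX d).
Proof. by move=> k kd; rewrite zXE ltn_eqF. Qed.

Lemma zXM d y k : (zX d * y) k = if (k < d)%N then 0 else y (k - d)%N.
Proof.
case: ltnP => kd; first by rewrite (ordgeM (@ordge_zX d) (ordge0 y)) ?addn0.
rewrite psM (bigD1 (inord d)) //= inordK ?ltnS // zXE eqxx mul1r big1 ?addr0 //.
by move=> i; rewrite -val_eqE /= inordK ?ltnS // zXE => /negbTE ->; rewrite mul0r.
Qed.

Lemma zXMl d y k : (zX d * y) (d + k)%N = y k.
Proof. by rewrite zXM ltnNge leq_addr addKn. Qed.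

Lemma zX_inj d : injective ( *%R (zX d)).
Proof. by move=> f g fg; apply: funext => k; rewrite -(zXMl d) fg zXMl. Qed.

Definition pdiv d y : ps := fun k => y (d + k)%N.

Lemma pdivK d y : ordge d y -> zX d * pdiv d y = y.
Proof.
move=> yd; apply: funext => k; rewrite zXM; case: ltnP => kd; first by rewrite yd.
by rewrite /pdiv subnKC.
Qed.

Definition cst (c : K) : ps := fun k => if k == 0%N then c else 0.

Lemma cstM c y k : (cst c * y) k = c * y k.
Proof.
rewrite psM big_ord_recl /= subn0 big1 ?addr0 // => i _.
by rewrite /cst /= mul0r.
Qed.

Lemma cst0 : cst 0 = 0. Proof. by apply: funext => -[]. Qed.
Lemma cst1 : cst 1 = 1. Proof. by apply: funext => -[]. Qed.
Lemma cstN c : cst (- c) = - cst c.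
Proof. by apply: funext => -[|k]; rewrite /cst psN ?oppr0. Qed.
Lemma cstD c d : cst (c + d) = cst c + cst d.
Proof. by apply: funext => -[|k]; rewrite /cst psD ?addr0. Qed.
Lemma cstMM c d : cst (c * d) = cst c * cst d.
Proof. by apply: funext => -[|k]; rewrite cstM /cst ?mulr0. Qed.

Lemma ordge_cst n c y : ordge n y -> ordge n (cst c * y).
Proof. exact: ordge_mulr. Qed.

(* Geometric series; the inverse of y only when y has constant term 1. *)
Definition ps_inv y : ps := fun k => (\sum_(i < k.+1) (1 - y) ^+ i) k.

Lemma ps_invK y : y 0%N = 1 -> y * ps_inv y = 1.
Proof.
move=> y1; have o1 : ordge 1 (1 - y).
  by case=> // _; rewrite psB y1 ps1 eqxx subrr.
have oi i : ordge i ((1 - y) ^+ i) by rewrite -[X in ordge X]muln1; apply: ordge_exp.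
apply: funext => k.
pose G := \sum_(i < k.+1) (1 - y) ^+ i.
have invG j : (j <= k)%N -> ps_inv y j = G j.
  move=> jk; rewrite /ps_inv /G !ps_sum.
  rewrite (big_ord_widen k.+1 (fun i => ((1 - y) ^+ i) j)) //.
  rewrite [RHS](bigID (fun i : 'I_k.+1 => (i < j.+1)%N)) /= [X in _ = _ + X]big1 ?addr0 //.
  by move=> i; rewrite -leqNgt => ji; apply: oi.
transitivity ((y * G) k).
  by rewrite !psM; apply: eq_bigr => i _; rewrite invG ?leq_subr.
have -> : y * G = 1 ^+ k.+1 - (1 - y) ^+ k.+1.
  rewrite subrXX; have -> : 1 - (1 - y) = y by ring.
  by congr (_ * _); apply: eq_bigr => i _; rewrite expr1n mul1r.
by rewrite expr1n psB (oi k.+1) // subr0.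
Qed.

Record subsp M : Prop := Subsp {
  subsp0 : M 0;
  subspD : forall f g, M f -> M g -> M (f + g);
  subspZ : forall c f, M f -> M (cst c * f) }.

Lemma subsp_mulr w M : subsp M -> subsp [set y | M (w * y)].
Proof.
move=> sM; split=> [|f g|c f] /=; first by rewrite mulr0; apply: subsp0.
  by rewrite mulrDr; apply: subspD.
by rewrite mulrCA; apply: subspZ.
Qed.

Definition contains_tail n M := forall y, ordge n y -> M y.

Lemma subspN M y : subsp M -> M y -> M (- y).
Proof. by move=> sM My; rewrite -mulN1r -cst1 -cstN; apply: subspZ. Qed.

Lemma subspB M f g : subsp M -> M f -> M g -> M (f - g).
Proof. by move=> sM Mf Mg; apply: subspD => //; apply: subspN. Qed.

Lemma subsp_sum M (I : Type) (r : seq I) (P : pred I) (F : I -> ps) :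
  subsp M -> (forall i, P i -> M (F i)) -> M (\sum_(i <- r | P i) F i).
Proof.
by move=> sM MF; apply: (big_ind M) => //; [apply: subsp0|apply: subspD].
Qed.

Lemma subspBl M f g : subsp M -> M g -> M (f - g) -> M f.
Proof. by move=> sM Mg Mfg; rewrite -(subrK g f); apply: subspD. Qed.

Lemma valsetP M d : subsp M ->
  valset M d <-> exists y, [/\ M y, ordge d y & y d = 1].
Proof.
move=> sM; split=> [[y My [yd oy]]|[y [My oy y1]]].
  exists (cst (y d)^-1 * y); split; first exact: subspZ.
    exact: ordge_cst.
  by rewrite cstM mulVf.
by exists y => //; split; rewrite // y1 oner_neq0.
Qed.

Lemma valset_lead M y d : M y -> ordge d y -> ~ valset M d -> y d = 0.
Proof.
move=> My oy nd; apply/eqP/negPn/negP => yd.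
by apply: nd; exists y.
Qed.

(** Leading terms of y are removed one at a time by elements of M of the same order, until the
    remainder falls into the tail. This is how an element of a larger module is brought down to a
    smaller one. *)
Lemma valset_sub M M' n c y :
    subsp M -> subsp M' -> contains_tail n M -> M `<=` M' ->
    (forall k, (c <= k)%N -> valset M' k -> valset M k) ->
  M' y -> ordge c y -> M y.
Proof.
move=> sM sM' tM MM' val; have [m] := ubnP (n - c).
elim: m c y val => // m IHm c y val ltm M'y oy.
case: (leqP n c) => nc; first by apply/tM; apply: ordgeW oy.
have [y0|y0] := eqVneq (y c) 0.
  apply: (IHm c.+1) => //; [by move=> k ck; apply/val/ltnW|lia|exact: ordge_step].
have /(valsetP _ sM)[b [Mb ob b1]] : valset M c by apply: val => //; exists y.
have Mcb : M (cst (y c) * b) by apply: subspZ.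
apply: (subspBl sM Mcb); apply: (IHm c.+1).
- by move=> k ck; apply/val/ltnW.
- lia.
- by apply: subspB => //; apply: MM'.
apply: ordge_step; first by apply: ordgeB => //; apply: ordge_cst.
by rewrite psB cstM b1 mulr1 subrr.
Qed.

Lemma valset_eq M M' n :
    subsp M -> subsp M' -> contains_tail n M -> M `<=` M' ->
    (forall k, valset M' k -> valset M k) -> M = M'.
Proof.
move=> sM sM' tM MM' val; apply/seteqP; split=> // y M'y.
by apply: (valset_sub (c := 0%N) sM sM' tM MM') => // k _; apply: val.
Qed.

(** The order of a nonzero y would belong to [valset M], where y has no coefficient. This is the
    uniqueness principle for reduced elements. *)
Lemma gap_supported_eq0 M y : M y -> (forall k, valset M k -> y k = 0) -> y = 0.
Proof.
move=> My y0; apply: funext; elim/ltn_ind => k IHk.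
by have [/y0 //|nk] := EM (valset M k); apply: (valset_lead My).
Qed.

(** * Coordinates along an echelon family of series *)

Section Echelon.
Variable B : nat -> ps.
Hypothesis oB : forall d, ordge d (B d).
Hypothesis B1 : forall d, B d d = 1.

(* [red d y] is the remainder of y after subtracting the multiples of
   B 0, ..., B (d - 1) that cancel its first d coefficients, and [co d y] is the
   coordinate of y at B d. *)
Fixpoint red d y : ps :=
  if d is d'.+1 then let r := red d' y in r - cst (r d') * B d' else y.

Definition co d y : K := red d y d.

Lemma redS d y : red d.+1 y = red d y - cst (co d y) * B d. Proof. by []. Qed.

Lemma ordge_red d y : ordge d (red d y).
Proof.
elim: d => [|d IHd] //; rewrite redS; apply: ordge_step.
  by apply: ordgeB => //; apply: ordge_cst.
by rewrite psB cstM B1 mulr1 subrr.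
Qed.

Lemma redD d y z : red d (y + z) = red d y + red d z.
Proof. by elim: d => [|d IHd] //=; rewrite IHd psD cstD mulrDl opprD addrACA. Qed.

Lemma redZ d c y : red d (cst c * y) = cst c * red d y.
Proof. by elim: d => [|d IHd] //=; rewrite IHd cstM cstMM -mulrA mulrBr. Qed.

Lemma coD d y z : co d (y + z) = co d y + co d z.
Proof. by rewrite /co redD. Qed.

Lemma coZ d c y : co d (cst c * y) = c * co d y.
Proof. by rewrite /co redZ cstM. Qed.

Lemma coN d y : co d (- y) = - co d y.
Proof. by rewrite -mulN1r -cst1 -cstN coZ mulN1r. Qed.

Lemma coB d y z : co d (y - z) = co d y - co d z.
Proof. by rewrite coD coN. Qed.

Lemma co_zero d : co d 0 = 0.
Proof. by have := coZ d 0 0; rewrite mulr0 mul0r. Qed.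

Lemma co_sum d (I : Type) (r : seq I) (P : pred I) (F : I -> ps) :
  co d (\sum_(i <- r | P i) F i) = \sum_(i <- r | P i) co d (F i).
Proof.
by elim/big_rec2 : _ => [|i a y _ IH]; rewrite ?co_zero // coD IH.
Qed.

Lemma red_expand d y : y = \sum_(i < d) cst (co i y) * B i + red d y.
Proof.
elim: d => [|d IHd]; first by rewrite big_ord0 add0r.
by rewrite big_ord_recr redS -addrA [X in _ + X]addrC subrK.
Qed.

Lemma red_ord m y : ordge m y -> red m y = y.
Proof.
move=> oy; have : (m <= m)%N by [].
elim: {1 3}m => //= d IHd dm; rewrite IHd ?oy ?cst0 ?mul0r ?subr0 //.
exact: ltnW.
Qed.

Lemma co_ord m y k : ordge m y -> (k < m)%N -> co k y = 0.
Proof.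
move=> oy km; rewrite /co red_ord; first exact: oy.
by apply: ordgeW oy; apply: ltnW.
Qed.

Lemma co_lead m y : ordge m y -> co m y = y m.
Proof. by move=> oy; rewrite /co red_ord. Qed.

Lemma co_B i d : co i (B d) = (i == d)%:R.
Proof.
have [id|di|->] := ltngtP i d; last by rewrite co_lead // B1.
  by rewrite (co_ord (@oB d)).
have rd : red d.+1 (B d) = 0.
  by rewrite redS co_lead // B1 cst1 mul1r red_ord // subrr.
suff r0 k : (d < k)%N -> red k (B d) = 0 by rewrite /co r0.
elim: k => // k IHk; rewrite ltnS leq_eqVlt => /orP[/eqP<- //|/IHk /= ->].
by rewrite ps0 cst0 mul0r subrr.
Qed.

Variable Dl : pred nat.
(** The closed span of the [B d] with [Dl d], described by the vanishing of the other coordinates so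
    that no infinite sum has to be formed. *)
Definition kerB : set ps := [set y | forall k, ~~ Dl k -> co k y = 0].

Lemma kerB_subsp : subsp kerB.
Proof.
split=> [k _|f g Mf Mg k nk|c f Mf k nk]; first exact: co_zero.
  by rewrite coD Mf // Mg // addr0.
by rewrite coZ Mf // mulr0.
Qed.

Lemma kerB_B d : Dl d -> kerB (B d).
Proof.
move=> Dd k nk; rewrite co_B; case: eqP => // kd.
by rewrite kd Dd in nk.
Qed.

Lemma kerB_expand m y : kerB y ->
  y = \sum_(i < m | Dl i) cst (co i y) * B i + red m y.
Proof.
move=> My; rewrite {1}(red_expand m y) (bigID (fun i : 'I_m => Dl i)) /=.
rewrite [X in _ + X + _]big1 ?addr0 // => i ni.
by rewrite My // cst0 mul0r.
Qed.

Variable n : nat.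
Hypothesis Dn : forall k, (n <= k)%N -> Dl k.

Lemma kerB_tail : contains_tail n kerB.
Proof.
move=> y oy k nk; apply: (co_ord oy).
by rewrite ltnNge; apply: contra nk; apply: Dn.
Qed.

Lemma kerB_valset k : valset kerB k <-> Dl k.
Proof.
split=> [[y My [yk oy]]|Dk].
  by apply/negPn/negP => nk; move: yk; rewrite -(co_lead oy) My // eqxx.
by apply/(valsetP _ kerB_subsp); exists (B k); split => //; apply: kerB_B.
Qed.

Lemma kerB_subset M : subsp M -> contains_tail n M ->
  (forall d, Dl d -> M (B d)) -> kerB `<=` M.
Proof.
move=> sM tM MB y My; rewrite (kerB_expand n My).
apply: (subspD sM); last exact/tM/ordge_red.
by apply: (subsp_sum _ sM) => i Di; apply: (subspZ sM); apply: MB.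
Qed.

Lemma kerB_mul a : (forall d, Dl d -> kerB (a * B d)) ->
  forall y, kerB y -> kerB (a * y).
Proof.
move=> aB y My; have sK := kerB_subsp.
rewrite (kerB_expand n My) mulrDr mulr_sumr.
apply: (subspD sK); last exact/kerB_tail/ordge_mulr/ordge_red.
by apply: (subsp_sum _ sK) => i Di; rewrite mulrCA; apply: (subspZ sK); apply: aB.
Qed.

Lemma kerB_eq M : subsp M ->
  (forall k, valset M k -> Dl k) -> (forall d, Dl d -> M (B d)) ->
  contains_tail n M -> kerB = M.
Proof.
move=> sM vM MB tM.
apply: (valset_eq kerB_subsp sM kerB_tail); first exact: kerB_subset.
by move=> k /vM Dk; apply/kerB_valset.
Qed.

End Echelon.

(* Perturbing the basis in relative order s perturbs the coordinates of y only
   from order (ord y + s) on, and at that order only through the leading term. *)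
Lemma co_perturb B B' m s y :
    (forall d, ordge d (B d)) ->
    (forall d, ordge (d + s) (B d - B' d)) -> ordge m y -> (0 < s)%N ->
  (forall k, (k < m + s)%N -> co B k y = co B' k y) /\
  co B (m + s) y + y m * B m (m + s)%N = co B' (m + s) y + y m * B' m (m + s)%N.
Proof.
move=> oB oBB' oy s0.
have key d : (d <= m + s)%N -> ordge (m + s) (red B d y - red B' d y) /\
    (red B d y - red B' d y) (m + s)%N =
    if (m < d)%N then - (y m * (B m - B' m) (m + s)%N) else 0.
  elim: d => [|d IHd] dms; first by rewrite /= subrr.
  have {IHd} [IH1 IH2] := IHd (ltnW dms).
  have E : red B d y d = red B' d y d.
    by apply/eqP; rewrite -subr_eq0 -psB IH1.
  have -> : red B d.+1 y - red B' d.+1 y =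
      (red B d y - red B' d y) - cst (red B d y d) * (B d - B' d).
    by rewrite /= -E; ring.
  case: (ltngtP d m) => [dm|md|dm].
  - have r0 : red B d y d = 0.
      by rewrite red_ord; [apply: oy|apply: ordgeW oy; apply: ltnW].
    by rewrite r0 cst0 mul0r subr0 ltnNge dm; rewrite ltnNge (ltnW dm) in IH2.
  - split.
      apply: ordgeB => //; apply: ordge_cst; apply: ordgeW (oBB' d); lia.
    rewrite psB cstM [X in _ * X](oBB' d) ?ltn_add2r // mulr0 subr0 IH2 md.
    by rewrite ltnS (ltnW md).
  - rewrite dm in IH1 IH2 *; rewrite ltnn in IH2.
    rewrite (red_ord B oy) in IH1 IH2 *; split.
      apply: ordgeB => //; apply: ordge_cst; apply: ordgeW (oBB' m); lia.
    by rewrite psB IH2 cstM sub0r ltnSn.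
split=> [k km|].
  have [+ _] := key k (ltnW km); move=> /(_ k km) /eqP.
  by rewrite psB subr_eq0 => /eqP.
have [_] := key (m + s)%N (leqnn _); rewrite ifT; last by lia.
rewrite !psB => /eqP; rewrite subr_eq => /eqP; rewrite /co => ->.
by ring.
Qed.

End SeriesToolkit.

(** * Generators modulo 4 *)

Section Generators.
Variables (u : nat) (a : nat -> nat).

(* The set Delta whose least element in the residue class c mod 4 is [a c]. *)
Definition Dl (k : nat) : bool := (a (k %% 4) <= k)%N.

(** Stability under 4 is built into [Dl]. The inequalities express stability under 2u, which is 2
    mod 4 and so exchanges 0 with 2 and 1 with 3. *)
Record generators : Prop := Generators {
  gens_mod : forall c, (c < 4)%N -> (a c %% 4 = c)%N;
  gens0 : a 0%N = 0%N;
  gens2 : (a 2%N <= 2 * u)%N;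
  gens13 : (a 1%N <= a 3%N + 2 * u)%N;
  gens31 : (a 3%N <= a 1%N + 2 * u)%N;
  gens_u : odd u }.

Hypothesis ga : generators.

Lemma mod4_cases k :
  [\/ k %% 4 = 0, k %% 4 = 1, k %% 4 = 2 | k %% 4 = 3]%N.
Proof.
have : (k %% 4 < 4)%N by rewrite ltn_mod.
by case: (k %% 4)%N => [|[|[|[|]]]] // _; [constructor 1|constructor 2|constructor 3|constructor 4].
Qed.

Lemma mod4_gens : [/\ a 0%N = 0%N, a 1%N %% 4 = 1, a 2%N %% 4 = 2 & a 3%N %% 4 = 3]%N.
Proof. by split; [exact: (gens0 ga)|exact: (gens_mod ga)..]. Qed.

Ltac gen_lia := have [g0 g1 g2 g3] := mod4_gens; have h2 := gens2 ga;
  have h13 := gens13 ga; have h31 := gens31 ga; have hu := gens_u ga; lia.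

Lemma Dl_mono k l : Dl k -> (k <= l)%N -> (l %% 4 = k %% 4)%N -> Dl l.
Proof. by rewrite /Dl => Dk kl ->; apply: leq_trans Dk kl. Qed.

Lemma Dl_gen c k : (c < 4)%N -> (a c <= k)%N -> (k %% 4 = c)%N -> Dl k.
Proof. by move=> c4 ak kc; rewrite /Dl kc. Qed.

Lemma Dl_add4 k j : Dl k -> Dl (k + 4 * j).
Proof. by move=> Dk; apply: Dl_mono Dk _ _; [exact: leq_addr|lia]. Qed.

Lemma Dl_even k : ~~ odd k -> (2 * u <= k)%N -> Dl k.
Proof.
move=> ev ku; rewrite /Dl; case: (mod4_cases k) => kE; rewrite kE; gen_lia.
Qed.

Lemma gap_odd k : ~~ Dl k -> (2 * u <= k)%N -> odd k.
Proof. by move=> nk ku; apply: contraR nk => /Dl_even; apply. Qed.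

Lemma Dl_odd_tail c k : odd c -> (c < 4)%N -> (a c + 2 * u <= k)%N -> Dl k.
Proof.
move=> oc c4 ck; rewrite /Dl.
have : c = 1%N \/ c = 3%N by case: c oc c4 ck => [|[|[|[|]]]] //; auto.
by case: (mod4_cases k) => kE; rewrite kE => -[] E; rewrite E in ck; gen_lia.
Qed.

Lemma Dl_add2u k : Dl k -> Dl (k + 2 * u).
Proof.
move=> Dk; case: (boolP (odd k)) => ok.
  apply: (@Dl_odd_tail (k %% 4)); rewrite ?ltn_mod //; last by rewrite leq_add2r.
  by rewrite odd_mod.
by apply: Dl_even; [rewrite oddD (negbTE ok) oddM|rewrite leq_addl].
Qed.

Lemma Dl_mod4_0 k : (k %% 4 = 0)%N -> Dl k.
Proof. by move=> k0; rewrite /Dl k0; gen_lia. Qed.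

(** Even numbers from 2u on are in Delta, so k is odd; as [a 2] is 2 mod 4, k and k + a 2 occupy the
    two odd classes, and each is below the generator of its class. *)
Lemma gap_pair c k : odd c -> (c < 4)%N -> (2 * u <= k)%N ->
  ~~ Dl k -> ~~ Dl (k + a 2) -> (k < a c)%N.
Proof.
move=> oc c4 ku nk nk2; have ok := gap_odd nk ku; have k2 : (k %% 2 = 1)%N by rewrite modn2 ok.
have E : ((k + a 2) %% 4 = (k + 2) %% 4)%N by gen_lia.
have : c = 1%N \/ c = 3%N by case: c oc c4 => [|[|[|[|]]]] //; auto.
move: nk nk2; rewrite /Dl E.
case: (mod4_cases k) => kE; rewrite kE; try by gen_lia.
- have -> : ((k + 2) %% 4 = 3)%N by lia.
  move=> ? ? -[] ->; gen_lia.
- have -> : ((k + 2) %% 4 = 1)%N by lia.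
  move=> ? ? -[] ->; gen_lia.
Qed.

End Generators.

(** * Echelon bases from four generators over the power series in x *)

Section GeneratedBasis.
Context {K : fieldType}.
Local Notation ps := (pseries K).
Variables (u : nat) (a : nat -> nat) (gen : nat -> ps) (n : nat).
Hypothesis ga : generators u a.
Hypothesis ogen : forall c, (c < 4)%N -> ordge (a c) (gen c).
Hypothesis gen1 : forall c, (c < 4)%N -> gen c (a c) = 1.
Hypothesis Dn : forall k, (n <= k)%N -> Dl a k.

(** For d in Delta this is the multiple of a generator by a power of x with leading term z^d. The
    monomials at the gaps complete the family, so that the module is cut out by its coordinates at
    the gaps. *)
Definition BB (d : nat) : ps :=
  if Dl a d then zX (d - a (d %% 4)) * gen (d %% 4) else zX d.

Lemma ordge_BB d : ordge d (BB d).
Proof.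
rewrite /BB; case: ifP => Dd; last exact: ordge_zX.
rewrite -{1}(subnK Dd); apply: ordgeM; first exact: ordge_zX.
by apply: ogen; rewrite ltn_mod.
Qed.

Lemma BB_lead d : BB d d = 1.
Proof.
rewrite /BB; case: ifP => Dd; last by rewrite zXE eqxx.
have := zXMl (d - a (d %% 4)) (gen (d %% 4)) (a (d %% 4)).
by rewrite subnK // gen1 // ltn_mod.
Qed.

Lemma BB_gap d : ~~ Dl a d -> BB d = zX d.
Proof. by rewrite /BB => /negbTE ->. Qed.

Lemma BB_gen c j : (c < 4)%N -> BB (a c + 4 * j) = zX (4 * j) * gen c.
Proof.
move=> c4; have E : ((a c + 4 * j) %% 4 = c)%N.
  by rewrite -modnDmr modnMr addn0 (gens_mod ga).
by rewrite /BB (Dl_gen c4) ?leq_addr // E addKn.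
Qed.

Lemma BB_gen0 c : (c < 4)%N -> BB (a c) = gen c.
Proof. by move=> c4; have := BB_gen 0 c4; rewrite muln0 addn0 zX0 mul1r. Qed.

Lemma Dl_split d : Dl a d -> exists j, d = (a (d %% 4) + 4 * j)%N.
Proof.
rewrite /Dl => Dd; exists ((d - a (d %% 4)) %/ 4)%N.
have := gens_mod ga (c := (d %% 4)%N); rewrite ltn_mod => /(_ isT); lia.
Qed.

Lemma BB_add4 d : Dl a d -> zX 4 * BB d = BB (d + 4).
Proof.
move=> Dd; have [j E] := Dl_split Dd.
rewrite E BB_gen ?ltn_mod // mulrA -zXD -mulnS -addnA -mulnSr.
by rewrite BB_gen ?ltn_mod.
Qed.

Local Notation M := (kerB BB (Dl a)).

Lemma BB_x y : M y -> M (zX 4 * y).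
Proof.
apply: (kerB_mul ordge_BB BB_lead Dn) => d Dd.
rewrite BB_add4 //; apply: (kerB_B ordge_BB BB_lead).
by rewrite -[4%N]muln1; apply: Dl_add4.
Qed.

Lemma gen_mem c : (c < 4)%N -> M (gen c).
Proof.
move=> c4; rewrite -BB_gen0 //; apply: (kerB_B ordge_BB BB_lead).
by apply: (Dl_gen c4); rewrite ?(gens_mod ga).
Qed.

Lemma BB_in (M' : set ps) d : Dl a d ->
  (forall y, M' y -> M' (zX 4 * y)) -> (forall c, (c < 4)%N -> M' (gen c)) ->
  M' (BB d).
Proof.
move=> Dd Mx Mg; have [j ->] := Dl_split Dd.
rewrite BB_gen ?ltn_mod //; elim: j => [|j IHj].
  by rewrite muln0 zX0 mul1r; apply: Mg; rewrite ltn_mod.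
by rewrite mulnS zXD -mulrA; apply: Mx.
Qed.

Lemma co_gen c c' : (c < 4)%N -> (c' < 4)%N ->
  co BB (a c) (gen c') = (c == c')%:R.
Proof.
move=> c4 c'4; rewrite -BB_gen0 // (co_B ordge_BB BB_lead).
congr (nat_of_bool _)%:R; apply/eqP/eqP => [E|->//].
by rewrite -[LHS](gens_mod ga c4) E (gens_mod ga).
Qed.

(** Multiplication by x sends the basis element at d to the one at d + 4, and the least order [a c]
    of a class is never d + 4 with d in Delta. Together with [x_divisible] this says that the four
    generators form a basis of M / x M. *)
Lemma co_x_gen c y : (c < 4)%N -> M y -> co BB (a c) (zX 4 * y) = 0.
Proof.
move=> c4 My; rewrite (kerB_expand (a c) My) mulrDr mulr_sumr coD co_sum.
rewrite [X in _ + X](@co_ord _ BB (4 + a c)%N) ?addr0; last by lia.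
  rewrite big1 // => i Di; rewrite mulrCA coZ BB_add4 //.
  rewrite (co_B ordge_BB BB_lead).
  have -> : (a c == i + 4)%N = false.
    apply/negbTE/eqP => E; move: Di; rewrite /Dl.
    have -> : (i %% 4 = c)%N.
      move: E; move: (nat_of_ord i) => i' E.
      by rewrite -[RHS](gens_mod ga c4) E; lia.
    by move: (nat_of_ord i) E => i' ->; lia.
  by rewrite mulr0.
by apply: ordgeM; [exact: ordge_zX|apply: (ordge_red ordge_BB BB_lead)].
Qed.

Lemma x_divisible y : M y -> (forall c, (c < 4)%N -> co BB (a c) y = 0) ->
  ordge 4 y -> M (pdiv 4 y).
Proof.
(* The shift by 4 keeps the remainder in the tail after division by x. *)
move=> My y0 oy; pose N := (n + 4)%N.
have sM : subsp M by apply: kerB_subsp.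
pose r := \sum_(i < N | Dl a i && (a (i %% 4) < i)%N) cst (co BB i y) * BB (i - 4).
have i4 i : Dl a i -> (a (i %% 4) < i)%N -> Dl a (i - 4) /\ (4 <= i)%N.
  move=> Di ai; have := gens_mod ga (c := (i %% 4)%N); rewrite ltn_mod => /(_ isT) E.
  split; last by lia.
  by rewrite /Dl (_ : (i - 4) %% 4 = i %% 4)%N; lia.
have Mr : M r.
  apply: (subsp_sum _ sM) => i /andP[Di ai]; apply: (subspZ sM).
  by apply: (kerB_B ordge_BB BB_lead); case: (i4 i Di ai).
have oN : ordge N (red BB N y) by apply: (ordge_red ordge_BB BB_lead).
have E : y = zX 4 * (r + pdiv 4 (red BB N y)).
  rewrite mulrDr pdivK; last by apply: ordgeW oN; rewrite leq_addl.
  rewrite {1}(kerB_expand N My); congr (_ + _).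
  rewrite /r mulr_sumr (bigID (fun i : 'I_N => (a (i %% 4) < i)%N)) /=.
  rewrite [X in _ + X]big1 ?addr0 => [|i /andP[Di ai]].
    apply: eq_bigr => i /andP[Di ai]; have [Di4 le4] := i4 i Di ai.
    by rewrite mulrCA BB_add4 // subnK.
  have -> : val i = a (i %% 4).
    by apply/eqP; rewrite eqn_leq; move: Di ai; rewrite /Dl -leqNgt => -> ->.
  by rewrite y0 ?ltn_mod // cst0 mul0r.
have -> : pdiv 4 y = r + pdiv 4 (red BB N y).
  by apply: (@zX_inj K 4); rewrite pdivK.
apply: (subspD sM) => //; apply: (kerB_tail _ Dn) => k kn.
by apply: oN; rewrite /N; lia.
Qed.

End GeneratedBasis.

(** * Stability under f as a triangular system *)

Section Core.
Context {K : fieldType}.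
Local Notation ps := (pseries K).
Variables (u v n : nat) (a : nat -> nat).
Hypothesis ga : generators u a.
Hypothesis Dn : forall k, (n <= k)%N -> Dl a k.

Local Notation D := (Dl a).
Local Notation e := (a 2).

Definition fser : ps := zX (2 * u) + zX v.

Implicit Types X Y : nat -> nat -> K.

(* The generators m_c of a module with m_0 = 1, reduced at Delta: X c s is the
   coefficient of z^(a c + s) in m_c. *)
Definition mt X (c : nat) : ps := fun k =>
  if k == a c then 1 else
  if [&& c != 0, a c < k & ~~ D k]%N then X c (k - a c)%N else 0.

Definition Bt X : nat -> ps := BB a (mt X).

Lemma mt_lead X c : mt X c (a c) = 1.
Proof. by rewrite /mt eqxx. Qed.

Lemma ordge_mt X c : ordge (a c) (mt X c).
Proof. by move=> k kc; rewrite /mt ltn_eqF // ltnNge (ltnW kc) andbF. Qed.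

Lemma mt_shift X c s : (0 < s)%N -> c != 0%N -> ~~ D (a c + s) ->
  mt X c (a c + s) = X c s.
Proof.
move=> s0 c0 ns; rewrite /mt ns c0 addKn ifF ?ifT //; first by lia.
by apply/eqP; lia.
Qed.

Lemma mt0 X : mt X 0 = 1.
Proof.
by apply: funext => k; rewrite /mt (gens0 ga) ps1 /=; case: eqP.
Qed.

Lemma ordge_Bt X d : ordge d (Bt X d).
Proof. by apply: ordge_BB => c _; exact: ordge_mt. Qed.

Lemma Bt_lead X d : Bt X d d = 1.
Proof. by apply: BB_lead => c _; exact: mt_lead. Qed.

Lemma Bt_gen X c k : (c < 4)%N -> (a c <= k)%N -> (k %% 4 = c)%N ->
  Bt X k = zX (k - a c) * mt X c.
Proof. by move=> c4 ck kc; rewrite /Bt /BB (Dl_gen c4) // kc. Qed.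

Lemma Bt_mod0 X k : (k %% 4 = 0)%N -> Bt X k = zX k.
Proof. by move=> k0; rewrite (@Bt_gen _ 0) ?(gens0 ga) // mt0 mulr1 subn0. Qed.

Lemma Bt_add4 X d j : D d -> Bt X (d + 4 * j) = zX (4 * j) * Bt X d.
Proof.
move=> Dd; rewrite /Bt /BB Dd (Dl_add4 j Dd) mulrA -zXD.
have -> : ((d + 4 * j) %% 4 = d %% 4)%N by lia.
by congr (zX _ * _); move: Dd; rewrite /Dl; lia.
Qed.

Definition Mt X : set ps := kerB (Bt X) D.

Lemma Mt_subsp X : subsp (Mt X).
Proof. exact: kerB_subsp. Qed.

Lemma Mt_B X d : D d -> Mt X (Bt X d).
Proof. exact: (kerB_B (@ordge_Bt X) (Bt_lead X)). Qed.

Lemma Mt_tail X : contains_tail n (Mt X).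
Proof. exact: kerB_tail Dn. Qed.

Lemma Mt_valset X k : valset (Mt X) k <-> D k.
Proof. exact: (kerB_valset (@ordge_Bt X) (Bt_lead X)). Qed.

Lemma Mt_x X y : Mt X y -> Mt X (zX 4 * y).
Proof. exact: (BB_x ga (fun c _ => @ordge_mt X c) (fun c _ => mt_lead X c) Dn). Qed.

Lemma mt_expand X c : c != 0%N -> mt X c =
  zX (a c) + \sum_(i < n | (a c < i)%N && ~~ D i) cst (X c (i - a c)%N) * zX i.
Proof.
move=> c0; apply: funext => j; rewrite psD zXE ps_sum /mt c0 /=.
case: (eqVneq j (a c)) => [->|jc].
  rewrite big1 ?addr0 // => i /andP[ci _]; rewrite cstM zXE.
  by rewrite (ltn_eqF ci) mulr0.
rewrite add0r; case: ifP => [/andP[cj nj]|nj].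
  have jn : (j < n)%N by rewrite ltnNge; apply: contra nj; exact: Dn.
  rewrite (bigD1 (Ordinal jn)) /=; last by rewrite cj.
  rewrite cstM zXE eqxx mulr1 big1 ?addr0 //.
  move=> i /andP[/andP[_ ni] ij]; rewrite cstM zXE.
  by rewrite -val_eqE /= in ij; rewrite eq_sym (negbTE ij) mulr0.
rewrite big1 // => i /andP[ci ni]; rewrite cstM zXE.
by case: eqP => [ji|_]; rewrite ?mulr0 //; move: nj; rewrite ji ci ni.
Qed.

Lemma Mt_x4 X y j : Mt X y -> Mt X (zX (4 * j) * y).
Proof.
move=> My; elim: j => [|j IHj]; first by rewrite muln0 zX0 mul1r.
by rewrite mulnS zXD -mulrA; apply: Mt_x.
Qed.

Lemma Mt_ord X y m : (forall k, (m <= k)%N -> D k) -> ordge m y -> Mt X y.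
Proof.
move=> Dm oy k nk; apply: (co_ord _ oy).
by rewrite ltnNge; apply: contra nk; apply: Dm.
Qed.

Definition agree s X Y := forall c t, (t < s)%N -> X c t = Y c t.

Lemma mt_agree s X Y c : agree s X Y -> ordge (a c + s) (mt X c - mt Y c).
Proof.
move=> XY k ks; rewrite psB /mt; case: eqP => _; first by rewrite subrr.
case: ifP => [/and3P[_ ck _]|_]; last by rewrite subrr.
by rewrite XY ?subrr //; lia.
Qed.

Lemma Bt_agree s X Y d : agree s X Y -> ordge (d + s) (Bt X d - Bt Y d).
Proof.
move=> XY; rewrite /Bt /BB; case: ifP => Dd; last by rewrite subrr.
rewrite -mulrBr -{1}(subnK Dd) -addnA.
by apply: ordgeM; [exact: ordge_zX|exact: mt_agree].
Qed.

Definition om X : ps := mt X 2 - zX e.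

Definition q := ((v + e) %% 4)%N.

(* Stability under f means that the coordinates of f and f m_2 at the gaps
   vanish.  The one of f at 2u + s (S1) and the one of f m_2 at e + 2u + s, when
   2u + s is not a gap (S2), are equations for X 2 s.  When 2u + s is a gap, the
   coordinate of f m_2 at e + 2u + s = v + e + t involves 2 X q t and gives an
   equation for X q t (S3).  In each case [rhs] depends on the X c t with t < s
   only. *)
Definition S1 (s : nat) := [&& 0 < s & ~~ D (2 * u + s)]%N.
Definition S2 (s : nat) := [&& 0 < s, ~~ D (e + 2 * u + s) & D (2 * u + s)]%N.
Definition S3 (s : nat) := [&& 0 < s, ~~ D (v + e + s) & ~~ D (v + s)]%N.

Definition solved (c s : nat) := (c == 2%N) && (S1 s || S2 s) || (c == q) && S3 s.

(** With l = f - x^j m_2 and 2u = e + 4j, this is f m_2 - z^(2u+e) + z^e l: the two terms z^(2u)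
    [om X] cancel and z^(v+e) is doubled. *)
Definition hser X : ps := cst 2%:R * zX (v + e) + zX v * om X.

(** X c s = rhs X c s says that the coordinate in question vanishes. That coordinate contains X c s
    with the factor -1 for S1, 1 for S2 and -2 for S3, so the signs and the division by 2 make X c s
    drop out of the right-hand side. *)
Definition rhs X (c s : nat) : K :=
  if c == 2%N then
    if S1 s then X 2 s + co (Bt X) (2 * u + s) fser
    else X 2 s - co (Bt X) (e + 2 * u + s) (fser * mt X 2)
  else X c s + co (Bt X) (v + e + s) (hser X) / 2%:R.

Lemma e_mod : (e %% 4 = 2)%N. Proof. exact: (gens_mod ga). Qed.

Hypothesis v_odd : odd v.
Hypothesis ltuv : (2 * u < v)%N.

Lemma v_mod : (v %% 2 = 1)%N. Proof. by rewrite modn2 v_odd. Qed.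

Lemma u_mod : (u %% 2 = 1)%N. Proof. by rewrite modn2 (gens_u ga). Qed.

Ltac arith := have := e_mod; have := v_mod; have := u_mod; have := gens2 ga; lia.

Lemma q_odd : odd q.
Proof. by rewrite -[odd q]eqb1 -modn2 /q; apply/eqP; arith. Qed.

Lemma q_lt4 : (q < 4)%N. Proof. by rewrite /q ltn_mod. Qed.

Lemma D_e : D e. Proof. by apply: (@Dl_gen _ 2); rewrite ?e_mod. Qed.

Lemma Bt_e X j : Bt X (e + 4 * j) = zX (4 * j) * mt X 2.
Proof.
by rewrite Bt_add4 ?D_e // (@Bt_gen _ 2) ?e_mod // subnn zX0 mul1r.
Qed.

Lemma om_ord X : ordge e.+1 (om X).
Proof.
apply: ordge_step; first by apply: ordgeB; [exact: ordge_mt|exact: ordge_zX].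
by rewrite /om psB mt_lead zXE eqxx subrr.
Qed.

(* Even gaps lie below e. *)
Lemma om_even X k : ~~ odd k -> om X k = 0.
Proof.
move=> ev; case: (ltnP k e.+1) => [/om_ord//|ek].
rewrite /om psB zXE /mt !gtn_eqF // subr0 ifF //; apply/negbTE.
rewrite !negb_and !negbK; apply/orP; right; apply/orP; right.
have [g0 _ _ _] := mod4_gens ga.
have k2 : (k %% 2 = 0)%N by rewrite modn2 (negbTE ev).
rewrite /Dl; case: (mod4_cases k) => kE; rewrite kE ?g0 //; lia.
Qed.

(** As v + s is an odd gap, s is even, and one of v + s, v + e + s is congruent to v mod 4; v in
    Delta would put that one in Delta. Under admissibility v + e is then in Delta, so a multiple of
    m_q leads at z^(v+e). *)
Lemma S3_gap s : S3 s -> ~~ D v.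
Proof.
case/and3P=> s0 n1 n2; apply/negP => Dv.
have o1 := gap_odd ga n2; have /o1{}o1 : (2 * u <= v + s)%N by lia.
have o1' : ((v + s) %% 2 = 1)%N by rewrite modn2 o1.
have [vs|vs] := eqVneq ((v + s) %% 4)%N (v %% 4)%N.
  by move/negP: n2; apply; apply: Dl_mono Dv _ vs; lia.
move/negP: n1; apply; apply: Dl_mono Dv _ _; first by lia.
by move/eqP: vs; arith.
Qed.

Lemma fser_ord : ordge (2 * u) fser.
Proof.
by apply: ordgeD; [exact: ordge_zX|apply: ordgeW (@ordge_zX K v); apply: ltnW].
Qed.

Lemma fser_lead : fser (2 * u)%N = 1.
Proof. by rewrite /fser psD !zXE eqxx (ltn_eqF ltuv) addr0. Qed.

Lemma two_u_e : exists j, (2 * u = e + 4 * j)%N.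
Proof. by exists ((2 * u - e) %/ 4)%N; arith. Qed.

Lemma hser_ord X : ordge (v + e) (hser X).
Proof.
apply: ordgeD; first by apply/ordge_cst/ordge_zX.
by apply: ordgeM; [exact: ordge_zX|apply: ordgeW (@om_ord X)].
Qed.

Lemma hser_lead X : hser X (v + e)%N = 2%:R.
Proof.
rewrite /hser psD cstM zXE eqxx mulr1 zXMl om_even ?addr0 //.
by rewrite -eqb0 -modn2; apply/eqP; arith.
Qed.

Lemma fser_mt_ord X : ordge (e + 2 * u) (fser * mt X 2).
Proof. by rewrite addnC; apply: ordgeM; [exact: fser_ord|exact: ordge_mt]. Qed.

(* When f lies in the module, so does the odd series l = f - x^j m_2, which
   therefore vanishes up to the smallest odd generator; this makes the obvious
   leading terms of the coordinate of f m_2 cancel. *)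
Lemma co_fser_mt X s : Mt X fser -> (0 < s)%N ->
    ~~ D (e + 2 * u + s) -> ~~ D (2 * u + s) ->
  co (Bt X) (e + 2 * u + s) (fser * mt X 2) =
  co (Bt X) (e + 2 * u + s) (hser X).
Proof.
move=> Mf s0 n1 n2; have [j uj] := two_u_e.
pose l := fser - zX (4 * j) * mt X 2.
have Ml : Mt X l.
  apply: (subspB (Mt_subsp X)) => //; rewrite -Bt_e.
  by apply/Mt_B/Dl_add4/D_e.
have lE : l = zX v - zX (4 * j) * om X.
  by rewrite /l /fser /om uj addnC zXD; ring.
have l_even k : ~~ odd k -> l k = 0.
  move=> ev; rewrite lE psB zXE zXM.
  have -> : (k == v) = false by apply: contraNF ev => /eqP->.
  case: ltnP => kj; first by rewrite subr0.
  by rewrite om_even ?subr0 // oddB // oddM addbF.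
have l_ord : ordge (minn (a 1) (a 3)) l.
  elim/ltn_ind => k IHk; rewrite leq_min => /andP[k1 k3].
  have [ok|/l_even//] := boolP (odd k).
  apply: (valset_lead Ml).
    by move=> i ik; apply: IHk => //; rewrite leq_min !(ltn_trans ik).
  rewrite Mt_valset /Dl => /negP.
  by case: (mod4_cases k) => kE; rewrite kE; move: k1 k3 (modn2 k); rewrite ok; lia.
have -> : fser * mt X 2 = Bt X (2 * u + e) + hser X - zX e * l.
  rewrite Bt_mod0; last by arith.
  have -> : mt X 2 = zX e + om X by rewrite /om addrC subrK.
  have -> : hser X = (1 + 1) * zX (v + e) + zX v * om X by rewrite -cst1 -cstD.
  rewrite lE /fser (zXD (2 * u) e) (zXD v e).
  have -> : zX (2 * u) = zX e * zX (4 * j) :> ps by rewrite uj zXD.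
  by ring.
rewrite coB coD (_ : co _ _ (Bt X _) = 0) ?add0r; last first.
  by apply: Mt_B => //; apply: (Dl_mod4_0 ga); arith.
rewrite [X in _ - X](co_ord _ (ordgeM (@ordge_zX K e) l_ord)) ?subr0 //.
have n1' : ~~ D (2 * u + s + e) by rewrite addnC addnA.
have := gap_pair (c := 1%N) ga isT isT (leq_addr _ _) n2 n1'.
have := gap_pair (c := 3) ga isT isT (leq_addr _ _) n2 n1'.
by rewrite /minn; case: ifP; lia.
Qed.

Definition solves X := forall c s, solved c s -> X c s = rhs X c s.

Definition fstable X := forall y, Mt X y -> Mt X (fser * y).

Lemma rhs2_S1 X s : S1 s -> rhs X 2 s = X 2 s + co (Bt X) (2 * u + s) fser.
Proof. by rewrite /rhs /= => ->. Qed.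

Lemma rhs2_S2 X s : S2 s ->
  rhs X 2 s = X 2 s - co (Bt X) (e + 2 * u + s) (fser * mt X 2).
Proof. by rewrite /rhs /S1 => /and3P[-> _ ->]. Qed.

Lemma rhs_q X s :
  rhs X q s = X q s + co (Bt X) (v + e + s) (hser X) / 2%:R.
Proof. by rewrite /rhs; case: eqP q_odd => // ->. Qed.

Hypothesis two_neq0 : 2%:R != 0 :> K.

Lemma solves_fstable X : D v || D (v + e) -> solves X -> fstable X.
Proof.
move=> adm sol; have add0P (x y : K) : x = x + y -> y = 0.
  by rewrite -{1}[x]addr0 => /addrI.
have Mf : Mt X fser.
  move=> k nk; case: (ltngtP k (2 * u)) => [ku|uk|kE].
  - exact: co_ord fser_ord ku.
  - have S1s : S1 (k - 2 * u) by rewrite /S1 subn_gt0 uk subnKC // ltnW.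
    have := sol 2%N (k - 2 * u)%N; rewrite /solved S1s => /(_ isT).
    by rewrite rhs2_S1 // subnKC 1?ltnW // => /add0P.
  - by rewrite kE (Dl_even ga) // oddM in nk.
have Mfm : Mt X (fser * mt X 2).
  move=> k nk; case: (ltngtP k (e + 2 * u)) => [ku|uk|kE].
  - exact: co_ord (fser_mt_ord X) ku.
  - have [s kE] : exists s, k = (e + 2 * u + s)%N.
      by exists (k - (e + 2 * u))%N; rewrite subnKC // ltnW.
    have s0 : (0 < s)%N by lia.
    rewrite kE in nk *; have [D2|n2] := boolP (D (2 * u + s)).
      have S2s : S2 s by rewrite /S2 s0 nk.
      have := sol 2%N s; rewrite /solved S2s orbT => /(_ isT).
      rewrite rhs2_S2 // => /add0P/eqP; rewrite oppr_eq0.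
      by move/eqP.
    rewrite co_fser_mt //.
    case: (ltngtP (e + 2 * u + s) (v + e)) => [lt|gt|E].
    + exact: co_ord (hser_ord X) lt.
    + have [t tE] : exists t, (e + 2 * u + s = v + e + t)%N.
        by exists (e + 2 * u + s - (v + e))%N; rewrite subnKC // ltnW.
      have S3t : S3 t.
        rewrite /S3 -tE nk; have -> : (v + t = 2 * u + s)%N by lia.
        by rewrite n2 !andbT; lia.
      have := sol q t; rewrite /solved S3t eqxx orbT => /(_ isT).
      rewrite rhs_q tE => /add0P/eqP; rewrite mulf_eq0 invr_eq0.
      by rewrite (negbTE two_neq0) orbF => /eqP.
    (* At v + e itself no unknown is available to cancel the leading coefficient 2 of [hser X];
       admissibility rules the case out. *)
    + move: adm; rewrite -E (negbTE nk) orbF.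
      have -> : v = (2 * u + s)%N by lia.
      by rewrite (negbTE n2).
  - by move: nk; rewrite kE (Dl_mod4_0 ga (k := (e + 2 * u)%N)) //; arith.
apply: (kerB_mul (@ordge_Bt X) (Bt_lead X) Dn) => d Dd.
case: (mod4_cases d) => dE.
- rewrite Bt_mod0 // mulrC (_ : d = 4 * (d %/ 4))%N; last by lia.
  exact: Mt_x4.
- apply: (Mt_ord X (m := d + 2 * u)).
    move=> k ku; apply: (@Dl_odd_tail u a ga 1) => //.
    by apply: leq_trans ku; rewrite leq_add2r; move: Dd; rewrite /Dl dE.
  by rewrite addnC; apply: ordgeM; [exact: fser_ord|exact: ordge_Bt].
- have [j ->] : exists j, d = (e + 4 * j)%N.
    by exists ((d - e) %/ 4)%N; move: Dd; rewrite /Dl dE; arith.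
  by rewrite Bt_e mulrCA; apply: Mt_x4.
- apply: (Mt_ord X (m := d + 2 * u)).
    move=> k ku; apply: (@Dl_odd_tail u a ga 3) => //.
    by apply: leq_trans ku; rewrite leq_add2r; move: Dd; rewrite /Dl dE.
  by rewrite addnC; apply: ordgeM; [exact: fser_ord|exact: ordge_Bt].
Qed.

Lemma Mt1 X : Mt X 1.
Proof. by have := Mt_B X (Dl_mod4_0 ga (k := 0) erefl); rewrite Bt_mod0 // zX0. Qed.

(** Stability makes the coordinates of f and f m_2 at the gaps vanish, which is the system. If v and
    v + e were both gaps, the coordinate of f m_2 at v + e would be the nonzero leading coefficient
    2 of [hser X]. *)
Lemma fstable_solves X : fstable X -> (D v || D (v + e)) /\ solves X.
Proof.
move=> st; have Mf : Mt X fser by rewrite -[fser]mulr1; apply/st/Mt1.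
have Mfm : Mt X (fser * mt X 2).
  by apply: st; have := Mt_B X D_e; rewrite -[X in Bt _ X]addn0 -(muln0 4) Bt_e zX0 mul1r.
split.
  rewrite -[_ || _]negbK negb_or; apply/negP => /andP[nv nve].
  have sE : (e + 2 * u + (v - 2 * u) = v + e)%N by lia.
  have := co_fser_mt Mf (s := (v - 2 * u)%N).
  rewrite sE subn_gt0 ltuv subnKC 1?ltnW // => /(_ isT nve nv).
  rewrite Mfm // (co_lead _ (hser_ord X)) hser_lead => /esym/eqP.
  by rewrite (negbTE two_neq0).
move=> c s /orP[/andP[/eqP-> /orP[S1s|S2s]]|/andP[/eqP-> S3s]].
- by rewrite rhs2_S1 // Mf ?addr0 //; case/andP: S1s.
- by rewrite rhs2_S2 // Mfm ?subr0 //; case/and3P: S2s.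
have [s0 n1 n2] := and3P S3s.
have [t tE] : exists t, (v + s = 2 * u + t)%N.
  by exists (v + s - 2 * u)%N; lia.
have tE' : (v + e + s = e + 2 * u + t)%N by lia.
rewrite rhs_q tE' -co_fser_mt //; [|lia|by rewrite -tE'|by rewrite -tE].
by rewrite Mfm ?mul0r ?addr0 // -tE'.
Qed.

Hypothesis adm : D v || D (v + e).

Lemma rhs_agree X Y c s : solved c s -> agree s X Y -> rhs X c s = rhs Y c s.
Proof.
move=> sol XY; have oB := ordge_Bt; have BB := fun d => Bt_agree (d := d) XY.
rewrite /rhs; have [c2|c2] := eqVneq c 2%N; last first.
  have /andP[/eqP cq S3s] : (c == q) && S3 s by move: sol; rewrite /solved (negbTE c2).
  have [s0 n1 n2] := and3P S3s.
  have Dve : D (v + e) by move: adm; rewrite (negbTE (S3_gap S3s)).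
  have oh : ordge (v + e) (hser X).
    apply: ordgeD; first by apply/ordge_cst/ordge_zX.
    by apply: ordgeM; [exact: ordge_zX|apply: ordgeW (om_ord X)].
  have [_ +] := co_perturb (oB X) BB oh s0.
  have -> : hser X (v + e)%N = 2%:R.
    rewrite /hser psD cstM zXE eqxx mulr1 zXMl om_even ?addr0 //.
    by rewrite -eqb0 -modn2; apply/eqP; arith.
  have BE Z : Bt Z (v + e) (v + e + s)%N = Z c s.
    rewrite (@Bt_gen _ q) ?q_lt4 //.
    have -> : (v + e + s = (v + e - a q) + (a q + s))%N.
      by move: Dve; rewrite /Dl -/q; lia.
    rewrite zXMl mt_shift ?cq //; first by have := q_odd; case: (q).
    apply: contra n1 => Dq; apply: Dl_mono Dq _ _.
      by move: Dve; rewrite /Dl -/q; lia.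
    by rewrite -modnDml -/q -{1}(gens_mod ga q_lt4) modnDml.
  (* The series itself depends on X. Its change has order at least v + e + s, and the coefficient
     there comes from m_2 at the even exponent e + s, where m_2 has none. *)
  have -> : co (Bt Y) (v + e + s) (hser X) = co (Bt Y) (v + e + s) (hser Y).
    have -> : hser X = hser Y + zX v * (mt X 2 - mt Y 2) by rewrite /hser /om; ring.
    rewrite coD [X in _ + X]co_lead ?addr0.
      rewrite -addnA zXMl psB.
      have ev : ~~ odd (e + s).
        have o1 : odd (v + s) by apply: (gap_odd ga n2); lia.
        have o1' : ((v + s) %% 2 = 1)%N by rewrite modn2 o1.
        by rewrite -eqb0 -modn2; apply/eqP; arith.
      have mE Z : mt Z 2 (e + s) = 0.
        rewrite -[RHS](om_even Z ev) /om psB zXE gtn_eqF ?subr0 //; lia.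
      by rewrite !mE subrr addr0.
    by rewrite -addnA; apply: ordgeM; [exact: ordge_zX|exact: mt_agree].
  rewrite !BE => E; apply: (mulfI two_neq0).
  by rewrite !mulrDr ![_ * (_ / _)]mulrC !divfK // ![2%:R * _ + _]addrC.
have sol2 : S1 s || S2 s.
  by move: sol; rewrite /solved c2 /=; case: eqP (q_odd) => [<-|] //; rewrite orbF.
case: ifP sol2 => [/andP[s0 n1] _|_ /= /and3P[s0 n1 n2]].
  have [_] := co_perturb (oB X) BB fser_ord s0.
  have [j uj] := two_u_e.
  have BE Z : Bt Z (2 * u) (2 * u + s)%N = Z 2%N s.
    rewrite uj Bt_e (_ : e + 4 * j + s = 4 * j + (e + s))%N; last by lia.
    rewrite zXMl mt_shift //; apply: contra n1 => De.
    by apply: Dl_mono De _ _; lia.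
  by rewrite !BE fser_lead !mul1r ![co _ _ _ + _]addrC.
have omt Z : ordge (e + 2 * u) (fser * mt Z 2).
  by rewrite addnC; apply: ordgeM; [exact: fser_ord|exact: ordge_mt].
have [_] := co_perturb (oB X) BB (omt X) s0.
(* As e + 2u is divisible by 4, the basis element at the leading order is a monomial and gives no
   correction; X 2 s enters through m_2 in the product only. *)
have BE Z : Bt Z (e + 2 * u) (e + 2 * u + s)%N = 0.
  rewrite Bt_mod0 ?zXE; last by arith.
  by rewrite gtn_eqF //; lia.
rewrite !BE !mulr0 !addr0 => ->.
have -> : fser * mt X 2 = fser * mt Y 2 + fser * (mt X 2 - mt Y 2) by ring.
have nes : ~~ D (e + s).
  by apply: contra n1 => De; rewrite addnAC; apply: Dl_add2u.
have oXY := mt_agree (c := 2%N) XY.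
have -> : (e + 2 * u + s = 2 * u + (e + s))%N by lia.
rewrite coD [co _ _ (_ * (_ - _))]co_lead.
  by rewrite (ordge_lead fser_ord oXY) fser_lead psB !mt_shift //; ring.
by apply: ordgeM => //; exact: fser_ord.
Qed.

Lemma S3_adm s : S3 s -> D (v + e).
Proof. by move=> /S3_gap nv; move: adm; rewrite (negbTE nv). Qed.

Lemma solved_gap c s : solved c s ->
  [&& 0 < c, c < 4, 0 < s & ~~ D (a c + s)]%N.
Proof.
move=> sol; case/orP: (sol) => [/andP[/eqP-> /orP[/andP[s0 n1]|/and3P[s0 n1 n2]]]|].
- rewrite s0 /=; apply: contra n1 => De; have [j uj] := two_u_e.
  by apply: Dl_mono De _ _; rewrite uj; lia.
- by rewrite s0 /=; apply: contra n1 => De; rewrite addnAC; apply: (Dl_add2u ga).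
move=> /andP[/eqP-> S3s]; have [s0 n1 n2] := and3P S3s.
have Dve := S3_adm S3s.
have q4 := q_lt4.
rewrite s0 q4 /=; have := q_odd; case E: q => [//|q'] _ /=.
rewrite -E; apply: contra n1 => Dq; apply: Dl_mono Dq _ _.
  by move: Dve; rewrite /Dl -/q; lia.
by rewrite -modnDml -/q -{1}(gens_mod ga q4) modnDml.
Qed.

End Core.

(** * Solving a triangular system by iteration *)

Section TriangularSystem.
Context {K : fieldType}.
Variables (S : nat -> nat -> bool) (P : (nat -> nat -> K) -> nat -> nat -> K).
Variable N : nat.
Hypothesis SN : forall c s, S c s -> (s < N)%N.
Hypothesis P_agree : forall X Y c s, S c s -> agree s X Y -> P X c s = P Y c s.
Implicit Types X t : nat -> nat -> K.

Definition tri_step t X : nat -> nat -> K :=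
  fun c s => if S c s then P X c s else t c s.

Definition tri_sol t := iter N (tri_step t) t.

(** An equation at depth s reads smaller depths only, so depth s is final after s + 1 rounds. Solved
    entries have depth below N, hence N rounds suffice. *)
Lemma tri_stable t k c s : (s < k)%N ->
  iter k.+1 (tri_step t) t c s = iter k (tri_step t) t c s.
Proof.
elim: k c s => // k IHk c s sk.
rewrite [LHS]/= [RHS]/= /tri_step; case: ifP => // Scs.
apply: P_agree => // c' s' s's; apply: IHk; lia.
Qed.

Lemma tri_sol_solved t c s : S c s -> tri_sol t c s = P (tri_sol t) c s.
Proof.
move=> Scs; rewrite /tri_sol -tri_stable; last exact: SN Scs.
by rewrite [LHS]/= /tri_step Scs.
Qed.

Lemma tri_sol_free t c s : ~~ S c s -> tri_sol t c s = t c s.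
Proof.
move=> nS; rewrite /tri_sol; elim: (N) => //= k _.
by rewrite /tri_step (negbTE nS).
Qed.

Lemma tri_sol_unique t X :
    (forall c s, S c s -> X c s = P X c s) ->
    (forall c s, ~~ S c s -> X c s = t c s) ->
  forall c s, X c s = tri_sol t c s.
Proof.
move=> XS XF c s; elim/ltn_ind: s c => s IHs c.
case: (boolP (S c s)) => [Scs|nS]; last by rewrite XF // tri_sol_free.
by rewrite XS // tri_sol_solved //; apply: P_agree => // c' s' /IHs.
Qed.

End TriangularSystem.

(** * Coordinates of flags of modules *)

Section Flags.
Context {K : fieldType}.
Local Notation ps := (pseries K).
Variables (u v n : nat) (a0 : nat -> nat) (G : seq nat).
Hypothesis ga0 : generators u a0.
Hypothesis Dn0 : forall k, (n <= k)%N -> Dl a0 k.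
Hypothesis sG : sorted ltn G.
Hypothesis Gnext : forall g, g \in G -> a0 (g %% 4) = (g + 4)%N.
Hypothesis Godd : forall g, g \in G -> odd g ->
  forall k, (g + 2 * u <= k)%N -> Dl a0 k.

Definition g2 : nat := (a0 2 - 4)%N.
Definition has2 : bool := g2 \in G.
Definition ast (c : nat) : nat := if has2 && (c == 2%N) then g2 else a0 c.
Definition Di (i k : nat) : bool := Dl a0 k || (k \in take i G).
Definition level (g : nat) : nat := (index g G).+1.

Record Rmodule (M : set ps) : Prop := RModule {
  Rmod_subsp : subsp M;
  Rmod_tail : contains_tail n M;
  Rmod_x : forall y, M y -> M (zX 4 * y);
  Rmod_f : forall y, M y -> M (fser u v * y) }.

Record flag_chain (M : nat -> set ps) : Prop := FlagChain {
  chain_Rmod : forall i, Rmodule (M i);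
  chain_val : forall i k, valset (M i) k <-> Di i k;
  chain_mono : forall i j, (i <= j)%N -> M i `<=` M j }.

Record reduced_bases (M : nat -> set ps) (rb : nat -> nat -> ps) : Prop := ReducedBases {
  rb_mem : forall i d, Di i d -> M i (rb i d);
  rb_ord : forall i d, Di i d -> ordge d (rb i d);
  rb_lead : forall i d, Di i d -> rb i d d = 1;
  rb_red : forall i d k, Di i d -> Di i k -> k != d -> rb i d k = 0 }.

Lemma g2E : has2 -> a0 2 = (g2 + 4)%N.
Proof.
move=> h; suff : (4 <= a0 2)%N by rewrite /g2; lia.
(* For a0 2 < 4 the truncated subtraction would give g2 = 0, but 0 is the generator of its own class
   and cannot be adjoined. *)
rewrite leqNgt; apply/negP => lt4; have g0 : g2 = 0%N by rewrite /g2; lia.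
by have := Gnext h; rewrite g0 mod0n (gens0 ga0).
Qed.

Lemma g2_mod : has2 -> (g2 %% 4 = 2)%N.
Proof. by move=> /g2E; have := gens_mod ga0 (c := 2) isT; lia. Qed.

Lemma G_gap g : g \in G -> ~~ Dl a0 g.
Proof. by move=> /Gnext; rewrite /Dl => ->; lia. Qed.

Lemma G_class g : g \in G -> (g %% 4 == 2)%N -> has2 /\ g = g2.
Proof.
move=> gG /eqP gc; have := Gnext gG; rewrite gc => E.
have -> : g2 = g by rewrite /g2 E addnK.
by rewrite /has2 /g2 E addnK.
Qed.

Lemma G_odd g : g \in G -> (g %% 4 != 2)%N -> odd g.
Proof.
move=> gG gc; have := Gnext gG.
case: (mod4_cases g) gc => E; rewrite E // ?(gens0 ga0); [lia| |];
  by move=> _ _; rewrite -[odd g]eqb1 -modn2; apply/eqP; lia.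
Qed.

Lemma G_level g i : g \in G -> (g \in take i G) = (level g <= i)%N.
Proof. by move=> gG; rewrite in_take // /level. Qed.

Lemma G_take_le g g' : g \in G -> g' \in take (level g) G -> (g' <= g)%N.
Proof.
move=> gG g't; have g'G := mem_take g't.
have := g't; rewrite G_level // /level ltnS => le.
have so : sorted leq G by apply: sub_sorted sG => x y /ltnW.
by have := sorted_leq_nth leq_trans leqnn 0%N so; move=> /(_ _ _ _ _ le);
  rewrite !nth_index // !inE !index_mem; apply.
Qed.

Lemma gast : generators u ast.
Proof.
have [h|/negbTE nh] := boolP has2; last first.
  by rewrite (_ : ast = a0) //; apply: funext => c; rewrite /ast nh.
split; rewrite /ast ?h /=; try by case: ga0.
  move=> c c4; case: eqP => [->|_]; [exact: g2_mod|exact: (gens_mod ga0)].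
by apply: leq_trans (gens2 ga0); exact: leq_subr.
Qed.

Lemma Dl_ast k : Dl ast k = Dl a0 k || has2 && (k == g2).
Proof.
have [h|/negbTE nh] := boolP has2; last first.
  by rewrite (_ : ast = a0) ?orbF //; apply: funext => c; rewrite /ast nh.
rewrite /Dl /ast h /=; have := g2E h; have := g2_mod h.
case: eqP => kc E1 E2; last first.
  by case: eqP => [E|_]; rewrite ?orbF //; move: kc; rewrite E.
rewrite kc E2; case: eqP => [->|]; first by rewrite leqnn orbT.
by rewrite orbF; lia.
Qed.

Lemma Dn_ast k : (n <= k)%N -> Dl ast k.
Proof. by move=> /Dn0 Dk; rewrite Dl_ast Dk. Qed.

Lemma g2_lt : has2 -> (g2 < 2 * u)%N.
Proof. by move=> h; have := gens2 ga0; have := g2E h; lia. Qed.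

Lemma g2_gap : has2 -> ~~ Dl a0 g2.
Proof. exact: G_gap. Qed.

Lemma Rmod_BB M gen d : Rmodule M -> (forall c, (c < 4)%N -> M (gen c)) ->
  Dl a0 d -> M (BB a0 gen d).
Proof. by move=> RM Mg Dd; apply: BB_in => //; [exact: ga0|exact: Rmod_x]. Qed.

Lemma forall_lt4 (P : nat -> Prop) : P 0%N -> P 1%N -> P 2%N -> P 3%N ->
  forall c, (c < 4)%N -> P c.
Proof. by move=> ? ? ? ? [|[|[|[|]]]]. Qed.

(* If some g_i is congruent to 2 mod 4, it is g2 = a0 2 - 4, and M* is M_0 with
   the reduced element of valuation g2 of the flag adjoined; otherwise M* is M_0.
   The coordinates of a flag are: the reduced element w of valuation 0 of M*; the
   coefficients X of the reduced generators of w^-1 M*; the linear functional s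
   that cuts M_0 out of M* on the generators below g2; and, for each odd g_i, the
   coefficients t of the combination x W of generators of M_0 larger than
   g_i + 4, W being the new element of valuation g_i. *)
Section Coordinates.
Variable rb : nat -> nat -> ps.

Definition mm (c : nat) : ps := rb 0 (a0 c).
Definition WW (g : nat) : ps := rb (level g) g.
Definition ww : ps := if has2 then mm 0 - cst (mm 0 g2) * WW g2 else mm 0.
Definition gst (c : nat) : ps :=
  if c == 0%N then ww else if has2 && (c == 2%N) then WW g2 else mm c.
Definition Btl (d : nat) : ps :=
  if Dl ast d then ps_inv ww * BB ast gst d else zX d.
(** The reduced generator of w^-1 M* of order [ast c] is z^(ast c) minus its components along the
    gap monomials, which belong to the basis [Btl]; hence the sign. *)
Definition Xco (c s : nat) : K := - co Btl (ast c + s) (zX (ast c)).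
Definition mst (X : nat -> nat -> K) (w : ps) (c : nat) : ps := w * mt ast X c.
(** When [has2] holds, M_0 is a hyperplane of M*. The coordinate at g2 along a basis adapted to M_0
    is the functional on M* with kernel M_0 and value 1 on w m_2. *)
Definition sco (c : nat) : K := co (BB a0 mm) g2 (mst Xco ww c).
Definition m0 (X : nat -> nat -> K) (w : ps) (s : nat -> K) (c : nat) : ps :=
  if has2 then
    if c == 2%N then zX 4 * mst X w 2
    else mst X w c - cst (if (a0 c < g2)%N then s c else 0) * mst X w 2
  else mst X w c.
Definition tco (c c' : nat) : K :=
  co (BB a0 (m0 Xco ww sco)) (a0 c') (zX 4 * WW (a0 c - 4)).
(** The new element W is determined up to M_0 by its order and leading coefficient, so x W matters
    modulo x M_0, where the four generators form a basis. Besides m_c itself, only generators of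
    larger order can occur. *)
Definition xw X w s (t : nat -> nat -> K) (c : nat) : ps :=
  m0 X w s c + \sum_(c' < 4 | (a0 c < a0 c')%N) cst (t c c') * m0 X w s c'.
Definition wG X w s t (g : nat) : ps :=
  if (g %% 4 == 2)%N then mst X w 2 else pdiv 4 (xw X w s t (g %% 4)).
Definition Bi X w s t (i d : nat) : ps :=
  if Dl a0 d then BB a0 (m0 X w s) d else
  if d \in take i G then wG X w s t d else zX d.

End Coordinates.

(** * Orders and leading coefficients of the parametrized bases *)

Section ParametrizedBases.
Variables (X : nat -> nat -> K) (w : ps) (s : nat -> K) (t : nat -> nat -> K).
Hypothesis w1 : w 0%N = 1.
Local Notation mst := (mst X w).
Local Notation m0 := (m0 X w s).

Lemma mst_ord c : ordge (ast c) (mst c).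
Proof. exact/ordge_mulr/ordge_mt. Qed.

Lemma mst_lead c : mst c (ast c) = 1.
Proof.
have := ordge_lead (ordge0 w) (@ordge_mt K ast X c).
by rewrite add0n w1 mul1r mt_lead.
Qed.

Lemma ast_neq2 c : c != 2%N -> ast c = a0 c.
Proof. by rewrite /ast => /negbTE->; rewrite andbF. Qed.

Lemma ast2 : has2 -> ast 2 = g2. Proof. by rewrite /ast => ->. Qed.

Lemma ast_no2 c : has2 = false -> ast c = a0 c. Proof. by rewrite /ast => ->. Qed.

Lemma m0_ord c : ordge (a0 c) (m0 c).
Proof.
rewrite /m0; case: ifP => h; last by rewrite -ast_no2 //; exact: mst_ord.
case: eqP => [->|/eqP c2].
  by rewrite (g2E h) addnC -(ast2 h); apply: ordgeM; [exact: ordge_zX|exact: mst_ord].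
rewrite -ast_neq2 //; apply: ordgeB; first exact: mst_ord.
case: ifP => lt; last by rewrite cst0 mul0r.
apply/ordge_cst/(ordgeW _ (@mst_ord 2)).
by rewrite (ast2 h) ltnW.
Qed.

Lemma m0_lead c : m0 c (a0 c) = 1.
Proof.
rewrite /m0; case: ifP => h; last by rewrite -ast_no2 //; exact: mst_lead.
case: eqP => [->|/eqP c2].
  by rewrite (g2E h) addnC zXMl -(ast2 h) mst_lead.
rewrite -{2}(ast_neq2 c2) psB mst_lead ast_neq2 // cstM.
case: ifP => lt; last by rewrite mul0r subr0.
by rewrite (@mst_ord 2) ?mulr0 ?subr0 // ast2.
Qed.

Lemma xw_ord c : ordge (a0 c) (xw X w s t c).
Proof.
apply: ordgeD; first exact: m0_ord.
apply: ordge_sum => c' lt; apply/ordge_cst/(ordgeW _ (@m0_ord c')).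
exact: ltnW.
Qed.

Lemma xw_lead c : xw X w s t c (a0 c) = 1.
Proof.
rewrite /xw psD m0_lead ps_sum big1 ?addr0 // => c' lt.
by rewrite cstM (@m0_ord c') ?mulr0.
Qed.

Lemma wG_x g : g \in G -> (g %% 4 != 2)%N ->
  zX 4 * wG X w s t g = xw X w s t (g %% 4).
Proof.
move=> gG /negbTE gc; rewrite /wG gc pdivK //.
by apply: (ordgeW _ (@xw_ord (g %% 4))); rewrite (Gnext gG) leq_addl.
Qed.

Lemma wG_ord g : g \in G -> ordge g (wG X w s t g).
Proof.
move=> gG; have [gc|gc] := boolP (g %% 4 == 2)%N.
  have [h ->] := G_class gG gc; rewrite /wG g2_mod //= -ast2 //; exact: mst_ord.
move=> k kg; rewrite -(zXMl 4) wG_x // xw_ord // (Gnext gG) addnC.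
by rewrite ltn_add2r.
Qed.

Lemma wG_lead g : g \in G -> wG X w s t g g = 1.
Proof.
move=> gG; have [gc|gc] := boolP (g %% 4 == 2)%N.
  have [h ->] := G_class gG gc.
  by rewrite /wG g2_mod //=; have := mst_lead 2; rewrite ast2.
by rewrite -(zXMl 4) wG_x // addnC -(Gnext gG) xw_lead.
Qed.

Lemma Bi_ord i d : ordge d (Bi X w s t i d).
Proof.
rewrite /Bi; case: ifP => _; first by apply: ordge_BB => c _; exact: m0_ord.
case: ifP => [/mem_take|_]; [exact: wG_ord|exact: ordge_zX].
Qed.

Lemma Bi_lead i d : Bi X w s t i d d = 1.
Proof.
rewrite /Bi; case: ifP => _; first by apply: BB_lead => c _; exact: m0_lead.
case: ifP => [/mem_take|_]; [exact: wG_lead|by rewrite zXE eqxx].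
Qed.

End ParametrizedBases.

(** From b on, M_i has no orders beyond those of M_0. Applied just above the largest adjoined
    element, it shows that two elements of M_i with the same leading term there differ by an element
    of M_0. *)
Lemma chain_down M i b y : flag_chain M -> M i y -> ordge b y ->
  (forall g, g \in take i G -> (g < b)%N) -> M 0%N y.
Proof.
move=> ch My oy lt.
have [s0 t0 _ _] := chain_Rmod ch 0; have [si _ _ _] := chain_Rmod ch i.
apply: (valset_sub s0 si t0 (chain_mono ch (leq0n i)) _ My oy) => k bk.
rewrite !(chain_val ch) /Di take0 orbF => /orP[//|/lt].
by rewrite ltnNge bk.
Qed.

Hypothesis v_odd : odd v.
Hypothesis ltuv : (2 * u < v)%N.
Hypothesis two_neq0 : 2%:R != 0 :> K.

(** * From a flag of modules to its coordinates *)

Section ChainToCoordinates.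
Variables (M : nat -> set ps) (rb : nat -> nat -> ps).
Hypothesis ch : flag_chain M.
Hypothesis rbM : reduced_bases M rb.

Local Notation mm := (mm rb).
Local Notation WW := (WW rb).
Local Notation ww := (ww rb).
Local Notation gst := (gst rb).

Lemma Di0 k : Di 0 k = Dl a0 k. Proof. by rewrite /Di take0 orbF. Qed.

Lemma Di_a0 i k : Dl a0 k -> Di i k. Proof. by rewrite /Di => ->. Qed.

Lemma Dl_a0 c : (c < 4)%N -> Dl a0 (a0 c).
Proof. by move=> c4; apply: (Dl_gen c4); rewrite ?(gens_mod ga0). Qed.

Lemma Di_level g : g \in G -> Di (level g) g.
Proof. by move=> gG; rewrite /Di G_level // leqnn orbT. Qed.

Lemma mm_mem c : (c < 4)%N -> M 0%N (mm c).
Proof. by move=> c4; apply: (rb_mem rbM); rewrite Di0 Dl_a0. Qed.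

Lemma mm_ord c : (c < 4)%N -> ordge (a0 c) (mm c).
Proof. by move=> c4; apply: (rb_ord rbM); rewrite Di0 Dl_a0. Qed.

Lemma mm_lead c : (c < 4)%N -> mm c (a0 c) = 1.
Proof. by move=> c4; apply: (rb_lead rbM); rewrite Di0 Dl_a0. Qed.

Lemma WW_mem g : g \in G -> M (level g) (WW g).
Proof. by move=> gG; apply: (rb_mem rbM); apply: Di_level. Qed.

Lemma WW_ord g : g \in G -> ordge g (WW g).
Proof. by move=> gG; apply: (rb_ord rbM); apply: Di_level. Qed.

Lemma WW_lead g : g \in G -> WW g g = 1.
Proof. by move=> gG; apply: (rb_lead rbM); apply: Di_level. Qed.

Lemma sub0 i : M 0%N `<=` M i. Proof. exact: chain_mono. Qed.

Lemma level_down g y : g \in G -> M (level g) y -> ordge g.+1 y -> M 0%N y.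
Proof.
move=> gG My oy; apply: (chain_down ch My oy) => g' /(G_take_le gG).
by rewrite ltnS.
Qed.

Lemma M0_kerB gen : (forall c, (c < 4)%N -> M 0%N (gen c)) ->
    (forall c, (c < 4)%N -> ordge (a0 c) (gen c)) ->
    (forall c, (c < 4)%N -> gen c (a0 c) = 1) ->
  kerB (BB a0 gen) (Dl a0) = M 0%N.
Proof.
move=> Mg og g1; have RM := chain_Rmod ch 0.
apply: (kerB_eq (ordge_BB og) (BB_lead g1) Dn0).
- exact: Rmod_subsp.
- by move=> k; rewrite (chain_val ch) Di0.
- by move=> d Dd; apply: Rmod_BB.
- exact: Rmod_tail.
Qed.

Lemma M0_mm : kerB (BB a0 mm) (Dl a0) = M 0%N.
Proof. by apply: M0_kerB; [exact: mm_mem|exact: mm_ord|exact: mm_lead]. Qed.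

Lemma gst_ord c : (c < 4)%N -> ordge (ast c) (gst c).
Proof.
move: c; apply: forall_lt4; rewrite /gst /ast ?andbF ?andbT /=.
- by rewrite (gens0 ga0).
- exact: mm_ord.
- by case: ifP => h; [exact: WW_ord|exact: mm_ord].
- exact: mm_ord.
Qed.

Lemma g2_gt0 : has2 -> (0 < g2)%N.
Proof. by move/g2_mod; case: (g2). Qed.

Lemma ww0 : ww 0%N = 1.
Proof.
have m0 : mm 0 0%N = 1 by have := mm_lead (c := 0) isT; rewrite (gens0 ga0).
rewrite /ww; case: ifP => h //.
by rewrite psB cstM m0 (WW_ord h) ?mulr0 ?subr0 //; exact: g2_gt0.
Qed.

Lemma gst_lead c : (c < 4)%N -> gst c (ast c) = 1.
Proof.
move: c; apply: forall_lt4; rewrite /gst /ast ?andbF ?andbT /=.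
- by rewrite (gens0 ga0) ww0.
- exact: mm_lead.
- by case: ifP => h; [exact: WW_lead|exact: mm_lead].
- exact: mm_lead.
Qed.

Lemma ww_red k : Dl ast k -> k != 0%N -> ww k = 0.
Proof.
have D00 : Di 0 (a0 0) by rewrite Di0 Dl_a0.
move=> Dk k0; rewrite /ww; case: ifP => h; last first.
  move: Dk; rewrite Dl_ast h orbF => Dk.
  by apply: (rb_red rbM); rewrite ?Di0 ?(gens0 ga0) //; apply: (Dl_mod4_0 ga0).
rewrite psB cstM; move: Dk; rewrite Dl_ast h /=.
have [-> _|kg /=] := eqVneq k g2; first by rewrite WW_lead // mulr1 subrr.
rewrite orbF => Dk; rewrite [X in X - _](rb_red rbM) ?Di0 ?(gens0 ga0) //.
  by rewrite [X in _ * X](rb_red rbM) ?mulr0 ?subrr //; [exact: Di_level|exact: Di_a0].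
exact: (Dl_mod4_0 ga0).
Qed.

(** M* need not occur in the flag, since the module in which g2 appears may also contain odd
    elements adjoined earlier. It is therefore built from its generators inside that module. *)
Definition Mst : set ps := kerB (BB ast gst) (Dl ast).

Lemma Mst_subsp : subsp Mst. Proof. exact: kerB_subsp. Qed.
Lemma Mst_tail : contains_tail n Mst. Proof. exact: kerB_tail Dn_ast. Qed.
Lemma Mst_val k : valset Mst k <-> Dl ast k.
Proof. exact: (kerB_valset (ordge_BB gst_ord) (BB_lead gst_lead)). Qed.

Lemma Mst_x y : Mst y -> Mst (zX 4 * y).
Proof. exact: (BB_x gast gst_ord gst_lead Dn_ast). Qed.

Lemma gst_mem c : (c < 4)%N -> Mst (gst c).
Proof. exact: (gen_mem gast gst_ord gst_lead). Qed.

Definition lev2 : nat := if has2 then level g2 else 0%N.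

Lemma Mst_lev2 : Mst `<=` M lev2.
Proof.
have RM := chain_Rmod ch lev2; have sM := Rmod_subsp RM.
have Mm c : (c < 4)%N -> M lev2 (mm c) by move=> c4; apply/sub0/mm_mem.
have MW : has2 -> M lev2 (WW g2) by move=> h; rewrite /lev2 h; apply: WW_mem.
apply: (kerB_subset (ordge_BB gst_ord) (BB_lead gst_lead) sM (Rmod_tail RM)) => d Dd.
apply: (BB_in gast Dd); first exact: Rmod_x.
apply: forall_lt4; rewrite /gst ?andbF ?andbT /=; try exact: Mm.
  rewrite /ww; case: ifP => h; last exact: Mm.
  by apply: (subspB sM); [exact: Mm|apply: (subspZ sM); exact: MW].
by case: ifP => h; [exact: MW|exact: Mm].
Qed.

Lemma lev2_down y : M lev2 y -> (has2 -> ordge g2.+1 y) -> M 0%N y.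
Proof.
rewrite /lev2; case: ifP => // h My /(_ isT); exact: level_down.
Qed.

Lemma lev2_Mst y : M lev2 y -> (has2 -> ordge g2 y) ->
  (~~ has2 -> M 0%N y -> Mst y) -> Mst y.
Proof.
rewrite /lev2; case: ifP => h My oy nh; last exact: nh.
have [si _ _ _] := chain_Rmod ch (level g2).
have sub : Mst `<=` M (level g2) by have := Mst_lev2; rewrite /lev2 h.
apply: (valset_sub Mst_subsp si Mst_tail sub _ My (oy isT)) => k gk.
rewrite (chain_val ch) Mst_val Dl_ast /Di h /= => /orP[->//|/(G_take_le h) kg].
by rewrite (_ : k = g2) ?eqxx ?orbT //; apply/eqP; rewrite eqn_leq kg.
Qed.

Lemma Mst_no2 : ~~ has2 -> Mst = M 0%N.
Proof.
move=> /negbTE h; rewrite -M0_mm /Mst.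
have -> : ast = a0 by apply: funext => c; rewrite /ast h.
suff -> : gst = mm by [].
by apply: funext => -[|c]; rewrite /gst /ww h.
Qed.

Lemma M0_Mst : M 0%N `<=` Mst.
Proof.
have [h|nh] := boolP has2; last by rewrite Mst_no2.
rewrite -M0_mm; apply: (kerB_subset (ordge_BB mm_ord) (BB_lead mm_lead) Mst_subsp Mst_tail) => d Dd.
apply: (BB_in ga0 Dd); first exact: Mst_x.
have gm := gst_mem; apply: forall_lt4.
- have -> : mm 0 = ww + cst (mm 0 g2) * WW g2 by rewrite /ww h subrK.
  apply: (subspD Mst_subsp); first exact: (gm 0%N).
  by apply: (subspZ Mst_subsp); have := gm 2%N isT; rewrite /gst h.
- by have := gm 1%N isT; rewrite /gst andbF.
- apply: lev2_Mst => [|_|]; rewrite ?h //; first exact/sub0/mm_mem.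
  by apply: ordgeW (mm_ord (c := 2) isT); rewrite (g2E h) leq_addr.
- by have := gm 3%N isT; rewrite /gst andbF.
Qed.

Lemma Mst_high y : Mst y -> (has2 -> ordge g2.+1 y) -> M 0%N y.
Proof. by move=> /Mst_lev2; exact: lev2_down. Qed.

(** The product lies in the flag module at [lev2] and has order at least 2u > g2, above everything
    adjoined up to there, so it is in M_0. Stability of M* under f rests on this. *)
Lemma Mst_fM0 y : Mst y -> M 0%N (fser u v * y).
Proof.
move=> /Mst_lev2 My; apply: lev2_down.
  exact: (Rmod_f (chain_Rmod ch lev2)).
move=> h; rewrite -[g2.+1]addn0; apply: ordgeM => //.
by apply: ordgeW (fser_ord ltuv); exact: g2_lt.
Qed.

Lemma ww_mem : Mst ww. Proof. exact: (gst_mem (c := 0) isT). Qed.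

Definition Mtil : set ps := [set y | Mst (ww * y)].

Lemma Mtil_subsp : subsp Mtil. Proof. exact: subsp_mulr Mst_subsp. Qed.

Lemma Mtil_tail : contains_tail n Mtil.
Proof. by move=> y oy; apply/Mst_tail/ordge_mulr. Qed.

Lemma Mtil_x y : Mtil y -> Mtil (zX 4 * y).
Proof. by rewrite /Mtil /= mulrCA; apply: Mst_x. Qed.

Lemma Mtil_f y : Mtil y -> Mtil (fser u v * y).
Proof. by rewrite /Mtil /= mulrCA => /Mst_fM0 /M0_Mst. Qed.

Lemma Mtil1 : Mtil 1. Proof. by rewrite /Mtil /= mulr1; exact: ww_mem. Qed.

Lemma ww_ord_mul m y : ordge m y -> (ww * y) m = y m.
Proof.
move=> oy; have := ordge_lead (ordge0 ww) oy.
by rewrite add0n ww0 mul1r.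
Qed.

Lemma Mtil_val k : valset Mtil k -> Dl ast k.
Proof.
move=> /(valsetP _ Mtil_subsp)[y [My oy y1]].
apply/Mst_val/(valsetP _ Mst_subsp); exists (ww * y); split=> //.
  exact: ordge_mulr.
by rewrite ww_ord_mul.
Qed.

Lemma Btl_ord d : ordge d (Btl rb d).
Proof.
rewrite /Btl; case: ifP => _; last exact: ordge_zX.
exact/ordge_mulr/(ordge_BB gst_ord).
Qed.

Lemma ps_inv_ww : ww * ps_inv ww = 1. Proof. exact: ps_invK ww0. Qed.

Lemma Btl_lead d : Btl rb d d = 1.
Proof.
rewrite /Btl; case: ifP => _; last by rewrite zXE eqxx.
rewrite -ww_ord_mul; last exact/ordge_mulr/(ordge_BB gst_ord).
by rewrite mulrA ps_inv_ww mul1r (BB_lead gst_lead).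
Qed.

Lemma Btl_ker : kerB (Btl rb) (Dl ast) = Mtil.
Proof.
apply: (kerB_eq Btl_ord Btl_lead Dn_ast Mtil_subsp Mtil_val _ Mtil_tail).
move=> d Dd; rewrite /Btl Dd /Mtil /= mulrA ps_inv_ww mul1r.
exact: (kerB_B (ordge_BB gst_ord) (BB_lead gst_lead)).
Qed.

Lemma mt_Xco_mem c : (c < 4)%N -> Mtil (mt ast (Xco rb) c).
Proof.
move=> c4; have [->|c0] := eqVneq c 0%N; first by rewrite (mt0 gast); exact: Mtil1.
rewrite -Btl_ker => k nk.
have E : mt ast (Xco rb) c = zX (ast c) -
    \sum_(i < n | (ast c < i)%N && ~~ Dl ast i) cst (co (Btl rb) i (zX (ast c))) * Btl rb i.
  rewrite (mt_expand Dn_ast) // -sumrN; congr (_ + _); apply: eq_bigr => i /andP[ci ni].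
  by rewrite /Xco subnKC ?(ltnW ci) // cstN mulNr [in RHS]/Btl (negbTE ni).
rewrite E coB co_sum.
have coBtl i : co (Btl rb) k (Btl rb i) = (k == i)%:R by apply: co_B Btl_ord Btl_lead _ _.
case: (ltngtP k (ast c)) => [kc|ck|kc].
- rewrite (co_ord _ (@ordge_zX K _) kc) big1 ?subr0 // => i /andP[ci _].
  by rewrite coZ coBtl (ltn_eqF (ltn_trans kc ci)) mulr0.
- have kn : (k < n)%N by rewrite ltnNge; apply: contra nk; exact: Dn_ast.
  rewrite (bigD1 (Ordinal kn)) /=; last by rewrite ck.
  rewrite coZ coBtl eqxx mulr1 big1 ?addr0 ?subrr // => i /andP[_ ik].
  rewrite coZ coBtl; rewrite -val_eqE /= eq_sym in ik.
  by rewrite (negbTE ik) mulr0.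
- by move: nk; rewrite kc (Dl_gen c4) // (gens_mod gast).
Qed.

Lemma Mt_Xco : Mt ast (Xco rb) = Mtil.
Proof.
apply: (kerB_eq (@ordge_Bt K ast (Xco rb)) (Bt_lead ast (Xco rb)) Dn_ast
  Mtil_subsp Mtil_val _ Mtil_tail) => d Dd.
apply: (BB_in gast Dd (gen := mt ast (Xco rb))); first exact: Mtil_x.
exact: mt_Xco_mem.
Qed.

Lemma Xco_solves :
  (Dl ast v || Dl ast (v + ast 2)) /\ solves u v ast (Xco rb).
Proof.
apply: (fstable_solves gast v_odd ltuv two_neq0) => y.
by rewrite Mt_Xco; exact: Mtil_f.
Qed.

Local Notation X1 := (Xco rb).
Local Notation s1 := (sco rb).
Local Notation t1 := (tco rb).

Lemma mst_mem c : (c < 4)%N -> Mst (mst X1 ww c).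
Proof. exact: mt_Xco_mem. Qed.

(** Reduction along the basis of M_0 stays inside M*, and g2 is the only order of M* that is a gap
    of Delta_0, so every other gap coordinate vanishes by itself. *)
Lemma co_g2_Mst y : has2 -> Mst y -> co (BB a0 mm) g2 y = 0 -> M 0%N y.
Proof.
move=> h My y0; rewrite -M0_mm; elim/ltn_ind => k IHk nk.
have Mr : Mst (red (BB a0 mm) k y).
  rewrite [red _ _ _](_ : _ = y - \sum_(i < k) cst (co (BB a0 mm) i y) * BB a0 mm i).
    apply: (subspB Mst_subsp) => //; apply: (subsp_sum _ Mst_subsp) => i _.
    have [Di|ni] := boolP (Dl a0 i).
      apply/(subspZ Mst_subsp)/M0_Mst; rewrite -M0_mm.
      exact: (kerB_B (ordge_BB mm_ord) (BB_lead mm_lead)).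
    by rewrite IHk // cst0 mul0r; apply: (subsp0 Mst_subsp).
  by rewrite {2}(red_expand (BB a0 mm) k y) addrC addKr.
have or : ordge k (red (BB a0 mm) k y).
  exact: (ordge_red (ordge_BB mm_ord) (BB_lead mm_lead)).
have [/eqP|kg] := eqVneq k g2; first by move=> /eqP ->.
apply: (valset_lead Mr or); rewrite Mst_val Dl_ast (negbTE nk) (negbTE kg).
by rewrite andbF.
Qed.

Lemma m0_mem c : (c < 4)%N -> M 0%N (m0 X1 ww s1 c).
Proof.
move=> c4; rewrite /m0; case: ifP => h; last first.
  by rewrite -Mst_no2 ?h //; exact: mst_mem.
have ms2 := mst_mem (c := 2) isT.
case: eqP => [_|/eqP c2].
  apply: Mst_high; first exact: Mst_x.
  move=> _; apply: (@ordgeW K _ (4 + g2)%N); first by rewrite add4n; lia.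
  apply: ordgeM; first exact: ordge_zX.
  by rewrite -(ast2 h); apply: mst_ord.
apply: (co_g2_Mst h).
  by apply: (subspB Mst_subsp); [exact: mst_mem|apply: (subspZ Mst_subsp)].
rewrite coB coZ (_ : co _ g2 (mst X1 ww 2) = 1); last first.
  rewrite co_lead; last by rewrite -(ast2 h); apply: mst_ord.
  by have := mst_lead X1 ww0 2; rewrite ast2.
rewrite mulr1; case: ltnP => [_|le]; first by rewrite subrr.
rewrite subr0 (co_ord _ (@mst_ord X1 ww c)) //.
rewrite ast_neq2 // ltn_neqAle le andbT; apply/eqP => E.
by have := g2_gap h; rewrite E Dl_a0.
Qed.

Lemma M0_m0 : kerB (BB a0 (m0 X1 ww s1)) (Dl a0) = M 0%N.
Proof.
apply: M0_kerB; first exact: m0_mem.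
  by move=> c _; apply: m0_ord.
by move=> c _; apply: (m0_lead _ _ ww0).
Qed.

Lemma wG_mem g : g \in G -> M (level g) (wG X1 ww s1 t1 g).
Proof.
move=> gG; have [gc|gc] := boolP (g %% 4 == 2)%N.
  have [h ->] := G_class gG gc; rewrite /wG g2_mod //=.
  by have := Mst_lev2 (mst_mem (c := 2) isT); rewrite /lev2 h.
have RM := chain_Rmod ch (level g).
pose c := (g %% 4)%N; have c4 : (c < 4)%N by rewrite ltn_mod.
have cE : a0 c = (g + 4)%N by apply: Gnext.
have gE : (a0 c - 4 = g)%N by rewrite cE addnK.
have M0xW : M 0%N (zX 4 * WW g).
  apply: (level_down gG); first by apply: (Rmod_x RM); exact: WW_mem.
  apply: (@ordgeW K _ (4 + g)%N); first by rewrite add4n; lia.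
  by apply: ordgeM; [exact: ordge_zX|exact: WW_ord].
have s0 := Rmod_subsp (chain_Rmod ch 0).
have M0xw : M 0%N (xw X1 ww s1 t1 c).
  apply: (subspD s0); first exact: m0_mem.
  by apply: (subsp_sum _ s0) => c' _; apply: (subspZ s0); apply: m0_mem.
(* The coefficients t were chosen so that z has coordinate 0 at all four generators; hence z is x
   times an element of M_0, and [WW g] and [wG g] differ by that element. *)
pose z := zX 4 * WW g - xw X1 ww s1 t1 c.
have om c' : (c' < 4)%N -> ordge (a0 c') (m0 X1 ww s1 c').
  by move=> _; apply: m0_ord.
have lm c' : (c' < 4)%N -> m0 X1 ww s1 c' (a0 c') = 1.
  by move=> _; apply: (m0_lead _ _ ww0).
have Mz : kerB (BB a0 (m0 X1 ww s1)) (Dl a0) z.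
  by rewrite M0_m0; apply: (subspB s0).
have oxW : ordge (a0 c) (zX 4 * WW g).
  by rewrite cE addnC; apply: ordgeM; [exact: ordge_zX|exact: WW_ord].
have z0 c' : (c' < 4)%N -> co (BB a0 (m0 X1 ww s1)) (a0 c') z = 0.
  move=> c'4; rewrite /z coB /xw coD (co_gen ga0 om lm) // co_sum.
  have -> : \sum_(i < 4 | (a0 c < a0 i)%N)
      co (BB a0 (m0 X1 ww s1)) (a0 c') (cst (t1 c i) * m0 X1 ww s1 i) =
      if (a0 c < a0 c')%N then t1 c c' else 0.
    case: ifP => lt.
      rewrite (bigD1 (Ordinal c'4)) //= coZ (co_gen ga0 om lm) // eqxx mulr1.
      rewrite big1 ?addr0 // => i /andP[_ ic]; rewrite coZ (co_gen ga0 om lm) //.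
      by rewrite -val_eqE /= eq_sym in ic; rewrite (negbTE ic) mulr0.
    rewrite big1 // => i lti; rewrite coZ (co_gen ga0 om lm) //.
    by case: eqP => [E|_]; rewrite ?mulr0 //; move: lt; rewrite E lti.
  case: (ltngtP (a0 c) (a0 c')) => [lt|gt|E].
  - rewrite (_ : (c' == c) = false) ?add0r; last by apply/negP => /eqP E; rewrite E ltnn in lt.
    by rewrite /tco gE subrr.
  - rewrite (co_ord _ oxW gt) (_ : (c' == c) = false) ?addr0 ?subr0 //.
    by apply/negP => /eqP E; rewrite E ltnn in gt.
  - have -> : c' = c by rewrite -(gens_mod ga0 c'4) -E (gens_mod ga0).
    by rewrite co_lead // {1}cE addnC zXMl WW_lead // eqxx addr0 subrr.
have oz : ordge 4 z.
  apply: ordgeB; first by rewrite -[4%N]addn0; apply: ordgeM; [exact: ordge_zX|].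
  by apply: ordgeW (@xw_ord X1 ww s1 t1 c); rewrite cE leq_addl.
have := x_divisible ga0 om lm Dn0 Mz z0 oz.
rewrite M0_m0 => /(sub0 (level g)) Mdz.
have sl := Rmod_subsp RM.
have -> : wG X1 ww s1 t1 g = WW g - pdiv 4 z.
  apply: (@zX_inj K 4); rewrite mulrBr pdivK // wG_x // /z opprB addrC subrK.
  by [].
by apply: (subspB sl) => //; exact: WW_mem.
Qed.

Theorem chain_reconstruct i : kerB (Bi X1 ww s1 t1 i) (Di i) = M i.
Proof.
have RM := chain_Rmod ch i.
apply: (kerB_eq (@Bi_ord X1 ww s1 t1 i) (Bi_lead _ _ _ ww0 i) _ (Rmod_subsp RM)).
- by move=> k /Dn0; exact: Di_a0.
- by move=> k; rewrite (chain_val ch).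
- move=> d Dd; rewrite /Bi; case: ifP => Da.
    by apply: Rmod_BB => // c c4; apply/sub0/m0_mem.
  move: Dd; rewrite /Di Da /= => dt; rewrite dt.
  apply: (@chain_mono _ ch (level d)); last exact/wG_mem/mem_take/dt.
  by rewrite -G_level //; exact: mem_take dt.
- exact: Rmod_tail.
Qed.

End ChainToCoordinates.

(** * From coordinates back to a flag of modules *)

Section CoordinatesToChain.
Variables (X : nat -> nat -> K) (w : ps) (s : nat -> K) (t : nat -> nat -> K).
Hypothesis w1 : w 0%N = 1.
Hypothesis adm : Dl ast v || Dl ast (v + ast 2).
Hypothesis solX : solves u v ast X.

Local Notation mstP := (mst X w).
Local Notation m0P := (m0 X w s).
Local Notation wGP := (wG X w s t).

Let om c (_ : (c < 4)%N) : ordge (a0 c) (m0P c) := @m0_ord X w s c.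
Let lm c (_ : (c < 4)%N) : m0P c (a0 c) = 1 := m0_lead X s w1 c.

Definition Mpar (i : nat) : set ps := kerB (Bi X w s t i) (Di i).

Definition wMt : set ps := [set y | Mt ast X (ps_inv w * y)].

Let wK : ps_inv w * w = 1. Proof. by rewrite mulrC ps_invK. Qed.

Lemma wMt_subsp : subsp wMt. Proof. exact: subsp_mulr (Mt_subsp ast X). Qed.

Lemma wMt_tail : contains_tail n wMt.
Proof. by move=> y oy; apply/(Mt_tail Dn_ast X)/ordge_mulr. Qed.

Lemma wMt_x y : wMt y -> wMt (zX 4 * y).
Proof. by rewrite /wMt /= mulrCA; apply: (Mt_x gast Dn_ast). Qed.

Lemma wMt_f y : wMt y -> wMt (fser u v * y).
Proof.
rewrite /wMt /= mulrCA.
exact: (solves_fstable gast Dn_ast v_odd ltuv two_neq0 adm solX).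
Qed.

Lemma wMt_val k : valset wMt k <-> Dl ast k.
Proof.
have ord m y : ordge m y -> (w * y) m = y m.
  by move=> oy; have := ordge_lead (ordge0 w) oy; rewrite add0n w1 mul1r.
split=> [/(valsetP _ wMt_subsp)[y [My oy y1]]|].
  apply/(Mt_valset ast X k)/(valsetP _ (Mt_subsp ast X)).
  exists (ps_inv w * y); split=> //; first exact: ordge_mulr.
  rewrite -ord; last exact: ordge_mulr.
  by rewrite mulrA [w * _]mulrC wK mul1r.
move=> /(Mt_valset ast X k)/(valsetP _ (Mt_subsp ast X))[y [My oy y1]].
apply/(valsetP _ wMt_subsp); exists (w * y); split.
- by rewrite /wMt /= mulrA wK mul1r.
- exact: ordge_mulr.
- by rewrite ord.
Qed.

Lemma mst_wMt c : (c < 4)%N -> wMt (mstP c).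
Proof.
move=> c4; rewrite /wMt /= /mst mulrA wK mul1r.
exact: (gen_mem gast (gen := mt ast X) (fun c _ => @ordge_mt K ast X c)
  (fun c _ => @mt_lead K ast X c)).
Qed.

Lemma m0_wMt c : (c < 4)%N -> wMt (m0P c).
Proof.
move=> c4; rewrite /m0; case: ifP => h; last exact: mst_wMt.
case: ifP => _; first by apply/wMt_x/mst_wMt.
by apply: (subspB wMt_subsp); [exact: mst_wMt|apply: (subspZ wMt_subsp); exact: mst_wMt].
Qed.

Lemma Mpar0 : Mpar 0 = kerB (BB a0 m0P) (Dl a0).
Proof.
rewrite /Mpar (_ : Di 0 = Dl a0); last by apply: funext => k; rewrite /Di take0 orbF.
congr kerB; apply: funext => d; rewrite /Bi take0 in_nil /=.
by case: ifP => // /negbT /BB_gap.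
Qed.

Lemma Mpar_subsp i : subsp (Mpar i). Proof. exact: kerB_subsp. Qed.

Lemma Mpar_tail i : contains_tail n (Mpar i).
Proof. by apply: kerB_tail => k /Dn0; rewrite /Di => ->. Qed.

Lemma Mpar_val i k : valset (Mpar i) k <-> Di i k.
Proof. exact: (kerB_valset (@Bi_ord X w s t i) (Bi_lead _ _ _ w1 i)). Qed.

Lemma Mpar_B i d : Di i d -> Mpar i (Bi X w s t i d).
Proof. exact: (kerB_B (@Bi_ord X w s t i) (Bi_lead _ _ _ w1 i)). Qed.

Lemma Mpar_mono i j : (i <= j)%N -> Mpar i `<=` Mpar j.
Proof.
move=> ij; apply: (kerB_subset (@Bi_ord X w s t i) (Bi_lead _ _ _ w1 i)
  (Mpar_subsp j) (@Mpar_tail j)) => d Dd.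
have Dj : Di j d.
  move: Dd; rewrite /Di => /orP[->//|di]; have dG := mem_take di.
  by move: di; rewrite !G_level // => le; rewrite (leq_trans le ij) orbT.
have -> : Bi X w s t i d = Bi X w s t j d.
  rewrite /Bi; case: ifP => // nd; move: Dd Dj; rewrite /Di nd /= => -> ->.
  by [].
exact: Mpar_B.
Qed.

Lemma Mpar0_x y : Mpar 0 y -> Mpar 0 (zX 4 * y).
Proof. by rewrite Mpar0; apply: (BB_x ga0 om lm Dn0). Qed.

Lemma m0_Mpar c : (c < 4)%N -> Mpar 0 (m0P c).
Proof. by rewrite Mpar0; apply: (gen_mem ga0 om lm). Qed.

Lemma Mpar0_wMt : Mpar 0 `<=` wMt.
Proof.
rewrite Mpar0; apply: (kerB_subset (ordge_BB om) (BB_lead lm) wMt_subsp wMt_tail).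
by move=> d Dd; apply: (BB_in ga0 Dd wMt_x); exact: m0_wMt.
Qed.

Lemma wMt_high c y : (has2 -> g2 < c)%N -> wMt y -> ordge c y -> Mpar 0 y.
Proof.
move=> gc; apply: (valset_sub (Mpar_subsp 0) wMt_subsp (@Mpar_tail 0) Mpar0_wMt).
move=> k ck; rewrite wMt_val Mpar_val Dl_ast /Di => /orP[->//|/andP[h /eqP kg]].
by have := gc h; rewrite -kg ltnNge ck.
Qed.

Lemma wMt_fM0 y : wMt y -> Mpar 0 (fser u v * y).
Proof.
move=> /wMt_f My; apply: (wMt_high (c := (2 * u)%N) _ My); first exact: g2_lt.
by rewrite -[(2 * u)%N]addn0; apply: ordgeM => //; exact: fser_ord.
Qed.

Lemma Mpar_high i m y : (forall k, (m <= k)%N -> Dl a0 k) -> ordge m y -> Mpar i y.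
Proof.
move=> Dm oy k nk; apply: (co_ord _ oy); rewrite ltnNge.
by apply: contra nk => /Dm; rewrite /Di => ->.
Qed.

Lemma wG_xM0 g : g \in G -> Mpar 0 (zX 4 * wGP g).
Proof.
move=> gG; have s0 := Mpar_subsp 0; have [gc|gc] := boolP (g %% 4 == 2)%N.
  have [h ->] := G_class gG gc; rewrite /wG g2_mod //=.
  by have := m0_Mpar (c := 2) isT; rewrite /m0 h.
rewrite (wG_x X w s t gG gc); apply: (subspD s0).
  by apply: m0_Mpar; rewrite ltn_mod.
by apply: (subsp_sum _ s0) => c _; apply: (subspZ s0); apply: m0_Mpar.
Qed.

Lemma wG_fM0 g : g \in G -> Mpar 0 (fser u v * wGP g).
Proof.
move=> gG; have [gc|gc] := boolP (g %% 4 == 2)%N.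
  have [h ->] := G_class gG gc; rewrite /wG g2_mod //=.
  exact/wMt_fM0/mst_wMt.
apply: (Mpar_high (Godd gG (G_odd gG gc))); rewrite addnC.
by apply: ordgeM; [exact: fser_ord|exact: wG_ord].
Qed.

(** Both x and f send every adjoined element into M_0, so stability of each M_i reduces to x M_0 and
    f M_0 lying in M_0. For f this comes from M*, where the solved equations give stability. *)
Lemma Mpar_Rmod i : Rmodule (Mpar i).
Proof.
have BE d : Di i d -> (Dl a0 d /\ Mpar 0 (Bi X w s t i d)) \/
    (d \in G /\ Bi X w s t i d = wGP d).
  rewrite /Di /Bi; case: ifP => Da /= dt; last by right; rewrite dt (mem_take dt).
  left; split=> //; rewrite Mpar0; exact: (kerB_B (ordge_BB om) (BB_lead lm)).
have Dni k : (n <= k)%N -> Di i k by move=> /Dn0; rewrite /Di => ->.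
split; [exact: Mpar_subsp|exact: Mpar_tail|..].
  apply: (kerB_mul (@Bi_ord X w s t i) (Bi_lead _ _ _ w1 i) Dni) => d /BE[].
    by move=> [_ /Mpar0_x]; exact: Mpar_mono.
  by move=> [dG ->]; apply: (Mpar_mono (leq0n i)); exact: wG_xM0.
apply: (kerB_mul (@Bi_ord X w s t i) (Bi_lead _ _ _ w1 i) Dni) => d /BE[].
  by move=> [_ /Mpar0_wMt/wMt_fM0]; exact: Mpar_mono.
by move=> [dG ->]; apply: (Mpar_mono (leq0n i)); exact: wG_fM0.
Qed.

Theorem Mpar_chain : flag_chain Mpar.
Proof. by split; [exact: Mpar_Rmod|exact: Mpar_val|exact: Mpar_mono]. Qed.

Section RecoverCoordinates.
Variable rb : nat -> nat -> ps.
Hypothesis rbM : reduced_bases Mpar rb.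
Hypothesis w_red : forall k, Dl ast k -> k != 0%N -> w k = 0.

Let ch := Mpar_chain.

Lemma wG_level g : g \in G -> Mpar (level g) (wGP g).
Proof.
move=> gG; have Dg : Di (level g) g by apply: Di_level.
by have := Mpar_B Dg; rewrite /Bi (negbTE (G_gap gG)) G_level ?leqnn.
Qed.

Lemma WW_wG g : g \in G -> Mpar 0 (WW rb g - wGP g).
Proof.
move=> gG; apply: (level_down ch gG).
  apply: (subspB (Mpar_subsp _)); last exact: wG_level.
  exact: (WW_mem rbM).
apply: ordge_step; first by apply: ordgeB; [exact: (WW_ord rbM)|exact: wG_ord].
by rewrite psB (WW_lead rbM gG) (wG_lead _ _ _ w1 gG) subrr.
Qed.

Lemma WW_wMt : has2 -> wMt (WW rb g2).
Proof.
move=> h; rewrite -(subrK (wGP g2) (WW rb g2)); apply: (subspD wMt_subsp).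
  exact/Mpar0_wMt/WW_wG.
by rewrite /wG g2_mod //=; apply: mst_wMt.
Qed.

Lemma mm_wMt c : (c < 4)%N -> wMt (mm rb c).
Proof. by move=> c4; apply/Mpar0_wMt/(mm_mem rbM). Qed.

Lemma ww_recover : ww rb = w.
Proof.
apply/eqP; rewrite -subr_eq0; apply/eqP.
apply: (@gap_supported_eq0 _ wMt).
  apply: (subspB wMt_subsp).
    rewrite /ww; case: ifP => h; last exact: mm_wMt.
    by apply: (subspB wMt_subsp); [exact: mm_wMt|apply: (subspZ wMt_subsp); exact: WW_wMt].
  by have := mst_wMt (c := 0) isT; rewrite /mst (mt0 gast) mulr1.
move=> k; rewrite wMt_val psB => Dk; have [->|k0] := eqVneq k 0%N.
  by rewrite (ww0 rbM) w1 subrr.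
by rewrite (ww_red rbM) // w_red // subrr.
Qed.

Lemma Mst_recover : Mst rb = wMt.
Proof.
apply: (kerB_eq (ordge_BB (gst_ord rbM)) (BB_lead (gst_lead rbM)) Dn_ast wMt_subsp).
- by move=> k; rewrite wMt_val.
- move=> d Dd; apply: (BB_in gast Dd wMt_x); apply: forall_lt4;
    rewrite /gst ?andbF ?andbT /=; try exact: mm_wMt.
    rewrite ww_recover; have := mst_wMt (c := 0) isT.
    by rewrite /mst (mt0 gast) mulr1.
  by case: ifP => h; [exact: WW_wMt|exact: mm_wMt].
- exact: wMt_tail.
Qed.

Lemma Mtil_recover : Mtil rb = Mt ast X.
Proof.
rewrite /Mtil Mst_recover ww_recover; apply/seteqP; split=> y;
  by rewrite /wMt /= mulrA wK mul1r.
Qed.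

Lemma Xco_recover c k : (c < 4)%N -> c != 0%N -> (0 < k)%N -> ~~ Dl ast (ast c + k) ->
  Xco rb c k = X c k.
Proof.
move=> c4 c0 k0 nk.
have coE i d : ~~ Dl ast i -> co (Btl rb) d (zX i) = (d == i)%:R.
  move=> ni; have -> : zX i = Btl rb i by rewrite /Btl (negbTE ni).
  exact: (co_B (Btl_ord rbM) (Btl_lead rbM)).
have := gen_mem gast (gen := mt ast X) (fun c _ => @ordge_mt K ast X c)
  (fun c _ => @mt_lead K ast X c) c4.
rewrite -/(Mt ast X) -Mtil_recover -(Btl_ker rbM) => /(_ _ nk).
have kn : (ast c + k < n)%N by rewrite ltnNge; apply: contra nk; exact: Dn_ast.
rewrite (mt_expand Dn_ast) // coD co_sum (bigD1 (Ordinal kn)) /=; last first.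
  by rewrite nk andbT; lia.
rewrite coZ (coE (ast c + k)%N) // eqxx mulr1 addKn big1 ?addr0.
  by rewrite /Xco => /eqP; rewrite addrC addr_eq0 => /eqP.
move=> i /andP[/andP[_ ni] ij]; rewrite coZ coE //.
by rewrite -val_eqE /= eq_sym in ij; rewrite (negbTE ij) mulr0.
Qed.

Lemma mt_recover c : (c < 4)%N -> mt ast (Xco rb) c = mt ast X c.
Proof.
move=> c4; apply: funext => k; rewrite /mt; case: eqP => // kc.
case: ifP => // /and3P[c0 ck nk]; apply: Xco_recover => //; first by rewrite subn_gt0.
by rewrite subnKC // ltnW.
Qed.

Lemma mst_recover c : (c < 4)%N -> mst (Xco rb) (ww rb) c = mstP c.
Proof. by move=> c4; rewrite /mst mt_recover // ww_recover. Qed.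

Lemma sco_recover c : (c < 4)%N -> has2 -> (a0 c < g2)%N -> sco rb c = s c.
Proof.
move=> c4 h lt; rewrite /sco mst_recover //.
have c2 : c != 2%N by apply/eqP => E; move: lt; rewrite E (g2E h); lia.
have -> : mstP c = m0P c + cst (s c) * mstP 2.
  by rewrite /m0 h (negbTE c2) lt subrK.
have M0E := M0_mm ch rbM.
have -> : co (BB a0 (mm rb)) g2 (m0P c + cst (s c) * mstP 2) = 0 + s c * 1.
  rewrite coD coZ; congr (_ + _ * _).
    have : kerB (BB a0 (mm rb)) (Dl a0) (m0P c) by rewrite M0E; exact: m0_Mpar.
    by apply; exact: g2_gap.
  rewrite co_lead -?(ast2 h); last exact: mst_ord.
  exact: mst_lead.
by rewrite add0r mulr1.
Qed.

Lemma m0_recover c : (c < 4)%N -> m0 (Xco rb) (ww rb) (sco rb) c = m0P c.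
Proof.
move=> c4; rewrite /m0 !mst_recover //; case: ifP => // h; case: eqP => // _.
by case: ifP => // lt; rewrite sco_recover.
Qed.

Lemma BB_m0_recover : BB a0 (m0 (Xco rb) (ww rb) (sco rb)) = BB a0 m0P.
Proof.
apply: funext => d; rewrite /BB; case: ifP => // _.
by rewrite m0_recover // ltn_mod.
Qed.

Lemma tco_recover c c' : (c < 4)%N -> (c' < 4)%N -> c != 2%N -> (4 <= a0 c)%N ->
  (a0 c - 4)%N \in G -> (a0 c < a0 c')%N -> tco rb c c' = t c c'.
Proof.
move=> c4 c'4 c2 ac gG lt; rewrite /tco BB_m0_recover.
set g := (a0 c - 4)%N in gG *.
have gc : (g %% 4 = c)%N by have := gens_mod ga0 c4; rewrite /g; lia.
rewrite -(subrK (wGP g) (WW rb g)) mulrDr coD.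
have := WW_wG gG; rewrite Mpar0 => /(co_x_gen ga0 om lm c'4) ->.
rewrite add0r wG_x ?gc // /xw coD (co_gen ga0 om lm) // co_sum.
rewrite (bigD1 (Ordinal c'4)) //= coZ (co_gen ga0 om lm) // eqxx mulr1.
rewrite big1 ?addr0 => [|i /andP[_ ic]]; last first.
  rewrite coZ (co_gen ga0 om lm) //.
  by rewrite -val_eqE /= eq_sym in ic; rewrite (negbTE ic) mulr0.
by case: eqP => [E|_]; rewrite ?add0r //; move: lt; rewrite E ltnn.
Qed.

End RecoverCoordinates.

End CoordinatesToChain.

End Flags.

(** * The ring R *)

Section FiniteCardinal.

Lemma fcard_count (S : set nat) (N : nat) (P : pred nat) :
  (forall k, S k <-> (k < N)%N && P k) -> Defs.fcard S = count P (iota 0 N).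
Proof.
move=> SP; have fS : finite_set S.
  apply/finite_seqP; exists (filter P (iota 0 N)); apply/seteqP.
  by split=> k /=; rewrite mem_filter mem_iota add0n leq0n /= andbC => /SP.
rewrite /Defs.fcard -size_filter; apply/perm_size/uniq_perm.
- exact: fset_uniq.
- by rewrite filter_uniq // iota_uniq.
move=> k; rewrite in_fset_set // mem_filter mem_iota add0n leq0n /=.
by apply/idP/idP => [/set_mem/SP|h]; [rewrite andbC|apply/mem_set/SP; rewrite andbC].
Qed.

Lemma count_sum (P : pred nat) N : count P (iota 0 N) = (\sum_(i < N) P i)%N.
Proof.
rewrite -sum1_count -(big_mkord xpredT (fun i => P i : nat)) /index_iota subn0.
by rewrite big_mkcond; apply: eq_bigr => i _; case: (P i).
Qed.

Lemma count_involution N (P : pred nat) :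
  (forall k, (k < N)%N -> P k = ~~ P (N.-1 - k)%N) ->
  (count P (iota 0 N) + count P (iota 0 N) = N)%N.
Proof.
move=> inv; rewrite -[in RHS](size_iota 0 N) -(count_predC P (iota 0 N)).
congr (_ + _)%N; rewrite !count_sum [RHS](reindex_inj rev_ord_inj) /=.
apply: eq_bigr => i _; rewrite (inv i) //.
by have -> : (N - i.+1 = N.-1 - i)%N by lia.
Qed.

End FiniteCardinal.

(** * The value semigroup *)

Section Semigroup.
Variables (u v : nat).
Hypothesis u_odd : odd u.
Hypothesis v_odd : odd v.
Hypothesis ltuv : (2 * u < v)%N.

Local Notation n := (4 * u + v - 3)%N.

(** The orders of 1, f, h and f h, where h = (f^2 - x^u)/2 starts with z^(2u+v). The last gap is
    thus 4u + v - 4, which explains the bound n. *)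
Definition aG (c : nat) : nat :=
  if c == 0%N then 0%N else if c == 2%N then (2 * u)%N else
  if c == (v %% 4)%N then (4 * u + v)%N else (2 * u + v)%N.

Lemma v_mod4 : (v %% 4 = 1 \/ v %% 4 = 3)%N.
Proof.
have v2 : (v %% 2 = 1)%N by rewrite modn2 v_odd.
by case: (mod4_cases v) => E; rewrite E; lia.
Qed.

Lemma gens_aG : generators u aG.
Proof.
have u2 : (u %% 2 = 1)%N by rewrite modn2 u_odd.
by split; rewrite /aG //; case: v_mod4 => E; rewrite E /=; try lia;
  apply: forall_lt4; rewrite //=; lia.
Qed.

Lemma Dn_aG k : (n <= k)%N -> Dl aG k.
Proof.
have u2 : (u %% 2 = 1)%N by rewrite modn2 u_odd.
rewrite /Dl /aG; case: v_mod4 => E; rewrite E;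
  by case: (mod4_cases k) => kE; rewrite kE /=; lia.
Qed.

(** Gamma is a symmetric semigroup: k -> n - 1 - k exchanges its elements with its gaps. This
    identifies n with 2 delta, the exponent of the Grassmannian truncation. *)
Lemma gap_symmetry k : (k < n)%N -> Dl aG k = ~~ Dl aG (n.-1 - k)%N.
Proof.
have u2 : (u %% 2 = 1)%N by rewrite modn2 u_odd.
move=> kn; rewrite /Dl /aG; case: v_mod4 => E; rewrite E;
  case: (mod4_cases k) => kE; case: (mod4_cases (n.-1 - k)) => k'E;
  rewrite kE k'E /=; lia.
Qed.

Lemma count_Gamma : (count (Dl aG) (iota 0 n) + count (Dl aG) (iota 0 n) = n)%N.
Proof. exact: count_involution gap_symmetry. Qed.

End Semigroup.

(** * The ring as a free module over the power series in x *)

Section TheRing.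
Context {K : fieldType}.
Local Notation ps := (pseries K).
Variables (u v : nat).
Hypothesis u_odd : odd u.
Hypothesis v_odd : odd v.
Hypothesis ltuv : (2 * u < v)%N.
Hypothesis two_neq0 : 2%:R != 0 :> K.

Local Notation x := (zX 4 : ps).
Local Notation f := (fser u v : ps).
Local Notation A := (ring4uv K u v).
Local Notation n := (4 * u + v - 3)%N.
Local Notation aA := (aG u v).

Let gens_aA := gens_aG u_odd v_odd ltuv.
Let Dn_aA := Dn_aG u_odd v_odd ltuv.
Let v_cases := v_mod4 u_odd v_odd ltuv.

Lemma fser_ord1 : ordge 1 f.
Proof. by apply: ordgeW (fser_ord ltuv); have := u_odd; case: (u). Qed.

Lemma monomial_ord i j : ordge (i + j) (x ^+ i * f ^+ j).
Proof.
apply: ordgeM; last by rewrite -{1}[j]muln1; apply: ordge_exp fser_ord1.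
by apply: (ordgeW _ (@ordge_exp K 4 x i (@ordge_zX K 4))); lia.
Qed.

Lemma subst2_trunc (c : nat -> nat -> K) N k : (k < N)%N ->
  ps_subst2 c x f k =
  (\sum_(i < N) \sum_(j < N) cst (c i j) * (x ^+ i * f ^+ j)) k.
Proof.
move=> kN; rewrite /ps_subst2 ps_sum.
rewrite (big_ord_widen N (fun i => \sum_(j < k.+1) c i j * (x ^+ i * f ^+ j : ps) k)) //.
rewrite [RHS](bigID (fun i : 'I_N => (i < k.+1)%N)) /= [X in _ = _ + X]big1 ?addr0.
  apply: eq_bigr => i ik; rewrite ps_sum.
  rewrite (big_ord_widen N (fun j => c i j * (x ^+ i * f ^+ j : ps) k)) //.
  rewrite [RHS](bigID (fun j : 'I_N => (j < k.+1)%N)) /= [X in _ = _ + X]big1 ?addr0.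
    by apply: eq_bigr => j _; rewrite cstM.
  by move=> j jk; rewrite cstM (@monomial_ord i j) ?mulr0 //; lia.
move=> i ik; rewrite ps_sum big1 // => j _.
by rewrite cstM (@monomial_ord i j) ?mulr0 //; lia.
Qed.

(** Up to a series of order at least N, which the tail of M absorbs after multiplication by y, an
    element of A is a polynomial in x and f. *)
Lemma ring_stable (M : set ps) N : subsp M -> contains_tail N M ->
    (forall y, M y -> M (x * y)) -> (forall y, M y -> M (f * y)) ->
  forall a y, A a -> M y -> M (a * y).
Proof.
move=> sM tM Mx Mf a y [c _ <-] My.
pose p := \sum_(i < N) \sum_(j < N) cst (c i j) * (x ^+ i * f ^+ j) : ps.
rewrite -[ps_subst2 _ _ _](subrK p) mulrDl.
apply: (subspD sM).
  apply: tM; rewrite mulrC; apply: ordge_mulr => k kN.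
  by rewrite psB (subst2_trunc c kN) subrr.
rewrite mulr_suml; apply: (subsp_sum _ sM) => i _.
rewrite mulr_suml; apply: (subsp_sum _ sM) => j _.
rewrite -mulrA; apply: (subspZ sM).
have Mfj : M (f ^+ j * y).
  by elim: (nat_of_ord j) => [|k IHk]; [rewrite mul1r|rewrite exprS -mulrA; apply: Mf].
rewrite -mulrA; elim: (nat_of_ord i) => [|k IHk]; first by rewrite mul1r.
by rewrite exprS -mulrA; apply: Mx.
Qed.

Lemma A_of_trunc (c : nat -> nat -> K) y :
  (forall N, ordge N (y - \sum_(i < N) \sum_(j < N) cst (c i j) * (x ^+ i * f ^+ j))) ->
  A y.
Proof.
move=> yN; exists c => //; apply: funext => k.
rewrite -[zX 4]/(ps_var ^+ 4) in yN *; rewrite (subst2_trunc c (ltnSn k)).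
by apply/eqP; rewrite eq_sym -subr_eq0 -psB yN.
Qed.

Lemma A_trunc (y : ps) : A y -> exists c : nat -> nat -> K, forall N,
  ordge N (y - \sum_(i < N) \sum_(j < N) cst (c i j) * (x ^+ i * f ^+ j)).
Proof.
move=> [c _ <-]; exists c => N k kN.
by rewrite psB (subst2_trunc c kN) subrr.
Qed.

Lemma subsp_A : subsp A.
Proof.
split.
- apply: (@A_of_trunc (fun _ _ => 0)) => N.
  rewrite big1 ?subr0 // => i _; rewrite big1 // => j _.
  by rewrite cst0 mul0r.
- move=> y z /A_trunc[c yc] /A_trunc[d zd].
  apply: (@A_of_trunc (fun i j => c i j + d i j)) => N.
  have := ordgeD (yc N) (zd N); congr ordge.
  rewrite addrACA -opprD; congr (_ - _).
  rewrite -big_split; apply: eq_bigr => i _; rewrite -big_split.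
  by apply: eq_bigr => j _; rewrite cstD mulrDl.
- move=> b y /A_trunc[c yc].
  apply: (@A_of_trunc (fun i j => b * c i j)) => N.
  have := ordge_cst b (yc N); congr ordge.
  rewrite mulrBr mulr_sumr; congr (_ - _); apply: eq_bigr => i _.
  rewrite mulr_sumr; under [RHS]eq_bigr => j _ do rewrite cstMM -mulrA.
  by [].
Qed.

Lemma A_f y : A y -> A (f * y).
Proof.
move=> /A_trunc[c yc].
apply: (@A_of_trunc (fun i j => if j is j'.+1 then c i j' else 0)) => -[|N] //.
have := ordge_mulr f (yc N.+1); rewrite mulrBr => o1.
rewrite -(subrKA (f * \sum_(i < N.+1) \sum_(j < N.+1)
   cst (c i j) * (x ^+ i * f ^+ j))).
apply: ordgeD; first exact: o1.
rewrite mulr_sumr -sumrB; apply: ordge_sum => i _.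
(* After the index shift the truncated sums differ only by the terms with f^(N+1), of order at least
   N + 1. *)
rewrite [X in _ - X]big_ord_recl /= cst0 mul0r add0r mulr_sumr [X in X - _]big_ord_recr /=.
rewrite addrAC -sumrB big1 ?add0r => [|j _].
  apply: (@ordgeM _ 1 N); first exact: fser_ord1.
  by apply/ordge_cst/(ordgeW _ (@monomial_ord i N)); rewrite leq_addl.
by rewrite /= exprS; ring.
Qed.

Definition xseries (p : nat -> K) : ps :=
  fun k => if (k %% 4 == 0)%N then p (k %/ 4)%N else 0.

Lemma xseries_trunc p N :
  ordge (4 * N) (xseries p - \sum_(i < N) cst (p i) * x ^+ i).
Proof.
move=> k kN; rewrite psB ps_sum /xseries.
have xE i : (x ^+ i : ps) k = (k == 4 * i)%N%:R.
  by rewrite -zXE /zX -exprM.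
case: eqP => k0.
  have ki : (k %/ 4 < N)%N by lia.
  rewrite (bigD1 (Ordinal ki)) //= cstM xE (_ : (k == _) = true); last first.
    by apply/eqP; lia.
  rewrite mulr1 big1 ?addr0 ?subrr // => i.
  rewrite -val_eqE /= => ik; rewrite cstM xE.
  case: eqP => [E|_]; rewrite ?mulr0 //; move: ik; rewrite E.
  by rewrite mulKn // eqxx.
rewrite big1 ?subrr // => i _; rewrite cstM xE.
by case: eqP => [E|_]; rewrite ?mulr0 //; move: k0; rewrite E modnMr.
Qed.

Lemma A_xseries p : A (xseries p).
Proof.
apply: (@A_of_trunc (fun i j => if j == 0%N then p i else 0)) => -[|N] //.
apply: (@ordgeW _ _ (4 * N.+1)); first by lia.
have := @xseries_trunc p N.+1; congr ordge; congr (_ - _).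
apply: eq_bigr => i _; rewrite big_ord_recl big1 ?addr0 /=.
  by rewrite expr0 mulr1.
by move=> j _; rewrite cst0 mul0r.
Qed.

Lemma A_exp j y : A y -> A (f ^+ j * y).
Proof.
move=> Ay; elim: j => [|j IHj]; first by rewrite mul1r.
by rewrite exprS -mulrA; apply: A_f.
Qed.

(** Removing x^u from f^2 exposes the first odd order 2u + v of the ring; the factor 1/2 makes the
    leading coefficient 1. *)
Definition hh : ps := cst 2%:R^-1 * (f ^+ 2 - x ^+ u).

Definition genG (c : nat) : ps :=
  if c == 0%N then 1 else if c == 2%N then f else
  if c == (v %% 4)%N then f * hh else hh.


Lemma four_alpha : exists al, (v = u + 2 * al)%N /\ (u < 2 * al)%N.
Proof.
have u2 : (u %% 2 = 1)%N by rewrite modn2 u_odd.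
have v2 : (v %% 2 = 1)%N by rewrite modn2 v_odd.
by exists ((v - u) %/ 2)%N; split; lia.
Qed.

Lemma two_cst : cst 2%:R * cst 2%:R^-1 = 1 :> ps.
Proof. by rewrite -cstMM divff // cst1. Qed.

Lemma two_ps : cst 2%:R = 1 + 1 :> ps. Proof. by rewrite -cst1 -cstD. Qed.

Lemma x_exp j : x ^+ j = zX (4 * j) :> ps. Proof. by rewrite /zX -exprM. Qed.

Lemma hhE : hh = zX (2 * u + v) + cst 2%:R^-1 * zX (2 * v).
Proof.
have -> : hh = cst 2%:R^-1 * (cst 2%:R * zX (2 * u + v) + zX (2 * v)).
  rewrite /hh; congr (_ * _); rewrite x_exp two_ps (zXD (2 * u)) /fser.
  have -> : zX (2 * v) = zX v * zX v :> ps by rewrite mul2n -addnn zXD.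
  have -> : zX (4 * u) = zX (2 * u) * zX (2 * u) :> ps.
    by rewrite -zXD; congr zX; lia.
  by ring.
by rewrite mulrDr mulrA [cst _ * cst _]mulrC two_cst mul1r.
Qed.

Lemma f_sq : f * f = cst 2%:R * hh + x ^+ u.
Proof. by rewrite /hh mulrA two_cst mul1r subrK expr2. Qed.

Lemma hh_ord : ordge (2 * u + v) hh.
Proof.
rewrite hhE; apply: ordgeD; first exact: ordge_zX.
by apply/ordge_cst/(ordgeW _ (@ordge_zX K _)); have := ltuv; lia.
Qed.

Lemma hh_lead : hh (2 * u + v)%N = 1.
Proof.
rewrite hhE psD cstM !zXE eqxx (_ : (_ == _) = false) ?mulr0 ?addr0 //.
by apply/negbTE/eqP; have := ltuv; lia.
Qed.

(* The relation of degree four satisfied by f over C[[x]]. *)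
Lemma hh_sq : exists p p' : nat, hh * hh = cst 4%:R^-1 * x ^+ p + x ^+ p' * f.
Proof.
have [al [vE ual]] := four_alpha; exists (2 * al + u)%N, (u + al)%N.
have ci : cst 2%:R^-1 * cst 2%:R^-1 = cst 4%:R^-1 :> ps.
  by rewrite -cstMM -invfM -natrM.
have e1 : zX (2 * u + v) * zX (2 * u + v) = zX (4 * (u + al)) * zX (2 * u) :> ps.
  by rewrite -!zXD; congr zX; lia.
have e2 : zX (2 * u + v) * zX (2 * v) = zX (4 * (u + al)) * zX v :> ps.
  by rewrite -!zXD; congr zX; lia.
have e3 : zX (2 * v) * zX (2 * v) = zX (4 * (2 * al + u)) :> ps.
  by rewrite -!zXD; congr zX; lia.
rewrite !x_exp hhE /fser -e3 -ci [X in _ = _ + X]mulrDr -e1 -e2.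
set a := zX (2 * u + v); set b := zX (2 * v); set k := cst _.
have -> : (a + k * b) * (a + k * b) = k * k * (b * b) + (a * a + (1 + 1) * k * (a * b)).
  by ring.
by rewrite -two_ps two_cst mul1r.
Qed.

Lemma genG_ord c : (c < 4)%N -> ordge (aA c) (genG c).
Proof.
move=> _; rewrite /aG /genG; case: ifP => // _; case: ifP => _.
  exact: fser_ord.
case: ifP => _; last exact: hh_ord.
rewrite (_ : 4 * u + v = 2 * u + (2 * u + v))%N; last by lia.
by apply: ordgeM; [exact: fser_ord|exact: hh_ord].
Qed.

Lemma genG_lead c : (c < 4)%N -> genG c (aA c) = 1.
Proof.
move=> _; rewrite /aG /genG; case: ifP => // _; case: ifP => _.
  exact: fser_lead.
case: ifP => _; last exact: hh_lead.
rewrite (_ : 4 * u + v = 2 * u + (2 * u + v))%N; last by lia.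
by rewrite (ordge_lead (fser_ord ltuv) hh_ord) fser_lead // hh_lead mul1r.
Qed.

(** The module over the power series in x with basis 1, f, [hh], f [hh]. Once it is identified with
    A, the semigroup and the conductor are read off from the generator orders. *)
Definition MG : set ps := kerB (BB aA genG) (Dl aA).

Let oG := ordge_BB genG_ord.
Let lG := BB_lead genG_lead.

Lemma subsp_MG : subsp MG. Proof. exact: kerB_subsp. Qed.
Lemma MG_tail : contains_tail n MG. Proof. exact: kerB_tail Dn_aA. Qed.
Lemma MG_x y : MG y -> MG (x * y). Proof. exact: (BB_x gens_aA genG_ord genG_lead Dn_aA). Qed.

Lemma MG_gen c : (c < 4)%N -> MG (genG c).
Proof. exact: (gen_mem gens_aA genG_ord genG_lead). Qed.

Definition p_odd : nat := ((v + 2) %% 4)%N.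

Lemma genG_p : genG p_odd = hh.
Proof. by rewrite /genG /p_odd; case: v_cases => E; rewrite E -modnDml E. Qed.

Lemma genG_q : genG (v %% 4) = f * hh.
Proof. by rewrite /genG; case: v_cases => E; rewrite E. Qed.

Lemma MG_xexp j y : MG y -> MG (x ^+ j * y).
Proof.
move=> My; elim: j => [|j IHj]; first by rewrite mul1r.
by rewrite exprS -mulrA; apply: MG_x.
Qed.

Lemma MG_f y : MG y -> MG (f * y).
Proof.
have M1 : MG 1 by exact: (MG_gen (c := 0)).
have Mf : MG f by exact: (MG_gen (c := 2)).
have Mh : MG hh by rewrite -genG_p; apply: MG_gen; rewrite /p_odd ltn_mod.
have Mfh : MG (f * hh) by rewrite -genG_q; apply: MG_gen; rewrite ltn_mod.
have sM := subsp_MG.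
have Mff : MG (f * f).
  rewrite f_sq; apply: (subspD sM); first exact: (subspZ sM).
  by rewrite -[x ^+ u]mulr1; apply: MG_xexp.
have Mffh : MG (f * (f * hh)).
  rewrite mulrA f_sq mulrDl -mulrA; apply: (subspD sM); last exact: MG_xexp.
  apply: (subspZ sM); have [p [p' ->]] := hh_sq; apply: (subspD sM).
    by apply: (subspZ sM); rewrite -[x ^+ p]mulr1; apply: MG_xexp.
  exact: MG_xexp.
apply: (kerB_mul oG lG Dn_aA) => d Dd.
apply: (BB_in gens_aA (M' := [set y | MG (f * y)]) Dd).
  by move=> z /= Mz; rewrite mulrCA; apply: MG_x.
move=> c _; rewrite /genG /=; case: ifP => _; first by rewrite mulr1.
by case: ifP => // _; case: ifP.
Qed.

Lemma A_sub_MG : A `<=` MG.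
Proof.
move=> y Ay; rewrite -[y]mulr1.
apply: (ring_stable subsp_MG MG_tail MG_x MG_f Ay).
exact: (MG_gen (c := 0)).
Qed.

Lemma A1 : A 1.
Proof.
suff -> : 1 = xseries (fun i => (i == 0)%:R) by exact: A_xseries.
apply: funext => -[|k]; rewrite ps1 /xseries //=.
by case: eqP => // k0; rewrite (_ : (_ == 0)%N = false) //; lia.
Qed.

Lemma A_xgen p c : (c < 4)%N -> A (xseries p * genG c).
Proof.
have Ax q : A (xseries q) by exact: A_xseries.
have xx q j : xseries q * x ^+ j =
    xseries (fun i => if (i < j)%N then 0 else q (i - j)%N).
  apply: funext => k; rewrite mulrC x_exp zXM /xseries.
  case: ltnP => kj.
    by case: eqP => // k0; rewrite ifT //; lia.
  have -> : ((k - 4 * j) %% 4 = k %% 4)%N by lia.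
  case: eqP => // k0; rewrite ifF; last by apply/negbTE; lia.
  by congr q; lia.
have Ahh q : A (xseries q * hh).
  rewrite /hh mulrCA; apply: (subspZ subsp_A); rewrite mulrBr xx.
  by apply: (subspB subsp_A) => //; rewrite mulrC; apply: A_exp.
move=> _; rewrite /genG; case: ifP => _; first by rewrite mulr1.
case: ifP => _; first by rewrite mulrC; apply: A_f.
by case: ifP => _ //; rewrite mulrCA; apply: A_f.
Qed.

Lemma co_all0 y : (forall k, co (BB aA genG) k y = 0) -> y = 0.
Proof.
move=> y0; apply: funext => k; have := red_expand (BB aA genG) k y.
rewrite big1 ?add0r => [->|i _]; first exact: y0.
by rewrite y0 cst0 mul0r.
Qed.

(** The coordinates of y in the class c are the coefficients of a power series p_c in x. Comparing
    all coordinates shows that y is the sum of the p_c times the generators, without rearranging an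
    infinite sum. *)
Lemma MG_sub_A : MG `<=` A.
Proof.
move=> y My.
pose p c i := co (BB aA genG) (aA c + 4 * i) y.
suff -> : y = \sum_(c < 4) xseries (p c) * genG c.
  by apply: (subsp_sum _ subsp_A) => c _; apply: A_xgen.
apply/eqP; rewrite -subr_eq0; apply/eqP/co_all0 => k.
rewrite coB co_sum.
have coE (c : 'I_4) : co (BB aA genG) k (xseries (p c) * genG c) =
    if (k %% 4 == c)%N && Dl aA k then co (BB aA genG) k y else 0.
  rewrite -[xseries _](subrK (\sum_(i < k.+1) cst (p c i) * x ^+ i)) mulrDl coD.
  rewrite (@co_ord _ _ (4 * k.+1)) ?add0r; last 2 first.
  - by rewrite mulrC; apply: ordge_mulr; exact: xseries_trunc.
  - by lia.
  rewrite mulr_suml co_sum.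
  under eq_bigr => i _ do
    rewrite -mulrA coZ x_exp -(BB_gen genG gens_aA _ (ltn_ord c)) (co_B oG lG).
  case: ifP => [/andP[/eqP kc Dk]|nk].
    have [j E] := Dl_split gens_aA Dk; rewrite kc in E.
    have jk : (j < k.+1)%N by rewrite E; lia.
    rewrite (bigD1 (Ordinal jk)) //= -E eqxx mulr1 big1 ?addr0.
      by rewrite /p -E.
    move=> i; rewrite -val_eqE /= => ij; case: eqP => [Ei|_]; rewrite ?mulr0 //.
    have ij' : nat_of_ord i = j by lia.
    by rewrite ij' eqxx in ij.
  rewrite big1 // => i _; case: eqP => [E|_]; rewrite ?mulr0 //.
  have kc : (k %% 4 = c)%N by rewrite E -modnDmr modnMr addn0 (gens_mod gens_aA).
  by move: nk; rewrite kc eqxx /= (Dl_gen (ltn_ord c)) // E leq_addr.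
rewrite (eq_bigr _ (fun c _ => coE c)).
have k4 : (k %% 4 < 4)%N by rewrite ltn_mod.
rewrite (bigD1 (Ordinal k4)) //= eqxx big1 ?addr0 /=.
  by case: ifP => [_|/negbT nk]; [rewrite subrr|rewrite My // subrr].
by move=> c; rewrite -val_eqE /= eq_sym => /negbTE ->.
Qed.

Lemma A_MG : A = MG.
Proof. by apply/seteqP; split; [exact: A_sub_MG|exact: MG_sub_A]. Qed.

Lemma valset_A k : valset A k <-> Dl aA k.
Proof. by rewrite A_MG; exact: (kerB_valset oG lG). Qed.

Lemma delta_A : (delta A + delta A = n)%N.
Proof.
have -> : delta A = count (predC (Dl aA)) (iota 0 n).
  apply: fcard_count => k /=; rewrite /gaps /= valset_A; split.
    move=> /negP nk; rewrite nk andbT ltnNge; apply: contra nk.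
    exact: Dn_aA.
  by move=> /andP[_ /negP].
have := count_predC (Dl aA) (iota 0 n); rewrite size_iota.
by have := count_Gamma u_odd v_odd ltuv; lia.
Qed.

Lemma standard_Rmodule M : standard_module A M <-> Rmodule u v n M /\ valset M 0.
Proof.
have Ac c : A (cst c).
  by rewrite -[cst c]mulr1; apply: (subspZ subsp_A); exact: A1.
split=> [[M0 MD MA [y My y0]]|[RM [y My y0]]].
  have sM : subsp M by split=> // c z Mz; apply: MA.
  split; last by exists y.
  split=> //.
  (* A series z of order at least n is (z / y') y' with z / y' again of order at least n, hence in
     A. *)
  - move=> z oz; pose y' := cst (y 0%N)^-1 * y.
    have y1 : y' 0%N = 1 by rewrite /y' cstM mulVf //; case: y0.
    have -> : z = (z * ps_inv y') * y'.
      by rewrite -mulrA [ps_inv _ * _]mulrC ps_invK // mulr1.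
    apply: MA; last by apply: (subspZ sM).
    by rewrite A_MG; apply: MG_tail; rewrite mulrC; apply: ordge_mulr.
  - move=> z; apply: MA; rewrite -[x]mulr1.
    by rewrite A_MG; apply/MG_x/(MG_gen (c := 0)).
  - by move=> z; apply: MA; rewrite A_MG; exact: (MG_gen (c := 2)).
have [sM tM Mx Mf] := RM; split.
- exact: subsp0.
- exact: subspD.
- exact: (ring_stable sM tM).
- by exists y.
Qed.

End TheRing.

(** * Charts of Grassmannians *)

Section ReducedElements.
Context {K : fieldType}.
Local Notation ps := (pseries K).
Variables (B : nat -> ps) (Dl : pred nat) (n : nat).
Hypothesis oB : forall d, ordge d (B d).
Hypothesis B1 : forall d, B d d = 1.
Hypothesis B_gap : forall d, ~~ Dl d -> B d = zX d.
Hypothesis Dn : forall k, (n <= k)%N -> Dl k.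

(** Equal to z^d minus its components along the gap monomials, which are basis elements by [B_gap].
    This closed formula makes the coefficients of reduced elements polynomial in those of the
    basis. *)
Definition red_elt (d : nat) : ps :=
  fun b => if b == d then 1 else if Dl b then 0 else - co B b (zX d).

Lemma co_gap i k : ~~ Dl i -> co B k (zX i) = (k == i)%:R.
Proof. by move=> ni; rewrite -(B_gap ni) (co_B oB B1). Qed.

Lemma red_elt_mem d : Dl d -> kerB B Dl (red_elt d).
Proof.
move=> Dd k nk.
have -> : red_elt d =
    zX d - \sum_(i < n | ~~ Dl i) cst (co B i (zX d)) * zX i.
  apply: funext => j; rewrite psB zXE ps_sum /red_elt.
  case: (boolP (Dl j)) => [Dj|nj].
    rewrite big1 ?subr0 => [|i ni]; first by case: eqP.
    rewrite cstM zXE; case: eqP => [ji|]; rewrite ?mulr0 //.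
    by rewrite -ji Dj in ni.
  have jn : (j < n)%N by rewrite ltnNge; apply: contra nj; exact: Dn.
  rewrite (_ : (j == d) = false); last by apply: contraNF nj => /eqP->.
  rewrite sub0r (bigD1 (Ordinal jn)) //= cstM zXE eqxx mulr1 big1 ?addr0 //.
  move=> i /andP[_]; rewrite -val_eqE /= cstM zXE eq_sym => /negbTE ->.
  by rewrite mulr0.
have kn : (k < n)%N by rewrite ltnNge; apply: contra nk; exact: Dn.
rewrite coB co_sum (bigD1 (Ordinal kn)) //= coZ (@co_gap k k) // eqxx mulr1.
rewrite big1 ?addr0 ?subrr // => i /andP[ni]; rewrite -val_eqE /= eq_sym => ik.
by rewrite coZ (@co_gap i k) // (negbTE ik) mulr0.
Qed.

End ReducedElements.

Section GrassmannPoints.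
Context {K : fieldType}.
Local Notation ps := (pseries K).
Variables (M : set ps) (Dl : pred nat) (n k : nat).
Hypothesis sM : subsp M.
Hypothesis tM : contains_tail n M.
Hypothesis vM : forall d, valset M d <-> Dl d.

Lemma basis_exists : exists B : nat -> ps, [/\ forall d, ordge d (B d),
  forall d, B d d = 1, forall d, ~~ Dl d -> B d = zX d & M = kerB B Dl].
Proof.
have /choice[B BP] d : exists b : ps, [/\ ordge d b, b d = 1,
    Dl d -> M b & ~~ Dl d -> b = zX d].
  case: (boolP (Dl d)) => [/vM/(valsetP _ sM)[b [Mb ob b1]]|nd].
    by exists b.
  by exists (zX d); split; rewrite ?zXE ?eqxx //; exact: ordge_zX.
have oB d : ordge d (B d) by case: (BP d).
have B1 d : B d d = 1 by case: (BP d).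
exists B; split=> // [d|]; first by case: (BP d).
have Dn j : (n <= j)%N -> Dl j.
  move=> nj; apply/vM/(valsetP _ sM); exists (zX j); split.
  - by apply: tM; apply: ordgeW nj (@ordge_zX K j).
  - exact: ordge_zX.
  - by rewrite zXE eqxx.
by apply/esym/(kerB_eq oB B1 Dn sM) => // d; [move/vM|case: (BP d)].
Qed.

Lemma Dl_tail d : (n <= d)%N -> Dl d.
Proof.
move=> nj; apply/vM/(valsetP _ sM); exists (zX d); split.
- by apply: tM; apply: ordgeW nj (@ordge_zX K d).
- exact: ordge_zX.
- by rewrite zXE eqxx.
Qed.

Definition reduced_at d (y : ps) := [/\ M y, y d = 1 & forall j, Dl j -> j != d -> y j = 0].

Lemma reduced_exists d : Dl d -> exists y, reduced_at d y.
Proof.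
move=> Dd; have [B [oB B1 Bg ME]] := basis_exists.
exists (red_elt B Dl d); split.
- by rewrite ME; apply: (red_elt_mem oB B1 Bg Dl_tail).
- by rewrite /red_elt eqxx.
- by move=> j Dj /negbTE jd; rewrite /red_elt jd Dj.
Qed.

Lemma reduced_unique d y z : reduced_at d y -> reduced_at d z -> y = z.
Proof.
move=> [My y1 y0] [Mz z1 z0]; apply/eqP; rewrite -subr_eq0; apply/eqP.
apply: (@gap_supported_eq0 _ M); first exact: subspB.
move=> j /vM Dj; rewrite psB; have [->|jd] := eqVneq j d.
  by rewrite y1 z1 subrr.
by rewrite y0 // z0 // subrr.
Qed.

Lemma reduced_ord d y : reduced_at d y -> ordge d y.
Proof.
move=> [My _ y0]; elim/ltn_ind => j IHj jd.
have [Dj|nj] := boolP (Dl j); first by apply: y0; rewrite // ltn_eqF.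
apply: (valset_lead My) => [i ij|/vM]; last by apply/negP.
by apply: IHj => //; apply: ltn_trans jd.
Qed.

Definition represents (V : @grass K n k) : Prop :=
  forall x, x \in val V <-> exists2 f, M f & x = ps_trunc n f.

Variable s : 'I_k -> 'I_n.
Hypothesis s_inj : injective s.
Hypothesis s_Dl : forall r, Dl (s r).
Hypothesis s_onto : forall j : 'I_n, Dl j -> exists r, s r = j.

Definition of_row (x : 'rV[K]_n) : ps :=
  fun j => if insub j is Some i then x 0 i else 0.

Lemma of_rowE x (i : 'I_n) : of_row x i = x 0 i.
Proof. by rewrite /of_row valK. Qed.

Lemma of_row_trunc f : M f -> M (of_row (ps_trunc n f)).
Proof.
move=> Mf; apply: (subspBl sM Mf); apply: tM => j jn.
by rewrite psB (of_rowE _ (Ordinal jn)) mxE subrr.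
Qed.

Lemma represents_exists : exists V, represents V.
Proof.
have /choice[y yP] r : exists y, reduced_at (s r) y by exact: reduced_exists.
have [Y YE] : exists Y : k.-tuple 'rV[K]_n, forall r, tnth Y r = ps_trunc n (y r).
  by exists [tuple ps_trunc n (y r) | r < k] => r; rewrite tnth_mktuple.
have Yfree : free Y.
  apply/freeP => c c0 r; have := congr1 (fun x : 'rV_n => x 0 (s r)) c0.
  rewrite summxE mxE (bigD1 r) //= big1 => [|r' rr'].
    rewrite mxE -tnth_nth YE mxE; have [_ -> _] := yP r.
    by rewrite mulr1 addr0.
  rewrite mxE -tnth_nth YE mxE; have [_ _ y0] := yP r'.
  by rewrite y0 ?mulr0 // eq_sym val_eqE (inj_eq s_inj).
have dimV : \dim <<Y>> == k by move: Yfree; rewrite /free size_tuple.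
exists (exist _ <<Y>>%VS dimV) => x /=; split.
  move=> /coord_span ->; exists (\sum_(r < k) cst (coord Y r x) * y r).
    by apply: (subsp_sum _ sM) => r _; apply: (subspZ sM); case: (yP r).
  apply/rowP => b; rewrite summxE mxE ps_sum; apply: eq_bigr => r _.
  by rewrite cstM mxE -tnth_nth YE mxE.
move=> [f Mf ->].
pose z := f - \sum_(r < k) cst (f (s r)) * y r.
have z0 : ordge n z.
  have Mz : M z.
    by apply: (subspB sM) => //; apply: (subsp_sum _ sM) => r _; apply: (subspZ sM);
      case: (yP r).
  have zD j : (j < n)%N -> Dl j -> z j = 0.
    move=> jn Dj; have [r rE] := s_onto (j := Ordinal jn) Dj.
    have jE : nat_of_ord (s r) = j by rewrite rE.
    rewrite /z psB ps_sum -{1 2}jE (bigD1 r) //= cstM; have [_ -> _] := yP r.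
    rewrite mulr1 big1 ?addr0 ?subrr // => r' rr'; rewrite cstM.
    have [_ _ y0] := yP r'; rewrite y0 ?mulr0 //.
    by rewrite eq_sym val_eqE (inj_eq s_inj).
  elim/ltn_ind => j IHj jn; have [Dj|nj] := boolP (Dl j); first exact: zD.
  apply: (valset_lead Mz) => [i ij|/vM]; last by apply/negP.
  by apply: IHj => //; apply: ltn_trans jn.
have -> : ps_trunc n f = \sum_(r < k) f (s r) *: tnth Y r.
  apply/rowP => b; rewrite summxE mxE.
  have := z0 b (ltn_ord b); rewrite /z psB ps_sum => /eqP; rewrite subr_eq0 => /eqP ->.
  by apply: eq_bigr => r _; rewrite cstM mxE YE mxE.
by apply: memv_suml => r _; apply/memvZ/memv_span/mem_tnth.
Qed.

Lemma grass_mx_row (V : @grass K n k) x :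
  x \in val V -> exists c : 'rV[K]_k, x = c *m grass_mx V.
Proof.
have dV : k = \dim (val V) by apply/esym/eqP/(valP V).
move=> xV; exists (\row_r coord (vbasis (val V)) (cast_ord dV r) x).
rewrite {1}(coord_vbasis xV); apply/rowP => b.
rewrite summxE mxE (reindex (cast_ord dV)) /=.
  by apply: eq_bigr => r _; rewrite !mxE.
by exists (cast_ord (esym dV)) => r _; rewrite ?cast_ordK ?cast_ordKV.
Qed.

(** On the columns indexed by the orders below n the reduced elements form the identity matrix, so
    they are the rows of the normalised matrix of V. *)
Lemma represents_chart (V : @grass K n k) : represents V ->
  colsub s (grass_mx V) \in unitmx /\
  forall r (y : ps), reduced_at (s r) y -> forall b : 'I_n,
    (invmx (colsub s (grass_mx V)) *m grass_mx V) r b = y b.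
Proof.
move=> VM.
have /choice[y yP] r : exists y, reduced_at (s r) y by exact: reduced_exists.
have /choice[c cP] r : exists c : 'rV[K]_k, ps_trunc n (y r) = c *m grass_mx V.
  by apply: grass_mx_row; apply/VM; exists (y r) => //; case: (yP r).
pose T : 'M_k := \matrix_r c r.
have TE : T *m grass_mx V = \matrix_(r, b) y r b.
  apply/row_matrixP => r; rewrite row_mul rowK -cP.
  by apply/rowP => b; rewrite !mxE.
have T1 : T *m colsub s (grass_mx V) = 1%:M.
  rewrite mulmx_colsub TE; apply/matrixP => r r'; rewrite !mxE.
  have [_ y1 y0] := yP r; have [<-|rr'] := eqVneq r r'; first exact: y1.
  by rewrite y0 // val_eqE (inj_eq s_inj) eq_sym.
have [_ uG] := mulmx1_unit T1; split=> // r z zr b.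
have -> : invmx (colsub s (grass_mx V)) = T.
  by rewrite -[T]mulmx1 -(mulmxV uG) mulmxA T1 mul1mx.
by rewrite TE mxE (reduced_unique zr (yP r)).
Qed.

End GrassmannPoints.

Lemma represents_unique (K : fieldType) (M : set (pseries K)) n k
    (V W : @grass K n k) : represents M V -> represents M W -> V = W.
Proof.
move=> VM WM; apply/val_inj/vspaceP => x.
by apply/idP/idP => [/VM/WM|/WM/VM].
Qed.

(** * Generators of flags of D-sets *)

Section FlagData.
Context {K : fieldType}.
Local Notation ps := (pseries K).
Variables (u v : nat).
Hypothesis u_odd : odd u.
Hypothesis v_odd : odd v.
Hypothesis ltuv : (2 * u < v)%N.
Hypothesis two_neq0 : 2%:R != 0 :> K.

Local Notation A := (ring4uv K u v).
Local Notation n := (4 * u + v - 3)%N.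

Let valA k : valset A k <-> Dl (aG u v) k.
Proof. exact: valset_A. Qed.

Lemma Gamma_a c j : (c < 4)%N -> valset A (aG u v c + 4 * j)%N.
Proof.
move=> c4; apply/valA/Dl_add4/(Dl_gen c4) => //.
exact: (gens_mod (gens_aG u_odd v_odd ltuv)).
Qed.

Lemma Gamma_mod0 j : valset A (4 * j)%N.
Proof. exact: (@Gamma_a 0). Qed.

Lemma Gamma_2u : valset A (2 * u)%N.
Proof. by have := @Gamma_a 2 0 isT; rewrite muln0 addn0. Qed.

Lemma Gamma_tail k : (n <= k)%N -> valset A k.
Proof. by move=> nk; apply/valA/(Dn_aG u_odd v_odd ltuv). Qed.

Lemma Dset_gmodule D : is_Dset A D ->
  standard_gmodule A (valset A `|` D) /\ forall k, D k -> ~ valset A k.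
Proof.
move=> [Delta [De0 DeM] ->]; split; last by move=> k [].
have E : valset A `|` (Delta `\` valset A) = Delta.
  apply/seteqP; split=> [k [Ak|[]//]|k Dk].
    by rewrite -[k]addn0; apply: DeM.
  by have [|] := EM (valset A k); [left|right].
by rewrite E.
Qed.

Lemma gmodule_generators (Delta : set nat) : standard_gmodule A Delta ->
  exists a, generators u a /\ forall k, Delta k <-> Dl a k.
Proof.
move=> [De0 DeM].
have DeA k : valset A k -> Delta k.
  by move=> Ak; rewrite -[k]addn0; apply: DeM.
have ex c : (c < 4)%N -> exists k, `[< Delta k >] && (k %% 4 == c)%N.
  move=> c4; exists (aG u v c); have := @Gamma_a c 0 c4.
  rewrite muln0 addn0 => /DeA /asboolP ->.
  by rewrite (gens_mod (gens_aG u_odd v_odd ltuv)) // eqxx.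
pose a c := if @idP (c < 4)%N is ReflectT c4 then ex_minn (ex c c4) else 0%N.
have aP c : (c < 4)%N -> [/\ Delta (a c), (a c %% 4 = c)%N &
    forall k, Delta k -> (k %% 4 = c)%N -> (a c <= k)%N].
  move=> c4; rewrite /a; case: {-}_ / idP => // c4'.
  case: ex_minnP => k /andP[/asboolP Dk /eqP kc] min; split=> // j Dj jc.
  by apply: min; rewrite jc eqxx andbT; apply/asboolP.
have up k : Delta k -> Delta (k + 4)%N.
  by move=> Dk; rewrite addnC; apply: DeM => //; have := Gamma_mod0 1.
have upj k j : Delta k -> Delta (k + 4 * j)%N.
  move=> Dk; elim: j => [|j IHj]; first by rewrite muln0 addn0.
  by rewrite mulnSr addnA; apply: up.
have add2u k : Delta k -> Delta (k + 2 * u)%N.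
  by move=> Dk; rewrite addnC; apply: DeM => //; exact: Gamma_2u.
have u2 : (u %% 2 = 1)%N by rewrite modn2 u_odd.
have [D0 m0 l0] := aP 0%N isT; have [D1 m1 l1] := aP 1%N isT.
have [D2 m2 l2] := aP 2%N isT; have [D3 m3 l3] := aP 3%N isT.
exists a; split.
  split=> //.
  - by move=> c /aP[].
  - by apply/eqP; rewrite -leqn0; apply: l0.
  - by apply: l2; [apply/DeA/Gamma_2u|lia].
  - by apply: l1; [exact: add2u|lia].
  - by apply: l3; [exact: add2u|lia].
move=> k; have [Dk mk lk] := aP (k %% 4)%N (ltn_pmod k (isT : (0 < 4)%N)).
split; first by move=> Dek; apply: lk.
rewrite /Dl => ak; have -> : k = (a (k %% 4) + 4 * ((k - a (k %% 4)) %/ 4))%N by lia.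
exact: upj.
Qed.

Lemma standard_valset M D : standard_module A M -> (forall k, D k -> ~ valset A k) ->
  Dset_of A M = D <-> forall k, valset M k <-> valset A k \/ D k.
Proof.
move=> stM DA.
have AM k : valset A k -> valset M k.
  move=> [b Ab [bk ob]]; have [_ _ MA [y My [y0 _]]] := stM.
  exists (b * y); first exact: MA.
  have lead := ordge_lead ob (ordge0 y); rewrite addn0 in lead.
  split; first by rewrite lead mulf_neq0.
  by rewrite -[k]addn0; apply: ordgeM.
split=> [<- k|E].
  split=> [Mk|[/AM//|[]//]].
  by have [|] := EM (valset A k); [left|right].
apply/seteqP; split=> k.
  by move=> [/E[]].
by move=> Dk; split; [apply/E; right|exact: DA].
Qed.

Section OneFlag.
Variables (m : nat) (D0 : set nat) (g : m.-tuple nat).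

Record flag_gens (a0 : nat -> nat) : Prop := FlagGens {
  fg_gens : generators u a0;
  fg_Dl : forall k, (valset A `|` D0) k <-> Dl a0 k;
  fg_tail : forall k, (n <= k)%N -> Dl a0 k;
  fg_sorted : sorted ltn g;
  fg_next : forall h, h \in (g : seq nat) -> a0 (h %% 4)%N = (h + 4)%N;
  fg_odd : forall h, h \in (g : seq nat) -> odd h ->
    forall k, (h + 2 * u <= k)%N -> Dl a0 k;
  fg_disj : forall i k, flag_set D0 g i k -> ~ valset A k }.

Lemma flag_gens_exist : is_flag A D0 g -> exists a0, flag_gens a0.
Proof.
move=> [sg gg Dg].
have D00 : flag_set D0 g 0 = D0.
  by rewrite /flag_set take0; apply/seteqP; split=> [k []//|k]; left.
have [gm0 dis0] : standard_gmodule A (valset A `|` D0) /\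
    forall k, D0 k -> ~ valset A k.
  by apply: Dset_gmodule; have := Dg ord0; rewrite /= D00.
have [a0 [ga aE]] := gmodule_generators gm0.
have u2 : (u %% 2 = 1)%N by rewrite modn2 u_odd.
have gap h : h \in (g : seq nat) -> ~~ Dl a0 h.
  by move=> /gg[hA hD]; apply/negP => /aE[].
(* h + b lies in the Gamma-module of the first step that contains h. The elements adjoined up to
   there are at most h, because the g_i increase, so h + b is already in Delta_0. *)
have step h b : h \in (g : seq nat) -> valset A b -> (0 < b)%N -> Dl a0 (h + b)%N.
  move=> hg Ab b0; pose i := index h g.
  have im : (i.+1 < m.+1)%N by rewrite ltnS -[X in (_ < X)%N](size_tuple g) index_mem.
  have [[_ gmM] _] := Dset_gmodule (Dg (Ordinal im)).
  have ht : h \in take i.+1 g by rewrite in_take.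
  have /aE : (valset A `|` D0) (h + b)%N; last by [].
  rewrite addnC; have := gmM b h Ab (or_intror (or_intror ht)) => /= -[Ah|[|ht']].
  - by left.
  - by right.
  - have hbg := mem_take ht'; move: ht'; rewrite /= in_take // ltnS => le.
    have so : sorted leq g by apply: sub_sorted sg => x y /ltnW.
    have : (b + h <= h)%N.
      have := sorted_leq_nth leq_trans leqnn 0%N so; move=> /(_ _ _ _ _ le).
      by rewrite !nth_index // !inE !index_mem; apply.
    by lia.
exists a0; split=> //.
- by move=> k /Gamma_tail Ak; apply/aE; left.
- move=> h hg; have := step h 4%N hg (Gamma_mod0 1) isT.
  have := gap h hg; have := gens_mod ga (c := (h %% 4)%N) (ltn_pmod h (isT : (0 < 4)%N)).
  by rewrite /Dl (_ : (h + 4) %% 4 = h %% 4)%N; lia.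
- move=> h hg oh k hk; have h1 : (h %% 2 = 1)%N by rewrite modn2 oh.
  have Dh2 := step h (2 * u)%N hg Gamma_2u; rewrite muln_gt0 /= in Dh2.
  have {}Dh2 : Dl a0 (h + 2 * u) by apply: Dh2; have := u_odd; case: (u).
  have Dh4 := step h 4%N hg (Gamma_mod0 1) isT.
  have [ok|ek] := boolP (odd k); last by apply: (Dl_even ga ek); lia.
  have k1 : (k %% 2 = 1)%N by rewrite modn2 ok.
  have [E|E] := eqVneq (k %% 4)%N (h %% 4)%N.
    by apply: Dl_mono Dh4 _ _; have := u_odd; case: (u) u2 hk; lia.
  by apply: Dl_mono Dh2 hk _; move/eqP: E; lia.
- by move=> i k [|/mem_take/gg[]]; [exact: dis0|].
Qed.

Variable a0 : nat -> nat.
Hypothesis fg : flag_gens a0.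

Lemma Di_flag_set i k : Di a0 g i k <-> valset A k \/ flag_set D0 g i k.
Proof.
rewrite /Di /flag_set /=; split=> [/orP[/(fg_Dl fg)[]|]|[Ak|[Dk|->]]]; rewrite ?orbT //; auto.
- by rewrite (_ : Dl a0 k) //; apply/(fg_Dl fg); left.
- by rewrite (_ : Dl a0 k) //; apply/(fg_Dl fg); right.
Qed.

(** By the symmetry of Gamma, delta also counts the elements of Gamma below n; adding the elements
    of D_i gives the number of pivot columns. *)
Lemma card_Di i :
  (delta A + Defs.fcard (flag_set D0 g i) = count (Di a0 g i) (iota 0 n))%N.
Proof.
pose P k := Di a0 g i k && ~~ Dl (aG u v) k.
have -> : Defs.fcard (flag_set D0 g i) = count P (iota 0 n).
  apply: fcard_count => k; split.
    move=> Dk; have nA := fg_disj fg Dk.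
    rewrite /P (_ : Di _ _ _ _) /=; last by apply/Di_flag_set; right.
    have nG : ~~ Dl (aG u v) k by apply/negP => /valA.
    rewrite nG andbT ltnNge; apply: contra nG; exact: Dn_aG.
  by move=> /and3P[_ /Di_flag_set[/valA ->|]].
have GD k : Dl (aG u v) k -> Di a0 g i k by move=> /valA Ak; apply/Di_flag_set; left.
have dG : delta A = count (Dl (aG u v)) (iota 0 n).
  have := count_Gamma u_odd v_odd ltuv; have := delta_A u_odd v_odd ltuv two_neq0.
  by lia.
rewrite dG -count_predUI [X in (_ + X)%N](_ : _ = 0%N) ?addn0.
  apply: eq_count => k /=; rewrite /P.
  by case: (boolP (Dl (aG u v) k)) => [/GD ->|_] //=; rewrite andbT.
rewrite (eq_count (a2 := pred0)) ?count_pred0 // => k /=.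
by rewrite /P andbC -andbA andNb andbF.
Qed.

End OneFlag.

End FlagData.

(** * Flag varieties are affine spaces *)

Section PolynomialSeries.
Context {K : fieldType}.
Local Notation ps := (pseries K).
Variables (P : atlas K) (Y : set P) (c : chart P).
Local Notation pf := (polyfun Y c).

Definition polyps (F : P -> ps) := forall k, pf (fun y => F y k).

Lemma polyps_cst f : polyps (fun=> f).
Proof. by move=> k; apply: polyfun_cst. Qed.

Lemma polyps_add F G : polyps F -> polyps G -> polyps (fun y => F y + G y).
Proof. by move=> pF pG k; apply: polyfun_add. Qed.

Lemma polyps_sub F G : polyps F -> polyps G -> polyps (fun y => F y - G y).
Proof. by move=> pF pG k; apply: polyfun_sub. Qed.

Lemma polyps_mul F G : polyps F -> polyps G -> polyps (fun y => F y * G y).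
Proof.
move=> pF pG k.
apply: (@polyfun_ext _ _ _ _ (fun y => \sum_(i < k.+1) F y i * G y (k - i)%N)).
  by move=> y _; rewrite psM.
by apply: polyfun_sum => i _; apply: polyfun_mul.
Qed.

Lemma polyps_scale F G : pf F -> polyps G -> polyps (fun y => cst (F y) * G y).
Proof.
move=> pF pG; apply: polyps_mul => //; case=> [|k] //.
exact: polyfun_cst.
Qed.

Lemma polyps_exp F k : polyps F -> polyps (fun y => F y ^+ k).
Proof.
move=> pF; elim: k => [|k IHk]; first exact: polyps_cst.
move=> j; apply: polyfun_ext (polyps_mul pF IHk j) => y _.
by rewrite exprS.
Qed.

Lemma polyps_sum (I : Type) (r : seq I) (Q : pred I) (F : I -> P -> ps) :
  (forall i, Q i -> polyps (F i)) -> polyps (fun y => \sum_(i <- r | Q i) F i y).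
Proof.
move=> pF k; apply: (@polyfun_ext _ _ _ _ (fun y => \sum_(i <- r | Q i) F i y k)).
  by move=> y _; rewrite ps_sum.
by apply: polyfun_sum => i Qi; apply: pF.
Qed.

Lemma polyps_inv F : polyps F -> polyps (fun y => ps_inv (F y)).
Proof.
move=> pF k; rewrite /ps_inv; apply: (@polyps_sum _ _ _ (fun (i : 'I_k.+1) y => (1 - F y) ^+ i)).
by move=> i _; apply: polyps_exp; apply: polyps_sub => //; apply: polyps_cst.
Qed.

Lemma polyps_pdiv d F : polyps F -> polyps (fun y => pdiv d (F y)).
Proof. by move=> pF k; apply: pF. Qed.

Lemma polyps_red (B : P -> nat -> ps) F d :
  (forall k, polyps (fun y => B y k)) -> polyps F -> polyps (fun y => red (B y) d (F y)).
Proof.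
move=> pB pF; elim: d => [|d IHd] //=.
by apply: polyps_sub => //; apply: polyps_scale.
Qed.

Lemma polyfun_co (B : P -> nat -> ps) F d :
  (forall k, polyps (fun y => B y k)) -> polyps F -> pf (fun y => co (B y) d (F y)).
Proof. by move=> pB pF; apply: polyps_red. Qed.

Lemma polyps_if (b : bool) F G : polyps F -> polyps G ->
  polyps (fun y => if b then F y else G y).
Proof. by case: b. Qed.

Lemma polyps_BB a (gen : P -> nat -> ps) d :
  (forall k, polyps (fun y => gen y k)) -> polyps (fun y => BB a (gen y) d).
Proof.
move=> pg; rewrite /BB; apply: polyps_if; last exact: polyps_cst.
by apply: polyps_mul => //; apply: polyps_cst.
Qed.

Lemma polyps_mt a (X : P -> nat -> nat -> K) k :
  (forall i s, pf (fun y => X y i s)) -> polyps (fun y => mt a (X y) k).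
Proof.
move=> pX j; rewrite /mt; apply: polyfun_if; first exact: polyfun_cst.
by apply: polyfun_if => //; apply: polyfun_cst.
Qed.

Lemma polyps_Bt a (X : P -> nat -> nat -> K) d :
  (forall i s, pf (fun y => X y i s)) -> polyps (fun y => Bt a (X y) d).
Proof.
by move=> pX; apply: polyps_BB => k; apply: polyps_mt.
Qed.

Lemma polyfun_rhs u v a (X : P -> nat -> nat -> K) i s :
  (forall i s, pf (fun y => X y i s)) -> pf (fun y => rhs u v a (X y) i s).
Proof.
move=> pX; have pB k := polyps_Bt a k pX; rewrite /rhs; apply: polyfun_if.
  apply: polyfun_if.
    by apply: polyfun_add => //; apply: polyfun_co => //; apply: polyps_cst.
  apply: polyfun_sub => //; apply: polyfun_co => //.
  by apply: polyps_mul; [exact: polyps_cst|exact: polyps_mt].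
apply: polyfun_add => //; apply: polyfun_mul; last exact: polyfun_cst.
apply: polyfun_co => //; apply: polyps_add; first exact: polyps_cst.
apply: polyps_mul; first exact: polyps_cst.
by apply: polyps_sub; [exact: polyps_mt|exact: polyps_cst].
Qed.

Lemma polyfun_tri_sol (S : nat -> nat -> bool) u v a N (t : P -> nat -> nat -> K) i s :
  (forall i s, pf (fun y => t y i s)) ->
  pf (fun y => tri_sol S (rhs u v a) N (t y) i s).
Proof.
move=> pt; rewrite /tri_sol; elim: N i s => // N IHN i s.
rewrite /= {1}/tri_step; apply: polyfun_if; last exact: pt.
exact: (polyfun_rhs u v a i s IHN).
Qed.

Section FlagCoordinates.
Variables (a0 : nat -> nat) (G : seq nat).

Lemma polyps_mst (X : P -> nat -> nat -> K) w k :
  (forall i s, pf (fun y => X y i s)) -> polyps w ->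
  polyps (fun y => mst a0 G (X y) (w y) k).
Proof. by move=> pX pw; apply: polyps_mul => //; apply: polyps_mt. Qed.

Lemma polyps_m0 (X : P -> nat -> nat -> K) w (s : P -> nat -> K) k :
  (forall i s, pf (fun y => X y i s)) -> polyps w -> (forall i, pf (fun y => s y i)) ->
  polyps (fun y => m0 a0 G (X y) (w y) (s y) k).
Proof.
move=> pX pw ps'; have pm i := polyps_mst i pX pw.
rewrite /m0; apply: polyps_if => //; apply: polyps_if.
  by apply: polyps_mul => //; apply: polyps_cst.
apply: polyps_sub => //; apply: polyps_scale => //.
by apply: polyfun_if => //; apply: polyfun_cst.
Qed.

Lemma polyps_Bi (X : P -> nat -> nat -> K) w (s : P -> nat -> K)
    (t : P -> nat -> nat -> K) i d :
  (forall i s, pf (fun y => X y i s)) -> polyps w -> (forall i, pf (fun y => s y i)) ->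
  (forall i j, pf (fun y => t y i j)) ->
  polyps (fun y => Bi a0 G (X y) (w y) (s y) (t y) i d).
Proof.
move=> pX pw ps' pt; have pm k := polyps_m0 k pX pw ps'.
rewrite /Bi; apply: polyps_if; first exact: polyps_BB.
apply: polyps_if; last exact: polyps_cst.
rewrite /wG; apply: polyps_if; first exact: polyps_mst.
apply/polyps_pdiv/polyps_add => //; apply: polyps_sum => k _.
exact: polyps_scale.
Qed.

Variable rb : P -> nat -> nat -> ps.
Hypothesis prb : forall i d, polyps (fun y => rb y i d).

Lemma polyps_ww : polyps (fun y => ww a0 G (rb y)).
Proof.
rewrite /ww; apply: polyps_if; last exact: prb.
by apply: polyps_sub; [exact: prb|apply: polyps_scale; [exact: prb|exact: prb]].
Qed.

Lemma polyps_gst k : polyps (fun y => gst a0 G (rb y) k).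
Proof.
rewrite /gst; apply: polyps_if; first exact: polyps_ww.
by apply: polyps_if; exact: prb.
Qed.

Lemma polyfun_Xco i s : pf (fun y => Xco a0 G (rb y) i s).
Proof.
apply/polyfun_opp/polyfun_co; last exact: polyps_cst.
move=> k; rewrite /Btl; apply: polyps_if; last exact: polyps_cst.
by apply: polyps_mul; [exact/polyps_inv/polyps_ww|apply: polyps_BB; exact: polyps_gst].
Qed.

Lemma polyfun_sco k : pf (fun y => sco a0 G (rb y) k).
Proof.
apply: polyfun_co; first by move=> d; apply: polyps_BB => i; exact: prb.
by apply: polyps_mst; [exact: polyfun_Xco|exact: polyps_ww].
Qed.

Lemma polyfun_tco i j : pf (fun y => tco a0 G (rb y) i j).
Proof.
apply: polyfun_co.
  move=> d; apply: polyps_BB => k; apply: polyps_m0.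
  - exact: polyfun_Xco.
  - exact: polyps_ww.
  - exact: polyfun_sco.
by apply: polyps_mul; [exact: polyps_cst|exact: prb].
Qed.

End FlagCoordinates.

End PolynomialSeries.

(** * The two inverse polynomial maps *)

Section FlagVariety.
Context {K : fieldType}.
Local Notation ps := (pseries K).
Variables (u v : nat).
Hypothesis u_odd : odd u.
Hypothesis v_odd : odd v.
Hypothesis ltuv : (2 * u < v)%N.
Hypothesis two_neq0 : 2%:R != 0 :> K.

Local Notation A := (ring4uv K u v).
Local Notation n := (delta A + delta A)%N.

Let nE : n = (4 * u + v - 3)%N.
Proof. exact: delta_A. Qed.

Variables (m : nat) (D0 : set nat) (g : m.-tuple nat) (a0 : nat -> nat).
Hypothesis fg : flag_gens (K := K) u v D0 g a0.

Local Notation a1 := (ast a0 g).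
Local Notation D1 := (Dl (ast a0 g)).
Local Notation dd := (Di a0 g).

Hypothesis adm : D1 v || D1 (v + a1 2).

Let ga0 := fg_gens fg.
Let sG := fg_sorted fg.
Let Gnext := fg_next fg.
Let Godd := fg_odd fg.

Let Dn0 k : (n <= k)%N -> Dl a0 k.
Proof. by rewrite nE; apply: (fg_tail fg). Qed.

Let ga1 : generators u a1 := gast ga0 sG Gnext.

(* The kinds of coordinates: 0 for the coefficients of w, 1 for the unsolved
   X(c, s), 2 for the functional s cutting M_0 out of M*, and 3 for t. *)
Definition relevant (kd c k : nat) : bool :=
  match kd with
  | 0 => (c == 0%N) && ~~ D1 k
  | 1 => [&& 0 < c, 0 < k, ~~ D1 (a1 c + k) & ~~ solved u v a1 c k]%N
  | 2 => [&& c == 0, has2 a0 g, k < 4 & a0 k < g2 a0]%N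
  | 3 => [&& c != 2, 4 <= a0 c, (a0 c - 4)%N \in (g : seq nat), k < 4 & a0 c < a0 k]%N
  | _ => false
  end.

(** The last index is an exponent or a depth below n for the kinds 0 and 1, and a class below 4 for
    the kinds 2 and 3; the bound n + 4 covers both. *)
Definition coord_set : {set 'I_4 * 'I_4 * 'I_(n + 4)} :=
  [set p : 'I_4 * 'I_4 * 'I_(n + 4) | relevant p.1.1 p.1.2 p.2]%SET.

Definition flag_dim : nat := #|coord_set|.

Local Notation N := flag_dim.

Definition triple (j : 'I_N) : nat * nat * nat :=
  let p := enum_val j in (p.1.1 : nat, p.1.2 : nat, p.2 : nat).

Lemma triple_inj : injective triple.
Proof.
move=> i j [] /val_inj h1 /val_inj h2 /val_inj h3; apply: enum_val_inj.
move: h1 h2 h3; case: (enum_val i) => -[x y] z; case: (enum_val j) => -[x' y'] z' /=.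
by move=> -> -> ->.
Qed.

Lemma triple_relevant j : relevant (triple j).1.1 (triple j).1.2 (triple j).2.
Proof. by have := enum_valP j; rewrite inE. Qed.

Lemma triple_lt4 j : ((triple j).1.1 < 4)%N /\ ((triple j).1.2 < 4)%N.
Proof. by split; apply: ltn_ord. Qed.

Lemma gap_lt k : ~~ D1 k -> (k < n)%N.
Proof.
move=> nk; rewrite ltnNge; apply: contra nk.
exact: (Dn_ast ga0 Dn0 sG Gnext).
Qed.

Lemma triple_onto kd c k : (c < 4)%N -> relevant kd c k ->
  exists j, triple j = (kd, c, k).
Proof.
move=> c4 rel; have kd4 : (kd < 4)%N by case: kd rel => [|[|[|[|]]]].
have kn : (k < n + 4)%N.
  case: kd rel {kd4} => [|[|[|[|]]]] //=.
  - by move=> /andP[_ /gap_lt]; lia.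
  - by move=> /and4P[_ _ /gap_lt + _]; lia.
  - by move=> /and4P[_ _ + _]; lia.
  - by move=> /and5P[_ _ _ + _]; lia.
pose p := (Ordinal kd4, Ordinal c4, Ordinal kn).
have pS : p \in coord_set by rewrite inE.
by exists (enum_rank_in pS p); rewrite /triple enum_rankK_in.
Qed.

Definition par (th : 'rV[K]_N) (kd c k : nat) : K :=
  \sum_(j < N | triple j == (kd, c, k)) th 0 j.

Lemma par_triple th j : par th (triple j).1.1 (triple j).1.2 (triple j).2 = th 0 j.
Proof.
rewrite /par -!surjective_pairing (big_pred1 j) // => i.
by rewrite /= (inj_eq triple_inj).
Qed.

Lemma par_row F kd c k : (c < 4)%N ->
  par (\row_j F (triple j).1.1 (triple j).1.2 (triple j).2) kd c k =
  if relevant kd c k then F kd c k else 0.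
Proof.
move=> c4; case: ifP => rel.
  have [j jE] := triple_onto c4 rel.
  by have := par_triple (\row_j F (triple j).1.1 (triple j).1.2 (triple j).2) j;
    rewrite !mxE jE.
rewrite /par big_pred0 // => j; apply/negbTE/eqP => jE.
by have := triple_relevant j; rewrite jE rel.
Qed.

Lemma par_irrelevant th kd c k : ~~ relevant kd c k -> par th kd c k = 0.
Proof.
move=> nr; rewrite /par big_pred0 // => j; apply/negbTE/eqP => jE.
by have := triple_relevant j; rewrite jE (negbTE nr).
Qed.

Definition wth (th : 'rV[K]_N) : ps := fun k => if k == 0%N then 1 else par th 0 0 k.
Definition Xth (th : 'rV[K]_N) : nat -> nat -> K :=
  tri_sol (solved u v a1) (rhs u v a1) n (par th 1).
Definition chain_of (th : 'rV[K]_N) : nat -> set ps :=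
  Mpar a0 g (Xth th) (wth th) (par th 2 0) (par th 3).

Lemma solved_lt c s : solved u v a1 c s -> (s < n)%N.
Proof.
have lt k : ~~ D1 (k + s) -> (s < n)%N by move=> /gap_lt; lia.
by case/orP=> [/andP[_ /orP[/andP[_ /lt]|/and3P[_ /lt]]]|/andP[_ /and3P[_ /lt]]].
Qed.

Let agree_rhs X Y c s := @rhs_agree K u v a1 ga1 v_odd ltuv two_neq0 adm X Y c s.

Lemma Xth_solves th : solves u v a1 (Xth th).
Proof. by move=> c s; apply: tri_sol_solved solved_lt agree_rhs _ _ _. Qed.

Lemma wth1 th : wth th 0%N = 1. Proof. by []. Qed.

Lemma wth_red th k : D1 k -> k != 0%N -> wth th k = 0.
Proof.
by move=> Dk k0; rewrite /wth (negbTE k0) par_irrelevant //= Dk.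
Qed.

Lemma chain_of_chain th : flag_chain u v n a0 g (chain_of th).
Proof.
exact: (Mpar_chain ga0 Dn0 sG Gnext Godd v_odd ltuv two_neq0 _ _ (wth1 th) adm
  (@Xth_solves th)).
Qed.

(* A flag is indexed by 'I_m.+1, a chain by nat: the latter is constant from
   m on. *)
Definition ii (i : nat) : 'I_m.+1 := inord (minn i m).

Lemma iiE i : ii i = minn i m :> nat.
Proof. by rewrite /ii inordK // ltnS geq_minr. Qed.

Lemma ii_ord (i : 'I_m.+1) : ii i = i.
Proof. by apply/val_inj; rewrite /= iiE; have := ltn_ord i; lia. Qed.

Lemma Di_ii i : dd (ii i) = dd i.
Proof.
apply: funext => k; rewrite /Di iiE; case: (leqP i m) => // im.
by rewrite !take_oversize ?size_tuple // ltnW.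
Qed.

Lemma std_Rmodule M : standard_module A M <-> Rmodule u v n M /\ valset M 0.
Proof. by rewrite nE; apply: standard_Rmodule. Qed.

Lemma chain_of_flags M : module_flags A D0 g M ->
  flag_chain u v n a0 g (fun i => M (ii i)).
Proof.
move=> [mono std]; split.
- by move=> i; have [/std_Rmodule[]] := std (ii i).
- move=> i k; have [st Dst] := std (ii i).
  have dis k' : flag_set D0 g (ii i) k' -> ~ valset A k' by apply: (fg_disj fg).
  have := (standard_valset st dis).1 Dst k.
  by rewrite -(Di_flag_set fg) Di_ii.
- by move=> i j ij; apply: mono; rewrite !iiE; lia.
Qed.

Lemma flags_of_chain M : flag_chain u v n a0 g M ->
  module_flags A D0 g (fun i => M i).
Proof.
move=> ch; split=> [i j|i]; first exact: (chain_mono ch).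
have st : standard_module A (M i).
  apply/std_Rmodule; split; first exact: (chain_Rmod ch).
  apply/(chain_val ch); rewrite /Di (_ : Dl a0 0 = true) //.
  exact: (Dl_mod4_0 ga0).
split=> //; apply/(standard_valset st).
  by move=> k; apply: (fg_disj fg).
by move=> k; rewrite (chain_val ch) (Di_flag_set fg).
Qed.

Local Notation kk i := (delta A + Defs.fcard (flag_set D0 g i))%N.

Lemma size_pivots (i : 'I_m.+1) : size [seq j <- enum 'I_n | dd i (val j)] == kk i.
Proof.
rewrite (card_Di u_odd v_odd ltuv two_neq0 fg) -nE size_filter -val_enum_ord count_map.
by apply/eqP/eq_count.
Qed.

Definition pivot (i : 'I_m.+1) : 'I_(kk i) -> 'I_n := tnth (Tuple (size_pivots i)).

Lemma pivot_inj (i : 'I_m.+1) : injective (pivot (i := i)).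
Proof. by apply/tuple_uniqP; rewrite filter_uniq // enum_uniq. Qed.

Lemma pivot_Di (i : 'I_m.+1) r : dd i (pivot (i := i) r).
Proof. by have := mem_tnth r (Tuple (size_pivots i)); rewrite mem_filter => /andP[]. Qed.

Lemma pivot_onto (i : 'I_m.+1) (j : 'I_n) : dd i j -> exists r, pivot (i := i) r = j.
Proof.
move=> Dj; have : j \in Tuple (size_pivots i) by rewrite mem_filter Dj mem_enum.
by move=> /tnthP[r ->]; exists r.
Qed.

Local Notation FS := (flag_space (K := K) A D0 g).

Definition the_chart : chart FS := fun i => pivot (i := i).

(** The rows of the normalised matrix, read as series. An order d from n on is no pivot, and there
    z^d is itself reduced, since it lies in the tail. *)
Definition rbV (V : FS) (i d : nat) : ps :=
  if [pick r | pivot (i := ii i) r == d :> nat] is Some r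
  then fun b => if insub b is Some b' then
                  chart_coord the_chart V (existT _ (ii i) (r, b')) else 0
  else zX d.

Lemma rbV_reduced V M : flag_chain u v n a0 g M ->
    (forall i : 'I_m.+1, represents (M i) (V i)) ->
  chart_dom the_chart V /\ reduced_bases a0 g (fun i => M (ii i)) (rbV V).
Proof.
move=> ch VM.
have sM i := Rmod_subsp (chain_Rmod ch i).
have tM i := Rmod_tail (chain_Rmod ch i).
have vM i k := chain_val ch i k.
have chart (i : 'I_m.+1) := represents_chart (sM i) (tM i) (vM i) (pivot_inj (i := i))
  (pivot_Di (i := i)) (VM i).
split; first by move=> i; have [] := chart i.
have red i d : dd (ii i) d -> reduced_at (M (ii i)) (dd (ii i)) d (rbV V i d).
  move=> Dd; rewrite /rbV; case: pickP => [r /eqP rd|no].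
    have [y yr] := reduced_exists (sM (ii i)) (tM (ii i)) (vM (ii i)) Dd.
    have yr' := yr; rewrite -rd in yr'.
    have coordE := (chart (ii i)).2 r y yr'.
    rewrite (_ : (fun b => _) = of_row (ps_trunc n y)); last first.
      apply: funext => b; rewrite /of_row; case: insubP => // b' _ _.
      by rewrite mxE -coordE.
    have [My y1 y0] := yr; split.
    - exact: (of_row_trunc (sM _) (tM _)).
    - by rewrite -rd of_rowE mxE rd.
    - move=> j Dj jd; rewrite /of_row; case: insubP => // b' _ bj.
      rewrite mxE (_ : nat_of_ord b' = j) //; exact: y0.
  have nd : (n <= d)%N.
    rewrite leqNgt; apply/negP => dn.
    have [r rE] := pivot_onto (i := ii i) (j := Ordinal dn) Dd.
    by have := no r; rewrite rE eqxx.
  split.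
  - by apply: tM; apply: ordgeW nd (@ordge_zX K d).
  - by rewrite zXE eqxx.
  - by move=> j _ /negbTE jd; rewrite zXE jd.
split=> i d.
- by rewrite -Di_ii => /red[].
- by rewrite -Di_ii => /red rd; exact: (reduced_ord (vM (ii i)) rd).
- by rewrite -Di_ii => /red[].
- by move=> k; rewrite -Di_ii => /red[_ _]; apply.
Qed.

Definition phi (V : FS) : 'rV[K]_N := \row_j
  match (triple j).1.1 with
  | 0 => ww a0 g (rbV V) (triple j).2
  | 1 => Xco a0 g (rbV V) (triple j).1.2 (triple j).2
  | 2 => sco a0 g (rbV V) (triple j).2
  | _ => tco a0 g (rbV V) (triple j).1.2 (triple j).2
  end.

Definition phi_coord (V : FS) (kd c k : nat) : K :=
  match kd with
  | 0 => ww a0 g (rbV V) k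
  | 1 => Xco a0 g (rbV V) c k
  | 2 => sco a0 g (rbV V) k
  | _ => tco a0 g (rbV V) c k
  end.

Lemma par_phi V kd c k : (c < 4)%N ->
  par (phi V) kd c k = if relevant kd c k then phi_coord V kd c k else 0.
Proof. by move=> c4; rewrite -par_row. Qed.

Lemma point_exists th : exists V : FS,
  forall i : 'I_m.+1, represents (chain_of th i) (V i).
Proof.
have ch := chain_of_chain th.
have ex (i : 'I_m.+1) : exists W : @grass K n (kk i), represents (chain_of th i) W.
  apply: (represents_exists (Rmod_subsp (chain_Rmod ch i)) (Rmod_tail (chain_Rmod ch i))
    (chain_val ch i) (pivot_inj (i := i)) (pivot_Di (i := i))).
  exact: pivot_onto.
by exists (fun i => projT1 (cid (ex i))) => i; apply: projT2 (cid (ex i)).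
Qed.

Definition psi (th : 'rV[K]_N) : FS := projT1 (cid (point_exists th)).

Lemma psi_represents th (i : 'I_m.+1) : represents (chain_of th i) (psi th i).
Proof. exact: projT2 (cid (point_exists th)) i. Qed.

Lemma psi_J th : J A D0 g (psi th).
Proof.
exists (fun i => chain_of th i); last exact: psi_represents.
exact/flags_of_chain/chain_of_chain.
Qed.

Lemma psi_reduced th :
  chart_dom the_chart (psi th) /\ reduced_bases a0 g (chain_of th) (rbV (psi th)).
Proof.
have ch := chain_of_chain th.
have [dom rbr] := rbV_reduced ch (psi_represents th); split=> //.
have E i k : chain_of th (ii i) k <-> chain_of th i k.
  rewrite (_ : chain_of th (ii i) = chain_of th i) //.
  have [sub0 tail0 _ _] := chain_Rmod ch (ii i); have [sub1 _ _ _] := chain_Rmod ch i.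
  apply: (valset_eq sub0 sub1 tail0).
    by apply: (chain_mono ch); rewrite iiE geq_minl.
  by move=> j; rewrite !(chain_val ch) Di_ii.
case: rbr => h1 h2 h3 h4; split=> // i d Dd; apply/E; exact: h1.
Qed.

Lemma J_reduced V : J A D0 g V -> exists M : 'I_m.+1 -> set ps,
  [/\ flag_chain u v n a0 g (fun i => M (ii i)), forall i, represents (M i) (V i),
      chart_dom the_chart V & reduced_bases a0 g (fun i => M (ii i)) (rbV V)].
Proof.
move=> [M Mfl VM]; have ch := chain_of_flags Mfl; exists M; split=> //.
  by have [] := rbV_reduced ch (V := V); first by move=> i; rewrite ii_ord; apply: VM.
have [|_] := rbV_reduced ch (V := V); first by move=> i; rewrite ii_ord; apply: VM.
suff -> : (fun i => M (ii (ii i))) = (fun i => M (ii i)) by [].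
by apply: funext => i; rewrite ii_ord.
Qed.

Lemma rhs_ext (X Y : nat -> nat -> K) c s :
  (forall c, (c < 4)%N -> mt a1 X c = mt a1 Y c) ->
  X c s = Y c s -> rhs u v a1 X c s = rhs u v a1 Y c s.
Proof.
move=> mXY; have BXY : Bt a1 X = Bt a1 Y.
  by apply: funext => d; rewrite /Bt /BB mXY ?ltn_mod.
by rewrite /rhs /hser /om BXY mXY //; case: eqP => [->|_] ->.
Qed.

(** Only the entries of [Xco] at gaps beyond the leading term enter the generators. With the others
    set to 0, [Xco] solves the same triangular system with the same free entries as [Xth (phi V)],
    and uniqueness applies. *)
Lemma mt_Xth_phi V M : flag_chain u v n a0 g M -> reduced_bases a0 g M (rbV V) ->
  forall c, (c < 4)%N -> mt a1 (Xth (phi V)) c = mt a1 (Xco a0 g (rbV V)) c.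
Proof.
move=> ch rbM.
pose relX c s := [&& 0 < c, c < 4, 0 < s & ~~ D1 (a1 c + s)]%N.
pose Xc c s := if relX c s then Xco a0 g (rbV V) c s else 0.
have mE c : (c < 4)%N -> mt a1 Xc c = mt a1 (Xco a0 g (rbV V)) c.
  move=> c4; apply: funext => k; rewrite /mt; case: ifP => // kc.
  case: ifP => // /and3P[c0 ck nk]; rewrite /Xc /relX lt0n c0 c4 subn_gt0 ck.
  by rewrite subnKC ?nk // ltnW.
have [_ solves_co] := Xco_solves ga0 Dn0 sG Gnext v_odd ltuv two_neq0 ch rbM.
have XcE c s : Xc c s = Xth (phi V) c s.
  apply: (tri_sol_unique solved_lt agree_rhs) => {c s} c s sol; last first.
    case: (ltnP c 4) => c4; last first.
      rewrite /Xc /relX (ltnNge c 4) c4 /= andbF /par big_pred0 // => j.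
      apply/negbTE/eqP => jE; have [_] := triple_lt4 j.
      by rewrite jE /= ltnNge c4.
    rewrite par_phi // /Xc /relX c4 /= sol andbT.
    by case: (0 < c)%N.
  have rel := solved_gap ga1 v_odd ltuv two_neq0 adm sol.
  have XcX : Xc c s = Xco a0 g (rbV V) c s by rewrite /Xc /relX rel.
  by rewrite XcX solves_co //; apply: rhs_ext => // c' c'4; rewrite mE.
by move=> c c4; rewrite -mE //; congr (mt a1 _ c); apply: funext => i;
  apply: funext => s; rewrite XcE.
Qed.

Lemma Bi_ext (X X' : nat -> nat -> K) (w : ps) (s s' : nat -> K)
    (t t' : nat -> nat -> K) i d :
    (forall c, (c < 4)%N -> mt a1 X c = mt a1 X' c) ->
    (forall c, (c < 4)%N -> has2 a0 g -> (a0 c < g2 a0)%N -> s c = s' c) ->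
    (forall c c', (c < 4)%N -> (c' < 4)%N -> relevant 3 c c' -> t c c' = t' c c') ->
  Bi a0 g X w s t i d = Bi a0 g X' w s' t' i d.
Proof.
move=> eX es et.
have em c : (c < 4)%N -> m0 a0 g X w s c = m0 a0 g X' w s' c.
  move=> c4; rewrite /m0 /mst !eX //; case: ifP => // h; case: ifP => // _.
  by case: ifP => // lt; rewrite es.
rewrite /Bi /BB; case: ifP => Da.
  by rewrite Da em // ltn_mod.
case: ifP => // /mem_take dg; rewrite /wG; case: ifP => [_|/negbT dc].
  by rewrite /mst eX.
have d4 : (d %% 4 < 4)%N by rewrite ltn_mod.
rewrite /xw em //; congr (pdiv 4 (_ + _)); apply: eq_bigr => c' lt.
rewrite em //; congr (cst _ * _); apply: et => //=.
by rewrite dc (Gnext dg) leq_addl addnK dg ltn_ord -(Gnext dg).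
Qed.

Lemma psi_phi V : J A D0 g V -> psi (phi V) = V.
Proof.
move=> /J_reduced[M [ch VM _ rbM]].
have ww1 := ww0 ga0 sG Gnext rbM.
have wE : wth (phi V) = ww a0 g (rbV V).
  apply: funext => k; rewrite /wth; case: eqP => [->|/eqP k0]; first by rewrite ww1.
  rewrite par_phi //=; case: (boolP (D1 k)) => //= Dk.
  by rewrite (ww_red ga0 sG Gnext rbM).
have E i : chain_of (phi V) i = M (ii i).
  rewrite -(chain_reconstruct ga0 Dn0 sG Gnext v_odd ltuv two_neq0 ch rbM).
  rewrite /chain_of /Mpar wE; congr kerB; apply: funext => d.
  apply: Bi_ext.
  - exact: mt_Xth_phi ch rbM.
  - by move=> c c4 h lt; rewrite par_phi //= h c4 lt.
  - by move=> c c' c4 c'4 rel; rewrite par_phi // rel.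
apply: functional_extensionality_dep => i.
apply: (@represents_unique _ (M i)); last exact: VM.
by have := psi_represents (phi V) i; rewrite E ii_ord.
Qed.

Lemma phi_psi th : phi (psi th) = th.
Proof.
have [_ rbM] := psi_reduced th; have sol := Xth_solves th.
have red := wth_red th.
apply/rowP => j; rewrite [LHS]mxE -(par_triple th); have rel := triple_relevant j.
have [_ c4] := triple_lt4 j; move: rel c4.
case: (triple j) => [[kd c] k] /=; case: kd => [|[|[|[|//]]]] /=.
- move=> /andP[/eqP-> nk] _.
  rewrite (ww_recover ga0 Dn0 sG Gnext Godd v_odd ltuv two_neq0 (wth1 th) adm sol rbM red).
  by rewrite /wth; case: eqP => // k0; move: nk; rewrite k0 (Dl_mod4_0 ga1).
- move=> /and4P[c0 k0 nk ns] c4; rewrite lt0n in c0.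
  rewrite (Xco_recover ga0 Dn0 sG Gnext Godd v_odd ltuv two_neq0 (wth1 th) adm sol rbM red) //.
  exact: tri_sol_free.
- move=> /and4P[/eqP-> h k4 lt] _.
  exact: (sco_recover ga0 Dn0 sG Gnext Godd v_odd ltuv two_neq0 (wth1 th) adm sol rbM red).
move=> /and5P[c2 c4' cg k4 lt] c4.
exact: (tco_recover ga0 Dn0 sG Gnext Godd v_odd ltuv two_neq0 (wth1 th) adm sol rbM red).
Qed.

Lemma phi_polynomial j :
  polyfun (J A D0 g) the_chart (fun V => chart_coord (tt : chart (affine_space K N)) (phi V) j).
Proof.
have prb i d : polyps (J A D0 g) the_chart (fun V => rbV V i d).
  move=> b; rewrite /rbV; case: pickP => [r _|_]; last exact: polyfun_cst.
  by case: insubP => [b' _ _|_]; [exact: polyfun_coord|exact: polyfun_cst].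
apply: (@polyfun_ext _ _ _ _ (fun V => phi_coord V (triple j).1.1 (triple j).1.2 (triple j).2)).
  by move=> V _; rewrite /= mxE.
case: (triple j) => [[kd c] k] /=; case: kd => [|[|[|kd]]] /=.
- exact: polyps_ww.
- exact: polyfun_Xco.
- exact: polyfun_sco.
- exact: polyfun_tco.
Qed.

Lemma psi_polynomial i :
  polyfun [set: affine_space K N] (tt : chart (affine_space K N))
    (fun th => chart_coord the_chart (psi th) i).
Proof.
pose Y := [set: affine_space K N].
have ppar kd c k : polyfun Y (tt : chart (affine_space K N)) (fun th => par th kd c k).
  by apply: polyfun_sum => j _; apply: (polyfun_coord Y (tt : chart (affine_space K N)) j).
have pB l d : polyps Y (tt : chart (affine_space K N))
    (fun th => Bi a0 g (Xth th) (wth th) (par th 2 0) (par th 3) l d).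
  apply: polyps_Bi => // [c s|k]; first exact: polyfun_tri_sol.
  by rewrite /wth; apply: polyfun_if => //; apply: polyfun_cst.
case: i => i [r b]; pose d : nat := pivot r.
(* The chart coordinates are coefficients of reduced elements, for which [red_elt] gives a formula
   in the basis [Bi], polynomial in the parameters. *)
apply: (@polyfun_ext K (affine_space K N) Y tt (fun th => if (b : nat) == d then 1 else
    if dd i b then 0 else
    - co (Bi a0 g (Xth th) (wth th) (par th 2 0) (par th 3) i) b (zX d))); last first.
  apply: polyfun_if; first exact: polyfun_cst.
  apply: polyfun_if; first exact: polyfun_cst.
  apply/polyfun_opp/polyfun_co; last exact: polyps_cst.
  exact: pB.
move=> th _; have ch := chain_of_chain th.
have [_ chartE] := represents_chart (Rmod_subsp (chain_Rmod ch i))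
  (Rmod_tail (chain_Rmod ch i)) (chain_val ch i) (pivot_inj (i := i))
  (pivot_Di (i := i)) (psi_represents th i).
pose B := Bi a0 g (Xth th) (wth th) (par th 2 0) (par th 3) i.
rewrite /= (chartE r (red_elt B (dd i) d)) //.
have oB d' : ordge d' (B d') by apply: (Bi_ord ga0 sG Gnext).
have B1 d' : B d' d' = 1 by apply: (Bi_lead ga0 sG Gnext _ _ _ (wth1 th)).
split.
- apply: (red_elt_mem oB B1) => //; last exact: pivot_Di.
    move=> d'; rewrite /Di negb_or /B /Bi => /andP[/negbTE -> /negbTE ->].
    by [].
  by move=> k /Dn0; rewrite /Di => ->.
- by rewrite /red_elt eqxx.
- by move=> k Dk /negbTE kd; rewrite /red_elt kd Dk.
Qed.

Theorem J_isomorphic_affine : isomorphic (J A D0 g) [set: affine_space K N].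
Proof.
apply: (@isomorphic_of_polynomial _ FS (affine_space K N) _ _ the_chart tt phi psi).
- by apply: grass_prod_single_chart => V /J_reduced[M []].
- exact: affine_space_single_chart.
- by [].
- by move=> th _; exact: psi_J.
- exact: phi_polynomial.
- exact: psi_polynomial.
- exact: psi_phi.
- by move=> th _; exact: phi_psi.
Qed.

End FlagVariety.

(** * Counting coordinates *)

Section Counting.
Local Open Scope nat_scope.

(** Substitution k = x + s; nothing is lost by stopping both sums at W, because P fails from W
    on. *)
Lemma sum_shift (P : pred nat) (x W : nat) : (forall k, W <= k -> ~~ P k) ->
  \sum_(s < W) ((0 < s) && P (x + s)) = \sum_(k < W) ((x < k) && P k).
Proof.
move=> PW; rewrite -(big_mkord xpredT (fun s => nat_of_bool ((0 < s) && P (x + s)))).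
rewrite -(big_mkord xpredT (fun k => nat_of_bool ((x < k) && P k))).
rewrite [RHS](_ : _ = \sum_(0 <= k < x + W) ((x < k) && P k)); last first.
  rewrite [RHS](big_cat_nat (n := W)) ?leq_addl //=.
  rewrite [X in _ = _ + X]big_nat_cond [X in _ = _ + X]big1 ?addn0 //.
  by move=> k /andP[/andP[/PW/negbTE->]]; rewrite andbF.
rewrite [RHS](big_cat_nat (n := x)) ?leq_addr //=.
rewrite [X in _ = X + _]big_nat_cond [X in _ = X + _]big1 ?add0n; last first.
  by move=> k /andP[/andP[_ kx]] _; rewrite ltnNge (ltnW kx).
rewrite (_ : \sum_(x <= k < x + W) _ = \sum_(0 + x <= k < x + W) ((x < k) && P k)) //.
rewrite big_addn addKn; apply: eq_bigr => s _.
by rewrite -(ltn_add2r x 0 s) add0n addnC.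
Qed.

Lemma sum_single (P : pred nat) (x W : nat) : x < W ->
  \sum_(k < W) ((k == x :> nat) && P k) = P x.
Proof.
move=> xW; rewrite (bigD1 (Ordinal xW)) //= eqxx big1 ?addn0 // => k.
by rewrite -val_eqE /= => /negbTE->.
Qed.

Section OneModule.
Variables (u v W : nat) (a : nat -> nat).
Hypothesis ga : generators u a.
Hypothesis v_odd : odd v.
Hypothesis ltuv : 2 * u < v.
Hypothesis aW : forall c, c < 4 -> a c < W.

Local Notation D := (Dl a).
Local Notation e := (a 2).

Lemma gap_ltW k : W <= k -> D k.
Proof. by move=> Wk; apply: leq_trans Wk; rewrite ltnW // aW // ltn_mod. Qed.

Definition gaps_above x := \sum_(k < W) ((x < k) && ~~ D k).

(* The number of s with S2 or S3, by the substitutions j = 2u + s, j = v + s. *)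
Definition odd_pairs := \sum_(j < W) [&& 2 * u < j, ~~ D (e + j) & D j || (v < j)].

Definition free_count := \sum_(k < W) ~~ D k +
  \sum_(c < 4) \sum_(s < W) [&& 0 < c, 0 < s, ~~ D (a c + s) & ~~ solved u v a c s].

Hypothesis solved_gap : forall c s, solved u v a c s ->
  [&& 0 < c, c < 4, 0 < s & ~~ D (a c + s)].

Lemma sum_S1 : \sum_(s < W) S1 u a s = gaps_above (2 * u).
Proof.
by rewrite [LHS](sum_shift (P := fun k => ~~ D k)) // => k /gap_ltW ->.
Qed.

Lemma sum_S23 : \sum_(s < W) S2 u a s + \sum_(s < W) S3 v a s = odd_pairs.
Proof.
rewrite (eq_bigr (fun s : 'I_W => nat_of_bool ((0 < s) &&
  (~~ D (e + (2 * u + s)) && D (2 * u + s))))); last by move=> s _; rewrite /S2 addnA.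
rewrite [X in _ + X](eq_bigr (fun s : 'I_W => nat_of_bool ((0 < s) &&
  (~~ D (e + (v + s)) && ~~ D (v + s))))); last first.
  by move=> s _; rewrite /S3 addnA (addnC v).
rewrite (sum_shift (P := fun j => ~~ D (e + j) && D j)); last first.
  by move=> k Wk; rewrite gap_ltW //; apply: leq_trans Wk (leq_addl _ _).
rewrite (sum_shift (P := fun j => ~~ D (e + j) && ~~ D j)); last first.
  by move=> k Wk; rewrite gap_ltW //; apply: leq_trans Wk (leq_addl _ _).
rewrite -big_split; apply: eq_bigr => j _ /=.
case: (ltnP v j) => vj; last by rewrite orbF addn0.
rewrite (ltn_trans ltuv vj) orbT andbT /=.
by case: (D j); case: (D _).
Qed.

Lemma sum_solved : \sum_(c < 4) \sum_(s < W) solved u v a c s =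
  \sum_(s < W) S1 u a s + (\sum_(s < W) S2 u a s + \sum_(s < W) S3 v a s).
Proof.
have q1 := q_odd ga v_odd ltuv; have q4 := q_lt4 v a.
rewrite !big_ord_recl big_ord0 /= /bump /= !add1n.
have SE c s : solved u v a c s = (c == 2) && (S1 u a s || S2 u a s) ||
  (c == q v a) && S3 v a s by [].
rewrite addn0 -!big_split; apply: eq_bigr => s _ /=; rewrite !SE.
have -> : S1 u a s || S2 u a s = S1 u a s (+) S2 u a s.
  by rewrite /S1 /S2; case: (D (2 * u + s)); rewrite ?andbF ?addbF ?addFb //= orbF.
have : ~~ (S1 u a s && S2 u a s).
  by rewrite /S1 /S2; case: (D (2 * u + s)); rewrite ?andbF.
move: q1 q4; case: (q v a) => [|[|[|[|]]]] //= _ _;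
by case: (S1 u a s); case: (S2 u a s); case: (S3 v a s).
Qed.

(** Each m_c with c > 0 has [gaps_above (a c)] coefficients and w has one for every gap; one is lost
    per equation, [gaps_above (2 * u)] of type S1 and [odd_pairs] of types S2 and S3. *)
Lemma free_countE : free_count + gaps_above (2 * u) + odd_pairs =
  \sum_(k < W) ~~ D k + (gaps_above (a 1) + gaps_above (a 2) + gaps_above (a 3)).
Proof.
rewrite -sum_S1 -sum_S23 -!addnA -sum_solved; congr addn.
rewrite -big_split /=.
have shift c : \sum_(s < W) ((0 < s) && ~~ D (a c + s)) = gaps_above (a c).
  by rewrite [LHS](sum_shift (P := fun k => ~~ D k)) // => k /gap_ltW ->.
rewrite -!shift [X in _ = _ + (_ + X)](_ : _ = \sum_(s < W) ((0 < s) && ~~ D (a 3 + s)) + 0) ?addn0 //.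
rewrite -[LHS]addn0 !big_ord_recl big_ord0 /= /bump /= !add1n.
rewrite (_ : forall x y z w, x + (y + (z + (w + 0))) + 0 = x + (y + (z + w))); last by lia.
have E c : 0 < c -> c < 4 -> \sum_(s < W) ([&& 0 < s, ~~ D (a c + s) & ~~ solved u v a c s]) +
    \sum_(s < W) solved u v a c s = \sum_(s < W) ((0 < s) && ~~ D (a c + s)).
  move=> c0 c4; rewrite -big_split; apply: eq_bigr => s _ /=.
  case: (boolP (solved u v a c s)) => [/solved_gap/and4P[_ _ -> ->]//|_].
  by rewrite andbT addn0.
rewrite !E // -big_split big1 //= => s _.
by case: (boolP (solved _ _ _ _ _)) => [/solved_gap|].
Qed.

(** When e drops to e - 4, the only new pair for the odd class c has e - 4 + j = a c - 4, that is j
    = a c - e. The formula states 2u < j, and j in Delta or v < j, for this j of class 4 - c. *)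
Definition pair_defect c :=
  (2 * u + e < a c) && ((a (4 - c) + e <= a c) || (v + e < a c)).

End OneModule.

(* Adjoining h = a 2 - 4 to Delta moves the generator of class 2 from a 2 to h. *)
Section EvenStep.
Variables (u v W : nat) (a a' : nat -> nat).
Hypothesis ga : generators u a.
Hypothesis ga' : generators u a'.
Hypothesis v_odd : odd v.
Hypothesis ltuv : 2 * u < v.
Hypothesis aW : forall c, c < 4 -> a c < W.
Hypothesis a'2 : a 2 = a' 2 + 4.
Hypothesis a'c : forall c, c != 2 -> a' c = a c.

Local Notation D := (Dl a).
Local Notation D' := (Dl a').
Local Notation e := (a 2).
Local Notation h := (a' 2).

Lemma Dl_even_step k : ~~ D k = ~~ D' k + (k == h) :> nat.
Proof.
have h2 : h %% 4 = 2 by exact: (gens_mod ga').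
rewrite /Dl; case: (k %% 4 =P 2) => [k2|/eqP k2]; last first.
  rewrite a'c // (_ : (k == h) = false) ?addn0 //.
  by apply/negbTE; apply: contraNneq k2 => ->; rewrite h2.
by rewrite k2 a'2; case: (ltngtP k h); lia.
Qed.

Lemma sum_even_step (P : pred nat) :
  \sum_(k < W) (P k && ~~ D k) = \sum_(k < W) (P k && ~~ D' k) + P h.
Proof.
have hW : h < W by have := aW (isT : 2 < 4); lia.
rewrite -(sum_single P hW) -big_split; apply: eq_bigr => k _ /=.
by have := Dl_even_step k; case: (P k); case: (D k); case: (D' k); case: (_ == h).
Qed.

Lemma gaps_above_even_step x : gaps_above W a x = gaps_above W a' x + (x < h).
Proof. exact: sum_even_step. Qed.

(** Strictly between h = e - 4 and e only e - 3 and e - 1 can be gaps, in the classes 3 and 1. *)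
Lemma gaps_above_e : gaps_above W a h = gaps_above W a e + (e < a 1) + (e < a 3).
Proof.
have := aW (isT : 2 < 4) => eW.
have [a0 a1 a2 a3] := mod4_gens ga.
have [l1 l3] : e.-1 < W /\ e - 3 < W by lia.
rewrite -(sum_single (fun=> e < a 1) l1) -(sum_single (fun=> e < a 3) l3) -!big_split.
apply: eq_bigr => k _ /=; rewrite /Dl.
case: (ltnP e k) => [ek|ke].
  by rewrite (_ : h < k) //; lia.
by case: (mod4_cases k) => kE; rewrite kE; lia.
Qed.

Lemma odd_pairs_even_step :
  odd_pairs u v W a' = odd_pairs u v W a + pair_defect u v a 1 + pair_defect u v a 3.
Proof.
have [a0 a1 a2 a3] := mod4_gens ga.
have [eu uo] := (gens2 ga, gens_u ga).
have pdE c : odd c -> c < 4 -> pair_defect u v a c =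
    \sum_(j < W) ((j == a c - e :> nat) && [&& e < a c, 2 * u < j & D j || (v < j)]) :> nat.
  move=> oc c4; have acW := aW c4.
  have lt : a c - e < W by lia.
  rewrite (sum_single (fun j => [&& e < a c, 2 * u < j & D j || (v < j)]) lt).
  rewrite /pair_defect /Dl; congr nat_of_bool.
  have [E1|E3] : c = 1 \/ c = 3 by case: c oc c4 {acW lt} => [|[|[|[|]]]] //; auto.
    rewrite E1 (_ : 4 - 1 = 3) //; case: (leqP (a 1) e) => ae; first by lia.
    by rewrite (_ : (a 1 - e) %% 4 = 3); lia.
  rewrite E3 (_ : 4 - 3 = 1) //; case: (leqP (a 3) e) => ae; first by lia.
  by rewrite (_ : (a 3 - e) %% 4 = 1); lia.
rewrite !pdE // -!big_split; apply: eq_bigr => j _ /=.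
case: (ltnP (2 * u) j) => uj; last by rewrite !andbF.
have -> : D' j = D j.
  by have := Dl_even_step j; rewrite (_ : (_ == h) = false); [case: (D j); case: (D' j)|lia].
rewrite /=; case: (D j || (v < j)); last by rewrite !andbF.
rewrite !andbT.
have -> : ~~ D' (h + j) = ~~ D (h + j) :> nat.
  by rewrite Dl_even_step (_ : (_ == h) = false) ?addn0 //; lia.
have E : h + j = e + j - 4 by lia.
rewrite E /Dl; set x := e + j; have -> : (x - 4) %% 4 = x %% 4 by lia.
by case: (mod4_cases x) => xE; rewrite xE; lia.
Qed.

Hypothesis sg : forall c s, solved u v a c s ->
  [&& 0 < c, c < 4, 0 < s & ~~ D (a c + s)].
Hypothesis sg' : forall c s, solved u v a' c s ->
  [&& 0 < c, c < 4, 0 < s & ~~ D' (a' c + s)].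

(** The terms 1 + (a 1 < h) + (a 3 < h) count the coordinates of the functional that cuts M_0 out of
    M*, one for each generator below h, the 1 being the class 0. *)
Lemma free_count_even_step :
  free_count u v W a' + 1 + (a 1 < h) + (a 3 < h) + pair_defect u v a 1 + pair_defect u v a 3
  = free_count u v W a + (e < a 1) + (e < a 3).
Proof.
have aW' c : c < 4 -> a' c < W.
  by move=> c4; have := aW c4; case: (c =P 2) => [->|/eqP c2]; [lia|rewrite a'c].
have := free_countE ga v_odd ltuv aW sg; have := free_countE ga' v_odd ltuv aW' sg'.
rewrite odd_pairs_even_step.
have := sum_even_step xpredT.
rewrite /= (a'c (c := 1)) // (a'c (c := 3)) // !(gaps_above_even_step (2 * u)) !(gaps_above_even_step (a 1)).
have := gaps_above_e; rewrite !(gaps_above_even_step h) !(gaps_above_even_step (a 3)).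
by have := gens2 ga; lia.
Qed.

End EvenStep.
End Counting.

(* The dimension mu of the step from Delta to Delta with h adjoined. *)
Definition jump (u v : nat) (a : nat -> nat) (h : nat) : int :=
  if (h %% 4 == 2)%N then (a 2 < a 1)%N%:Z + (a 2 < a 3)%N%:Z
    - (pair_defect u v a 1)%:Z - (pair_defect u v a 3)%:Z
  else (\sum_(k < 4) (h + 4 < a k))%N%:Z.

(** * The dimension of a flag variety as a sum over its steps *)

Section FlagDimension.
Context {K : fieldType}.
Variables (u v : nat).
Hypothesis u_odd : odd u.
Hypothesis v_odd : odd v.
Hypothesis ltuv : (2 * u < v)%N.
Hypothesis two_neq0 : 2%:R != 0 :> K.

Local Notation A := (ring4uv K u v).
Local Notation n := (delta A + delta A)%N.
Local Notation W := (n + 4)%N.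

Lemma gens_ltW a : generators u a -> (forall k, (4 * u + v - 3 <= k)%N -> Dl a k) ->
  forall c, (c < 4)%N -> (a c < W)%N.
Proof.
move=> ga tail c c4; rewrite (delta_A u_odd v_odd ltuv two_neq0).
set N := (_ - 3)%N in tail *.
have Nk : (N <= N + (c + 3 * N) %% 4)%N by exact: leq_addr.
have := tail _ Nk; rewrite /Dl (_ : (_ %% 4)%N = c); last by lia.
by lia.
Qed.

Section OneFlag.
Variables (m : nat) (D0 : set nat) (g : m.-tuple nat) (a0 : nat -> nat).
Hypothesis fg : flag_gens (K := K) u v D0 g a0.
Local Notation a1 := (ast a0 g).

Let ga0 := fg_gens fg.
Let a0W := gens_ltW ga0 (fg_tail fg).

Lemma flag_dim_sum : flag_dim (K := K) u v g a0 =
  (free_count u v W a1 + \sum_(k < 4) (has2 a0 g && (a0 k < g2 a0)%N) +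
   \sum_(c < 4) \sum_(k < 4)
     [&& (c : nat) != 2, 4 <= a0 c, (a0 c - 4) \in (g : seq nat) & a0 c < a0 k])%N.
Proof.
rewrite /flag_dim -sum1_card big_mkcond /=.
rewrite (eq_bigr (fun p : 'I_4 * 'I_4 * 'I_W =>
  nat_of_bool (relevant u v g a0 p.1.1 p.1.2 p.2))); last first.
  by move=> p _; rewrite inE; case: (relevant _ _ _ _ _ _ _).
rewrite -(pair_big xpredT xpredT (fun (p : 'I_4 * 'I_4) (k : 'I_W) =>
  nat_of_bool (relevant u v g a0 p.1 p.2 k))) /=.
rewrite -(pair_big xpredT xpredT (fun (kd c : 'I_4) =>
  \sum_(k < W) relevant u v g a0 kd c k)%N) /=.
have first4 (P : nat -> bool) :
    (\sum_(k < W) ((k < 4) && P k) = \sum_(k < 4) P k)%N.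
  rewrite -(big_mkord xpredT (fun k => nat_of_bool ((k < 4)%N && P k))).
  rewrite (big_cat_nat (n := 4%N)) ?leq_addl //= [X in (_ + X)%N]big_nat_cond.
  rewrite [X in (_ + X)%N]big1 ?addn0; last first.
    by move=> k /andP[/andP[+ _] _]; rewrite leqNgt => /negbTE->.
  rewrite big_mkord; apply: eq_bigr => k _.
  by rewrite ltn_ord.
rewrite big_ord_recl [X in (_ + X)%N]big_ord_recl.
rewrite [X in (_ + (_ + X))%N]big_ord_recl [X in (_ + (_ + (_ + X)))%N]big_ord_recl.
rewrite big_ord0 addn0 !addnA; congr (_ + _ + _)%N; last first.
- apply: eq_bigr => c _; rewrite -(first4 (fun k =>
    [&& (c : nat) != 2, 4 <= a0 c, (a0 c - 4) \in (g : seq nat) & a0 c < a0 k]%N)); apply: eq_bigr => k _ /=.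
  by case: (c != 2 :> nat); case: (4 <= a0 c)%N; case: (_ \in _); rewrite ?andbF.
- rewrite big_ord_recl [X in (_ + X)%N = _]big1 ?addn0.
    rewrite -(first4 (fun k => has2 a0 g && (a0 k < g2 a0)%N)); apply: eq_bigr => k _ /=.
    by case: (has2 a0 g); rewrite ?andbF.
  by move=> c _; rewrite big1.
congr addn.
rewrite big_ord_recl [X in (_ + X)%N = _]big1 ?addn0.
  by apply: eq_bigr.
by move=> c _; rewrite big1.
Qed.

Hypothesis adm0 : Dl a0 v || Dl a0 (v + a0 2).
Hypothesis adm : Dl a1 v || Dl a1 (v + a1 2).

Let sG := fg_sorted fg.
Let Gnext := fg_next fg.
Let ga1 : generators u a1 := gast ga0 sG Gnext.

(** Every adjoined h is a0 c - 4 for its own class c, so a sum over the flag is a sum over the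
    classes. *)
Lemma sum_flag (F : nat -> int) : \sum_(h <- g) F h =
  \sum_(c < 4) if (4 <= a0 c)%N && ((a0 c - 4)%N \in (g : seq nat)) then F (a0 c - 4)%N else 0.
Proof.
rewrite (partition_big (fun h => inord (h %% 4) : 'I_4) xpredT) //=.
have ug : uniq g := sorted_uniq ltn_trans ltnn sG.
apply: eq_bigr => c _.
have cE h : h \in (g : seq nat) -> (inord (h %% 4) == c) -> h = (a0 c - 4)%N /\ (4 <= a0 c)%N.
  move=> hg /eqP <-; rewrite inordK ?ltn_mod // Gnext // addnK.
  by split=> //; rewrite leq_addl.
case: ifP => [/andP[c4 cg]|ncg].
  have cc : inord ((a0 c - 4) %% 4) == c.
    apply/eqP/val_inj; rewrite /= inordK ?ltn_mod //.
    by have := gens_mod ga0 (ltn_ord c); lia.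
  rewrite -big_filter (bigD1_seq (a0 c - 4)%N) /=; first last.
  - exact: filter_uniq.
  - by rewrite mem_filter cc.
  rewrite big_seq_cond big1 ?addr0 // => h /andP[]; rewrite mem_filter.
  by move=> /andP[hc hg]; have [-> _] := cE _ hg hc; rewrite eqxx.
rewrite big_seq_cond big1 // => h /andP[hg hc].
by have [hE c4] := cE _ hg hc; move: ncg; rewrite c4 -hE hg.
Qed.

Lemma flag_dimE : (flag_dim (K := K) u v g a0)%:Z =
  (free_count u v W a0)%:Z + \sum_(h <- g) jump u v a0 h.
Proof.
have [m0 m1 m2 m3] := mod4_gens ga0.
have sg0 := solved_gap ga0 v_odd ltuv two_neq0 adm0.
have sg1 := solved_gap ga1 v_odd ltuv two_neq0 adm.
rewrite flag_dim_sum sum_flag.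
rewrite !(big_ord_recl 3) !(big_ord_recl 2) !(big_ord_recl 1) !(big_ord_recl 0) !big_ord0.
rewrite /= /bump /= !add1n m0 /=.
have jumpc c : (c < 4)%N -> c != 2 -> (4 <= a0 c)%N ->
    jump u v a0 (a0 c - 4) = (\sum_(k < 4) (a0 c < a0 k))%N%:Z.
  move=> c4 c2 ac; rewrite /jump subnK // ifF //; apply/negbTE.
  by have := gens_mod ga0 c4; lia.
have termc c : (c < 4)%N -> c != 2 ->
    (if (3 < a0 c)%N && ((a0 c - 4)%N \in (g : seq nat))
     then jump u v a0 (a0 c - 4) else 0) =
    (\sum_(k < 4) [&& 3 < a0 c, (a0 c - 4) \in (g : seq nat) & a0 c < a0 k])%N%:Z.
  move=> c4 c2; case: ifP => [/andP[ac ->]|/negbT].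
    by rewrite jumpc // ac.
  rewrite negb_and => /orP[/negbTE->|/negbTE->]; rewrite big1 // => k _.
  by rewrite andbF.
rewrite (termc 1%N) // (termc 3%N) // (_ : (\sum_(k < 4) 0 = 0)%N); last by rewrite big1.
set t1 := (\sum_(k < 4) [&& (3 < a0 1)%N, _ & _])%N.
set t3 := (\sum_(k < 4) [&& (3 < a0 3)%N, _ & _])%N.
move: t1 t3 => t1 t3.
case: (boolP (has2 a0 g)) => h2; last first.
  have -> : ast a0 g = a0 by apply: funext => c; rewrite /ast (negbTE h2).
  have -> : (a0 2 - 4)%N \in (g : seq nat) = false by exact: negbTE h2.
  by rewrite andbF; lia.
have a2E := g2E ga0 sG Gnext h2.
have a1c c : c != 2%N -> a1 c = a0 c by move=> c2; rewrite /ast h2 (negbTE c2).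
have a12 : a1 2 = g2 a0 by rewrite /ast h2.
have := free_count_even_step ga0 ga1 v_odd ltuv a0W.
rewrite a12 => /(_ a2E a1c sg0 sg1).
have h2' : (a0 2 - 4)%N \in (g : seq nat) by exact: h2.
rewrite h2' [in (3 < a0 2)%N]a2E leq_addl /= /jump.
have g2m := g2_mod ga0 sG Gnext h2; rewrite -/(g2 a0) g2m eqxx a2E.
lia.
Qed.
End OneFlag.
End FlagDimension.

(** * Jumps as differences of gap counts *)

Section Jumps.
Variables (u v : nat).

Lemma gens_le (a b : nat -> nat) : generators u a ->
  (forall k, Dl a k -> Dl b k) -> forall c, (c < 4)%N -> (b c <= a c)%N.
Proof.
move=> ga ab c c4; have aC := gens_mod ga c4.
by have := ab (a c); rewrite /Dl aC => /(_ (leqnn _)).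
Qed.

(** Elements adjoined before h only lower generators that are below h + 4 already, and these count
    in no term of [jump]. Hence the jump at h may be computed from Delta_0 instead of Delta_i. *)
Lemma jump_eq (a b : nat -> nat) (h : nat) : generators u a ->
    a (h %% 4)%N = (h + 4)%N -> b (h %% 4)%N = (h + 4)%N ->
    (forall c, (c < 4)%N -> a c = b c \/ (b c < h /\ a c < h + 4)%N) ->
  jump u v a h = jump u v b h.
Proof.
move=> ga ah bh ab; have a2 := gens2 ga; rewrite /jump; case: eqP => h2.
  rewrite h2 in ah bh; rewrite /pair_defect ah bh (_ : 4 - 1 = 3)%N // (_ : 4 - 3 = 1)%N //.
  rewrite ah in a2.
  by have [->|[h1 h1']] := ab 1%N isT; have [->|[h3 h3']] := ab 3%N isT; lia.
congr Posz; apply: eq_bigr => k _.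
by have [->//|[b1 b2]] := ab k (ltn_ord k); congr nat_of_bool; lia.
Qed.

Lemma gap_count_diff (Delta : set nat) (P : pred nat) (W l : nat) :
    (forall k, Delta k <-> P k) -> (forall k, (W <= k)%N -> P k) ->
  (gap_count Delta l)%:Z - (gap_count Delta (l + 4)%N)%:Z =
  (\sum_(j < 4) ~~ P (l + j)%N)%N%:Z.
Proof.
move=> DP PW; pose N := (l + 4 + W)%N.
have gapE x : gap_count Delta x = (\sum_(k < N) ((x <= k) && ~~ P k))%N.
  rewrite -(count_sum (fun k => (x <= k)%N && ~~ P k)); apply: fcard_count => k /=; split.
    move=> [xk nD]; have nP : ~~ P k by apply/negP => /DP.
    rewrite xk nP /= andbT ltnNge; apply: contra nP => Nk.
    by apply: PW; apply: leq_trans Nk; rewrite leq_addl.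
  by move=> /and3P[_ xk /negP nP]; split=> // /DP.
suff -> : gap_count Delta l = (gap_count Delta (l + 4) + \sum_(j < 4) ~~ P (l + j))%N by lia.
have single j : (j < 4)%N -> nat_of_bool (~~ P (l + j)) =
    (\sum_(k < N) ((k == l + j :> nat) && ~~ P k))%N.
  move=> j4; have lt : (l + j < N)%N by rewrite /N; lia.
  by rewrite (sum_single (fun k => ~~ P k) lt).
rewrite !gapE (eq_bigr _ (fun (j : 'I_4) _ => single j (ltn_ord j))) exchange_big.
rewrite -big_split; apply: eq_bigr => k _ /=.
rewrite !big_ord_recl big_ord0 /= /bump /=; case: (P k); rewrite ?andbF //= !andbT.
by lia.
Qed.

Lemma sum4 (F : nat -> nat) : (\sum_(j < 4) F j = F 0 + F 1 + F 2 + F 3)%N.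
Proof. by rewrite !big_ord_recl big_ord0 addn0 !addnA. Qed.

Lemma lt_class (x k l : nat) : (x %% 4 = k %% 4)%N -> (k <= l)%N -> (l < k + 4)%N ->
  (k < x)%N = (l < x)%N.
Proof. by move=> xk kl lk; apply/idP/idP; lia. Qed.

Section Gaps.
Variables (a : nat -> nat) (h : nat).
Hypothesis ga : generators u a.
Hypothesis ah : a (h %% 4)%N = (h + 4)%N.

Lemma new_gapE c k : (k %% 4 = c)%N -> (h < k)%N ->
  ~~ (Dl a k || (k == h)) = (k < a c)%N.
Proof. by move=> kc hk; rewrite /Dl kc gtn_eqF // orbF -ltnNge. Qed.

Lemma new_gap0 : ~~ (Dl a (h + 0) || (h + 0 == h)%N) = false.
Proof. by rewrite addn0 eqxx orbT. Qed.

Lemma jump_odd : odd h ->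
  jump u v a h = (\sum_(j < 4) ~~ (Dl a (h + j)%N || ((h + j)%N == h)))%N%:Z.
Proof.
move=> oh; have [m0 m1 m2 m3] := mod4_gens ga.
have h1 : (h %% 2 = 1)%N by rewrite modn2 oh.
rewrite /jump ifF; last by lia.
congr Posz.
rewrite (sum4 (fun k => h + 4 < a k)%N) (sum4 (fun j => ~~ (Dl a (h + j) || (h + j == h)))%N).
rewrite new_gap0 m0 /=.
have [hE|hE] : (h %% 4 = 1)%N \/ (h %% 4 = 3)%N by clear -h1; lia.
  have := ah; rewrite hE => ac; rewrite -ac ltnn ac.
  rewrite (@new_gapE 2 (h + 1)) 1?(@new_gapE 3 (h + 2)) 1?(@new_gapE 0 (h + 3)) ?m0; try by clear -hE; lia.
  by rewrite (@lt_class (a 2) (h + 1) (h + 4)) ?(@lt_class (a 3) (h + 2) (h + 4)) //;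
    clear -hE m2 m3; lia.
have := ah; rewrite hE => ac; rewrite -ac ltnn ac.
rewrite (@new_gapE 0 (h + 1)) 1?(@new_gapE 1 (h + 2)) 1?(@new_gapE 2 (h + 3)) ?m0; try by clear -hE; lia.
by rewrite (@lt_class (a 1) (h + 2) (h + 4)) ?(@lt_class (a 2) (h + 3) (h + 4)) //;
  clear -hE m1 m2; lia.
Qed.

Hypothesis h2 : (h %% 4 = 2)%N.
Hypothesis v_odd : odd v.
Hypothesis ltuv : (2 * u < v)%N.
Hypothesis adm : Dl a v || Dl a (v + h).
Variable n : nat.
Hypothesis n_odd : odd n.
Hypothesis n_ge : (2 * u <= n)%N.
Hypothesis nD : Dl a n \/ n = v.
Hypothesis n_min : forall k, odd k -> Dl a k \/ k = v -> (2 * u <= k)%N -> (n <= k)%N.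

(** With j = a c - a 2, either alternative in [pair_defect] exhibits an odd element of Delta or v
    itself in the range from 2u up to j, and n is the least such number. *)
Lemma pair_defectE c : odd c -> (c < 4)%N ->
  pair_defect u v a c = (a 2 + n <= a c)%N.
Proof.
move=> oc c4; have [m0 m1 m2 m3] := mod4_gens ga.
have u2 : (u %% 2 = 1)%N by rewrite modn2 (gens_u ga).
have n2 : (n %% 2 = 1)%N by rewrite modn2 n_odd.
have v2 : (v %% 2 = 1)%N by rewrite modn2 v_odd.
have := ah; rewrite h2 => a2h; have acE := gens_mod ga c4.
have bE := gens_mod ga (c := (4 - c)%N).
have b4 : (4 - c < 4)%N by have := odd_gt0 oc; lia.
have {}bE := bE b4.
have c2 : (c %% 2 = 1)%N by rewrite modn2 oc.
rewrite /pair_defect; apply/idP/idP.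
  move=> /andP[gt /orP[le|gt']].
    have : (n <= a c - a 2)%N; last by lia.
    apply: n_min; first by rewrite -[odd _]eqb1 -modn2; lia.
      by left; rewrite /Dl (_ : (_ %% 4 = 4 - c)%N); lia.
    by lia.
  by have := n_min v_odd (or_intror erefl) (ltnW ltuv); lia.
move=> le; apply/andP; split; first by lia.
case: nD => [Dn|nv].
  apply/orP; left; move: Dn; rewrite /Dl.
  have [nc|nc] : (n %% 4 = c)%N \/ (n %% 4 = 4 - c)%N by lia.
    by rewrite nc; lia.
  by rewrite nc; lia.
case: (ltnP (v + a 2) (a c)) => [|le']; first by rewrite orbT.
(* In this boundary case v + h = a c - 4 is a gap, so admissibility puts v in Delta, and the first
   alternative holds. *)
have E : (a c = v + a 2)%N by lia.
rewrite orbF; move: adm; rewrite /Dl.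
have -> : ((v + h) %% 4 = c)%N by lia.
have -> : (v %% 4 = 4 - c)%N by lia.
by case/orP; lia.
Qed.

(** Among h + 1, h + 2, h + 3 the odd ones test a 3 and a 1 against a 2. Among the four numbers from
    h + n on, the even ones are in Delta since n is at least 2u, and the odd ones test a 1 and a 3
    against a 2 + n. *)
Lemma jump_even : jump u v a h =
  (\sum_(j < 4) ~~ (Dl a (h + j)%N || ((h + j)%N == h)))%N%:Z -
  (\sum_(j < 4) ~~ (Dl a (h + n + j)%N || ((h + n + j)%N == h)))%N%:Z.
Proof.
have [m0 m1 m2 m3] := mod4_gens ga.
have n2 : (n %% 2 = 1)%N by rewrite modn2 n_odd.
have n0 : (0 < n)%N by clear -n2; lia.
have l2 := gens2 ga.
rewrite /jump h2 eqxx !pair_defectE //; have := ah; rewrite h2 => a2h.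
have first4 : (\sum_(j < 4) ~~ (Dl a (h + j) || (h + j == h)) = (a 2 < a 3) + (a 2 < a 1))%N.
  rewrite (sum4 (fun j => ~~ (Dl a (h + j) || (h + j == h)))%N) new_gap0.
  rewrite (@new_gapE 3 (h + 1)) 1?(@new_gapE 0 (h + 2)) 1?(@new_gapE 1 (h + 3)) ?m0; try by clear -h2; lia.
  by rewrite a2h (@lt_class (a 3) (h + 1) (h + 4)) ?(@lt_class (a 1) (h + 3) (h + 4)) ?addn0 //;
    clear -h2 m1 m3; lia.
have next4 : (\sum_(j < 4) ~~ (Dl a (h + n + j) || (h + n + j == h)) =
    (a 2 + n <= a 1) + (a 2 + n <= a 3))%N.
  have ev k : (k %% 2 = 0)%N -> (2 * u <= k)%N -> ~~ (Dl a k || (k == h)) = false.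
    by move=> k2 uk; rewrite (Dl_even ga) // -eqb0 -modn2 k2.
  rewrite (sum4 (fun j => ~~ (Dl a (h + n + j) || (h + n + j == h)))%N).
  rewrite (ev (h + n + 1)%N) ?(ev (h + n + 3)%N); try by clear -h2 n2 n_ge; lia.
  have E x : (a 2 + n <= x)%N = (h + n + 3 < x)%N by rewrite a2h; clear; lia.
  rewrite !E.
  have [nc|nc] : (n %% 4 = 1)%N \/ (n %% 4 = 3)%N by clear -n2; lia.
    rewrite (@new_gapE 3 (h + n + 0)) 1?(@new_gapE 1 (h + n + 2)); try by clear -h2 nc n0; lia.
    rewrite (@lt_class (a 3) (h + n + 0) (h + n + 3)) ?(@lt_class (a 1) (h + n + 2) (h + n + 3));
      by clear -h2 nc m1 m3; lia.
  rewrite (@new_gapE 1 (h + n + 0)) 1?(@new_gapE 3 (h + n + 2)); try by clear -h2 nc n0; lia.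
  rewrite (@lt_class (a 1) (h + n + 0) (h + n + 3)) ?(@lt_class (a 3) (h + n + 2) (h + n + 3));
    by clear -h2 nc m1 m3; lia.
rewrite first4 next4 !PoszD opprD; ring.
Qed.

End Gaps.
End Jumps.

(** * The numerical condition forced by existing modules *)

Section Admissibility.
Context {K : fieldType}.
Variables (u v n : nat) (a0 : nat -> nat) (G : seq nat).
Hypothesis ga0 : generators u a0.
Hypothesis Dn0 : forall k, (n <= k)%N -> Dl a0 k.
Hypothesis v_odd : odd v.
Hypothesis ltuv : (2 * u < v)%N.
Hypothesis two_neq0 : 2%:R != 0 :> K.

Lemma chain_adm (M : nat -> set (pseries K)) : sorted ltn G ->
    (forall h, h \in G -> a0 (h %% 4)%N = (h + 4)%N) -> flag_chain u v n a0 G M ->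
  Dl (ast a0 G) v || Dl (ast a0 G) (v + ast a0 G 2).
Proof.
move=> sG Gnext ch.
have ex i d : exists y, Di a0 G i d -> reduced_at (M i) (Di a0 G i) d y.
  case: (boolP (Di a0 G i d)) => [Dd|_]; last by exists 0.
  have RM := chain_Rmod ch i.
  have [y yr] := reduced_exists (Rmod_subsp RM) (Rmod_tail RM) (chain_val ch i) Dd.
  by exists y.
have [rb rbP] : exists rb : nat -> nat -> pseries K,
    forall i d, Di a0 G i d -> reduced_at (M i) (Di a0 G i) d (rb i d).
  by exists (fun i d => projT1 (cid (ex i d))) => i d; apply: (projT2 (cid (ex i d))).
have rbM : reduced_bases a0 G M rb.
  split=> [i d /rbP[]|i d /rbP|i d /rbP[]|i d k /rbP[_ _ r] Dk kd] //.
    exact: (reduced_ord (chain_val ch i)).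
  exact: r.
by have [] := Xco_solves ga0 Dn0 sG Gnext v_odd ltuv two_neq0 ch rbM.
Qed.

End Admissibility.

Lemma module_adm (K : fieldType) (u v n : nat) (a : nat -> nat) (M : set (pseries K)) :
    generators u a -> (forall k, (n <= k)%N -> Dl a k) -> odd v -> (2 * u < v)%N ->
    2%:R != 0 :> K -> Rmodule u v n M -> (forall k, valset M k <-> Dl a k) ->
  Dl a v || Dl a (v + a 2).
Proof.
move=> ga Dn v_odd ltuv two_neq0 RM vM.
apply: (chain_adm (G := [::]) ga Dn v_odd ltuv two_neq0 (M := fun=> M)) => //.
split=> [_|i k|i j _] //.
by rewrite /Di take_oversize // orbF; exact: vM.
Qed.

(** * Dimensions and the values of mu *)

Section Dimensions.
Context {K : numFieldType}.
Variables (u v : nat).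
Hypothesis u_odd : odd u.
Hypothesis v_odd : odd v.
Hypothesis ltuv : (2 * u < v)%N.

Local Notation A := (ring4uv K u v).
Local Notation W := (delta A + delta A + 4)%N.

Let two_neq0 : 2%:R != 0 :> K.
Proof. by rewrite pnatr_eq0. Qed.

Lemma flag_has_dim m D0 (g : m.-tuple nat) a0 : flag_gens (K := K) u v D0 g a0 ->
    Dl (ast a0 g) v || Dl (ast a0 g) (v + ast a0 g 2) ->
  has_dim (J A D0 g) (flag_dim (K := K) u v g a0).
Proof.
move=> fg adm; apply: isomorphic_has_dim (J_isomorphic_affine u_odd v_odd ltuv two_neq0 fg adm) _.
exact: affine_space_has_dim (@horner_neq0_exists K) _.
Qed.

Lemma admissible_adm D a : generators u a ->
    (forall k, (4 * u + v - 3 <= k)%N -> Dl a k) ->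
    (forall k, D k -> ~ valset A k) -> (forall k, (valset A `|` D) k <-> Dl a k) ->
  admissible A D -> Dl a v || Dl a (v + a 2).
Proof.
move=> ga tail dis aE [M st MD].
have [RM _] := (standard_Rmodule u_odd v_odd ltuv two_neq0 M).1 st.
apply: (module_adm ga tail v_odd ltuv two_neq0 RM) => k.
by rewrite ((standard_valset st dis).1 MD) -aE.
Qed.

Lemma flag_gens_nil m D0 (g : m.-tuple nat) a0 : flag_gens (K := K) u v D0 g a0 ->
  flag_gens (K := K) u v D0 [tuple] a0.
Proof.
case=> ga DlE tail sg next_ od dis; split=> //.
by move=> i k [Dk|//]; apply: (dis i); left.
Qed.

Lemma J0_has_dim m D0 (g : m.-tuple nat) a0 : flag_gens (K := K) u v D0 g a0 ->
  Dl a0 v || Dl a0 (v + a0 2) -> has_dim (J0 A D0) (free_count u v W a0).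
Proof.
move=> /flag_gens_nil fg adm0; have := flag_dimE u_odd v_odd ltuv two_neq0 fg adm0 adm0.
rewrite big_nil addr0 => -[<-].
exact: flag_has_dim.
Qed.

Lemma flag_set0 m D0 (g : m.-tuple nat) : flag_set D0 g 0 = D0.
Proof. by rewrite /flag_set take0; apply/seteqP; split=> [k []//|k]; left. Qed.

Lemma flag_setS m D0 (g : m.-tuple nat) (i : 'I_m) :
  flag_set D0 g i.+1 = flag_set D0 g i `|` [set tnth g i].
Proof.
have sz : (i < size g)%N by rewrite size_tuple.
rewrite /flag_set (take_nth 0%N sz) -(tnth_nth 0%N) -setUA; congr setU.
apply/seteqP; split=> k /=; rewrite mem_rcons inE.
  by move=> /orP[/eqP->|]; [right|left].
by move=> [->|->]; rewrite ?eqxx ?orbT.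
Qed.

Lemma flag_set1 D h : flag_set D [tuple h] 1 = D `|` [set h].
Proof. by have := flag_setS D [tuple h] ord0; rewrite tnth0 flag_set0. Qed.

Section OneStep.
Variables (D : set nat) (h : nat).
Hypothesis DD : is_Dset A D.
Hypothesis Dadm : admissible A D.
Hypothesis nDh : ~ (valset A `|` D) h.
Hypothesis DhD : is_Dset A (D `|` [set h]).
Hypothesis Dhadm : admissible A (D `|` [set h]).

Lemma one_step_flag : is_flag A D [tuple h].
Proof.
split=> //.
  move=> x; rewrite inE => /eqP->; split; last by move=> Dh; apply: nDh; right.
  by move=> Ah; apply: nDh; left.
move=> [[|[|//]] ?]; first by rewrite flag_set0.
by rewrite flag_set1.
Qed.

Lemma one_step_adm a : flag_gens (K := K) u v D [tuple h] a ->
  (Dl a v || Dl a (v + a 2)) /\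
  (Dl (ast a [:: h]) v || Dl (ast a [:: h]) (v + ast a [:: h] 2)).
Proof.
move=> fg; have ga := fg_gens fg.
have dis k : (D `|` [set h]) k -> ~ valset A k.
  by rewrite -flag_set1; apply: (fg_disj fg).
have admD : Dl a v || Dl a (v + a 2).
  apply: (admissible_adm ga (fg_tail fg) _ (fg_Dl fg) Dadm).
  by move=> k Dk; apply: dis; left.
split=> //; case: (boolP (has2 a [:: h])) => h2; last first.
  by rewrite (_ : ast a _ = a) //; apply: funext => c; rewrite /ast (negbTE h2).
have gst := gast ga (fg_sorted fg) (fg_next fg).
have DlE k := Dl_ast ga (fg_sorted fg) (fg_next fg) k.
apply: (admissible_adm gst _ dis _ Dhadm) => k; first by move=> /(fg_tail fg) Dk; rewrite DlE Dk.
have g2h : g2 a = h by move: h2; rewrite /has2 inE => /eqP.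
have aE := fg_Dl fg k; rewrite DlE /= h2 g2h; split.
  move=> [Ak|[Dk|->]]; last by rewrite eqxx orbT.
    by rewrite aE.1 //; left.
  by rewrite aE.1 //; right.
by move=> /orP[/aE[]|/eqP->]; [left|right; left|right; right].
Qed.

(** Separate admissibility of D and of D with h adjoined is enough: it yields the numerical
    condition for both, and the parametrization then shows that the variety of nested pairs is a
    nonempty affine space. *)
Lemma has_mu_jump : exists2 a, flag_gens (K := K) u v D [tuple h] a &
  has_mu A D h (jump u v a h).
Proof.
have [a fg] := flag_gens_exist u_odd v_odd ltuv two_neq0 one_step_flag.
exists a => //; have [adm0 adm] := one_step_adm fg.
exists (flag_dim (K := K) u v [tuple h] a), (free_count u v W a); split.
- exact: flag_has_dim.
- exact: J0_has_dim fg adm0.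
- by rewrite (flag_dimE u_odd v_odd ltuv two_neq0 fg adm0 adm) big_seq1 addrC addKr.
Qed.

End OneStep.

Lemma admissible_flag_set m D0 (g : m.-tuple nat) (i : 'I_m.+1) :
  admissible_flag A D0 g -> admissible A (flag_set D0 g i).
Proof. by move=> [_ [M [_ std]]]; have [st Dst] := std i; exists (M i). Qed.

Lemma flag_jump m D0 (g : m.-tuple nat) a0 (i : 'I_m) :
    flag_gens (K := K) u v D0 g a0 -> admissible_flag A D0 g ->
  has_mu A (flag_set D0 g i) (tnth g i) (jump u v a0 (tnth g i)).
Proof.
move=> fg adm; have [[sg gg Dg] _] := adm; set h := tnth g i; set D := flag_set D0 g i.
have hg : h \in (g : seq nat) by exact: mem_tnth.
have im : (i < m.+1)%N by rewrite ltnS ltnW.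
have lt_h x : x \in take i g -> (x < h)%N.
  move=> xt; have xg := mem_take xt; rewrite in_take // in xt.
  have := sorted_ltn_nth ltn_trans 0%N sg; move=> /(_ (index x g) i).
  by rewrite !inE index_mem xg size_tuple ltn_ord nth_index // -(tnth_nth 0%N); apply.
have nDh : ~ (valset A `|` D) h.
  move=> [Ah|[Dh|/lt_h]]; last by rewrite ltnn.
    by have [] := gg h hg.
  by have [_] := gg h hg.
have [] := @has_mu_jump D h.
- exact: (Dg (Ordinal im)).
- exact: (admissible_flag_set (Ordinal im) adm).
- exact: nDh.
- by rewrite -flag_setS; exact: (Dg (lift ord0 i)).
- by rewrite -flag_setS; exact: (admissible_flag_set (lift ord0 i) adm).
move=> a fa; rewrite (@jump_eq u v a0 a) //.
- exact: fg_gens fg.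
- exact: (fg_next fg hg).
- by apply: (fg_next fa); rewrite inE.
have aE k : Dl a k <-> Dl a0 k \/ k \in take i g.
  rewrite -(fg_Dl fa) -(fg_Dl fg) /D /flag_set /=; split.
    by move=> [|[|]]; auto.
  by move=> [[|]|]; auto.
move=> c c4; have gac := gens_mod (fg_gens fa) c4.
have le : (a c <= a0 c)%N.
  by apply: (gens_le (fg_gens fg)) => // k Dk; apply/aE; left.
have /aE[|at_] : Dl a (a c) by rewrite /Dl gac.
  by rewrite /Dl gac => ge; left; apply/eqP; rewrite eqn_leq ge le.
have := fg_next fg (mem_take at_); rewrite gac => ->.
by right; have := lt_h _ at_; lia.
Qed.

Lemma flag_variety m D0 (g : m.-tuple nat) : admissible_flag A D0 g ->
  exists (N d0 : nat) (mu : 'I_m -> int),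
    [/\ has_dim (J0 A D0) d0,
        forall i : 'I_m, has_mu A (flag_set D0 g i) (tnth g i) (mu i),
        N%:Z = d0%:Z + \sum_(i < m) mu i
      & isomorphic (J A D0 g) [set: affine_space K N]].
Proof.
move=> adm; have [fl [M Mfl]] := adm.
have [a0 fg] := flag_gens_exist u_odd v_odd ltuv two_neq0 fl.
have tail k : (delta A + delta A <= k)%N -> Dl a0 k.
  by rewrite (delta_A u_odd v_odd ltuv two_neq0); apply: (fg_tail fg).
have adm1 := chain_adm (fg_gens fg) tail v_odd ltuv two_neq0 (fg_sorted fg)
  (fg_next fg) (chain_of_flags u_odd v_odd ltuv two_neq0 fg Mfl).
have adm0 : Dl a0 v || Dl a0 (v + a0 2).
  apply: (admissible_adm (fg_gens fg) (fg_tail fg) _ (fg_Dl fg)).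
    by move=> k Dk; apply: (fg_disj fg (i := 0%N)); rewrite flag_set0.
  by have := admissible_flag_set ord0 adm; rewrite flag_set0.
exists (flag_dim (K := K) u v g a0), (free_count u v W a0), (fun i => jump u v a0 (tnth g i)).
split.
- exact: J0_has_dim fg adm0.
- by move=> i; apply: flag_jump.
- by rewrite (flag_dimE u_odd v_odd ltuv two_neq0 fg adm0 adm1) big_tuple.
- exact: J_isomorphic_affine.
Qed.

Lemma mu_gap_counts D h :
    is_Dset A D -> admissible A D -> ~ (valset A `|` D) h ->
    is_Dset A (D `|` [set h]) -> admissible A (D `|` [set h]) ->
  let Delta := valset A `|` D in
  let Delta' := Delta `|` [set h] in
  let gap l : int := (gap_count Delta' l)%:Z in
  ((h %% 4 = 1)%N \/ (h %% 4 = 3)%N -> has_mu A D h (gap h - gap (h + 4)%N)) /\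
  ((h %% 4 = 2)%N -> forall n, smallest_odd u v Delta n ->
     has_mu A D h (gap h - gap (h + 4)%N - (gap (h + n)%N - gap (h + 4 + n)%N))).
Proof.
move=> DD Dadm nDh DhD Dhadm Delta Delta' gap.
have [a fg mu] := has_mu_jump DD Dadm nDh DhD Dhadm.
have ga := fg_gens fg; have ah := fg_next fg (mem_head h [::]).
have PE k : Delta' k <-> Dl a k || (k == h).
  split=> [[/(fg_Dl fg)->//|->]|/orP[/(fg_Dl fg)|/eqP->]]; first by rewrite eqxx orbT.
    by left.
  by right.
have PW k : (4 * u + v - 3 <= k)%N -> Dl a k || (k == h).
  by move=> /(fg_tail fg) ->.
split=> [h13|h2 n [[n_odd nD n_ge] n_min]].
  rewrite /gap (gap_count_diff h PE PW) -(@jump_odd u v a h ga ah) //.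
  by rewrite -[odd h]eqb1 -modn2; apply/eqP; case: h13; lia.
rewrite (addnAC h 4%N n) /gap (gap_count_diff h PE PW) (gap_count_diff (h + n) PE PW).
rewrite -(@jump_even u v a h) //.
- have [_] := one_step_adm Dadm Dhadm fg.
  have a2 : a 2%N = (h + 4)%N by rewrite -ah h2.
  have DlE k := Dl_ast ga (fg_sorted fg) (fg_next fg) k.
  have has2h : has2 a [:: h] by rewrite /has2 /g2 a2 addnK inE.
  have g2h : g2 a = h by rewrite /g2 a2 addnK.
  have -> : ast a [:: h] 2 = h by rewrite /ast has2h g2h.
  rewrite !DlE g2h.
  have v2 : (v %% 2 = 1)%N by rewrite modn2 v_odd.
  have -> : (v == h) = false by clear -v2 h2; apply/negbTE/eqP; lia.
  have -> : (v + h == h)%N = false by clear -v2 h2; apply/negbTE/eqP; lia.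
  by rewrite andbF !orbF.
- by case: nD => [/(fg_Dl fg)|]; auto.
- move=> k ok Dk uk; apply: n_min; split=> //.
  by case: Dk => [/(fg_Dl fg)|]; auto.
Qed.

End Dimensions.

Theorem theorem3p1 (R : realType) (u v : nat)
  (u_gt0 : (0 < u)%N) (v_gt0 : (0 < v)%N)
  (uv_odd : coprime (u * v) 2) (lt_2u_v : (2 * u < v)%N)
  (A : set (pseries (complex R))) (defA : A = ring4uv (complex R) u v) :
  (forall (m : nat) (D0 : set nat) (g : m.-tuple nat),
     admissible_flag A D0 g ->
     exists (N d0 : nat) (mu : 'I_m -> int),
       [/\ has_dim (J0 A D0) d0,
           forall i : 'I_m, has_mu A (flag_set D0 g i) (tnth g i) (mu i),
           N%:Z = d0%:Z + \sum_(i < m) mu i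
         & isomorphic (J A D0 g) [set: affine_space (complex R) N]])
  /\
  (forall (D : set nat) (h : nat),
     is_Dset A D -> admissible A D ->
     ~ (valset A `|` D) h ->
     is_Dset A (D `|` [set h]) -> admissible A (D `|` [set h]) ->
     let Delta := valset A `|` D in
     let Delta' := Delta `|` [set h] in
     let gap l : int := (gap_count Delta' l)%:Z in
     ((h %% 4 = 1)%N \/ (h %% 4 = 3)%N ->
        has_mu A D h (gap h - gap (h + 4)%N)) /\
     ((h %% 4 = 2)%N -> forall n, smallest_odd u v Delta n ->
        has_mu A D h (gap h - gap (h + 4)%N
                      - (gap (h + n)%N - gap (h + 4 + n)%N)))).
Proof.
have /andP[u_odd v_odd] : odd u && odd v by rewrite -oddM -coprimen2.
rewrite defA; split=> [m D0 g|D h]; first exact: (@flag_variety (complex R)).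
exact: (@mu_gap_counts (complex R)).
Qed.
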